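(* Suppose $(I_n^0,J_n^0)_{n\in\mathbb{Z}}$ is an i.i.d. sequence with marginal $\tilde\mu\times\mu=\mathrm{Gam}(\lambda_1+\lambda_2,c)\times\mathrm{Gam}(\lambda_1,c)$ (law of $I_n^0$ is $\tilde\mu$, of $J_n^0$ is $\mu$) for some $\lambda_1,\lambda_2>0$ and $c>0$. Then $\mathcal{T}_{dT}(I^0,J^0)\overset{d}{=}(I^0,J^0)$. Moreover, there are no other non-trivial measures for which $(I_n^0,J_n^0)_{n\in\mathbb{Z}}$ is i.i.d., with $I_n^0$ independent of $J_n^0$, and $\mathcal{T}_{dT}(I^0,J^0)\overset{d}{=}(I^0,J^0)$.
   Context: The discrete Toda equation: $(0,\infty)$-valued variables $(I_n^t,J_n^t,U_n^t)_{n,t\in\mathbb{Z}}$ with $I_n^{t+1}=J_n^t+U_n^t$, $J_n^{t+1}=I_{n+1}^tJ_n^t(I_n^{t+1})^{-1}$, $U_{n+1}^t=I_{n+1}^tU_n^t(I_n^{t+1})^{-1}$ for all $n,t$. For initial data $(I^0,J^0)\in((0,\infty)^2)^{\mathbb{Z}}$ for which there is a unique family $(I_n^t,J_n^t,U_n^t)_{n,t\in\mathbb{Z}}$ solving these equations, $\mathcal{T}_{dT}(I^0,J^0):=(I^1,J^1)$; the invariance statement includes that such unique solvability holds almost surely. ''Non-trivial'' means the marginals are not both Dirac masses. $\mathrm{Gam}(\lambda,c)$ has density proportional to $x^{\lambda-1}e^{-cx}\mathbf{1}_{(0,\infty)}(x)$. *)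

(* Defs.v *)
From HB Require Import structures.
From mathcomp Require Import all_boot all_order all_algebra.
From mathcomp Require Import all_classical all_reals all_analysis.
Set Implicit Arguments. Unset Strict Implicit. Unset Printing Implicit Defensive.
Import Order.TTheory GRing.Theory Num.Theory.
Local Open Scope classical_set_scope.
Local Open Scope ring_scope.

Section Defs.
Variable R : realType.

Definition toda_sol (I J U : int -> int -> R) : Prop :=
  forall n t : int,
    [/\ 0 < I n t, 0 < J n t & 0 < U n t] /\
    [/\ I n (t + 1) = J n t + U n t,
        J n (t + 1) = I (n + 1) t * J n t / I n (t + 1)
      & U (n + 1) t = I (n + 1) t * U n t / I n (t + 1)].

(** [toda_step I0 J0 I1 J1]: there is a unique family (I,J,U) solving the
    discrete Toda equation with initial data (I^0,J^0) = (I0,J0), and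
    T_dT(I0,J0) := (I^1,J^1) equals (I1,J1). *)
Definition toda_step (I0 J0 I1 J1 : int -> R) : Prop :=
  exists I J U : int -> int -> R,
    [/\ toda_sol I J U,
        (forall n, I n 0 = I0 n /\ J n 0 = J0 n),
        (forall I' J' U', toda_sol I' J' U' ->
            (forall n, I' n 0 = I0 n /\ J' n 0 = J0 n) ->
            [/\ I' = I, J' = J & U' = U])
      & (forall n, I n 1 = I1 n /\ J n 1 = J1 n)].

Definition gam_dens (lam c : R) (x : R) : R :=
  if 0 < x then x `^ (lam - 1) * expR (- (c * x)) else 0.

Definition gamma_prob (lam c : R) (A : set R) : \bar R :=
  ((\int[@lebesgue_measure R]_(x in A) (gam_dens lam c x)%:E) *
   ((fine (\int[@lebesgue_measure R]_(x in setT) (gam_dens lam c x)%:E))^-1)%:E)%E.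

Context {d : measure_display} {T : measurableType d} (P : probability T R).

Definition rect_event (X Y : int -> T -> R) (s : seq int) (A B : int -> set R)
  : set T := [set w | forall n, n \in s -> A n (X n w) /\ B n (Y n w)].

Definition pairs_independent (X Y : int -> T -> R) : Prop :=
  forall (s : seq int) (A B : int -> set R), uniq s ->
    (forall n, measurable (A n) /\ measurable (B n)) ->
    P (rect_event X Y s A B) =
      (\big[*%E/1%E]_(n <- s) P (X n @^-1` A n `&` Y n @^-1` B n))%E.

Definition pairs_identically_distributed (X Y : int -> T -> R) : Prop :=
  forall n (A B : set R), measurable A -> measurable B ->
    P (X n @^-1` A `&` Y n @^-1` B) = P (X 0 @^-1` A `&` Y 0 @^-1` B).

(** Equality in law of the two sequences of pairs (finite-dimensional
    rectangles, a generating pi-system of the product sigma-algebra). *)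
Definition same_law_pairs (X Y X' Y' : int -> T -> R) : Prop :=
  forall (s : seq int) (A B : int -> set R),
    (forall n, measurable (A n) /\ measurable (B n)) ->
    P (rect_event X Y s A B) = P (rect_event X' Y' s A B).

(** T_dT(X,Y) is a.s. well defined (unique solvability) and has the same
    law as (X,Y); (X1,Y1) are (measurable versions of) its components. *)
Definition toda_invariant (X Y : int -> {RV P >-> R}) : Prop :=
  exists X1 Y1 : int -> {RV P >-> R},
    {ae P, forall w, toda_step (fun n => X n w) (fun n => Y n w)
                               (fun n => X1 n w) (fun n => Y1 n w)} /\
    same_law_pairs (fun n => X1 n) (fun n => Y1 n)
                   (fun n => X n) (fun n => Y n).

Definition is_dirac_law (X : T -> R) : Prop :=
  exists a : R, forall A, measurable A -> P (X @^-1` A) = \d_a A.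

End Defs.

(* Main.v *)
Require Import Defs.
From HB Require Import structures.
From mathcomp Require Import all_boot all_order all_algebra.
From mathcomp Require Import all_classical all_reals all_analysis.
From mathcomp Require Import measurable_realfun zify ring lra.
Import Order.TTheory GRing.Theory Num.Theory.
Import numFieldNormedType.Exports.
Local Open Scope classical_set_scope.
Local Open Scope ring_scope.

(** Put V = 1/U.  The U-equation is the affine recursion
    V_{n+1} = (1 + J_n V_n) / I_{n+1}, whose unrolled form is the perpetuity
    sum_k (1/I_{n-k}) prod_{l<k} J_{n-l-1} / I_{n-l}.  If the ratio products
    are infinitely often at most 1, the next time step forces V to equal this
    sum, so U is a function of the past of the data; the half plane t < 0 is
    treated by space-time reversal, under which the equation is symmetric.
    For gamma data, the beta-gamma algebra shows that the local map
    (I, J, U) |-> (J + U, I J / (J + U), I U / (J + U)) preserves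
    Gam(l1 + l2) x Gam(l1) x Gam(l2); since U_n is independent of the data
    to its right, sweeping the local map along the lattice shows that the
    image is again i.i.d. with the same marginals.
    Conversely, for an invariant product law, U^0_0 is a function of the past
    of the data at time 0, hence independent of J^0_0, and by reversal U^0_1 is
    independent of (I^1_0, J^1_0).  As I^1_0 = J^0_0 + U^0_0 and
    J^1_0 / U^0_1 = J^0_0 / U^0_0, the sum and the ratio of the independent
    variables J^0_0 and U^0_0 are independent.  Lukacs' argument then turns the
    first two moment identities for the Laplace transforms into a linear ODE
    whose solutions are gamma transforms, or Dirac ones in the degenerate case. *)

(** An arbitrary invariant law comes with no moment condition, so the sign of the mean of log(J/I)
    cannot control the perpetuity. Its finiteness does instead: a positive solution of the affine
    recursion dominates the partial sums. Terms of a finite perpetuity tend to 0, and a ratio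
    product is such a term times a variable I of fixed law, so it tends to 0 in probability and is
    infinitely often at most 1. The row at one time cannot force V to equal the perpetuity, since
    adding a positive homogeneous solution gives another positive solution. The selection comes from
    time t + 1, where the terms are quadratic in V and an excess would keep them away from 0. Hence
    uniqueness is proved on half planes, by induction on time. For gamma data finiteness comes from
    stationarity: a chain started with the law of 1/U keeps this law, and it dominates the partial
    sums. Lukacs' argument is run with E[X^k e^(-sX)] at s > 0, which is finite for every positive
    X. *)

Set Implicit Arguments.
Unset Strict Implicit.
Unset Printing Implicit Defensive.

(** * Measure-theoretic preliminaries *)

Section measurability.
Context {R : realType}.

Lemma measurable_invr : measurable_fun [set: R] (@GRing.inv R).
Proof.
have -> : [set: R] = [set x : R | x != 0] `|` [set 0].
  by rewrite predeqE => x; split=> // _; case: (eqVneq x 0); [right|left].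
have o : open [set x : R | x != 0] by exact: open_neq.
apply/measurable_funU => //; first exact: open_measurable.
split; last exact: measurable_fun_set1.
apply: open_continuous_measurable_fun => // x /set_mem /= x0.
exact: inv_continuous.
Qed.

Context d (T : measurableType d).
Implicit Types f g : T -> R.

Lemma measurable_fun_invr f : measurable_fun setT f ->
  measurable_fun setT (fun x => (f x)^-1).
Proof. exact: measurableT_comp measurable_invr. Qed.

Lemma measurable_fun_divr f g : measurable_fun setT f -> measurable_fun setT g ->
  measurable_fun setT (fun x => f x / g x).
Proof. by move=> mf /measurable_fun_invr; exact: measurable_funM. Qed.

Lemma measurable_preimage d' (U : measurableType d') (X : T -> U) (A : set U) :
  measurable_fun setT X -> measurable A -> measurable (X @^-1` A).
Proof. by move=> mX mA; rewrite -[X in measurable X]setTI; exact: mX. Qed.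

End measurability.

Section restricted_law.
Context {R : realType} {d d'} {T : measurableType d} {U : measurableType d'}.
Variables (P : {measure set T -> \bar R}) (F : set T) (mF : measurable F).
Variables (X : T -> U) (mX : measurable_fun setT X).

(** The unnormalised law of [X] on the event [F]; with [F] the whole space it is the plain law.
    Being a measure in the target variable, it turns identities between probabilities of joint
    events into equalities of measures, to which the uniqueness lemmas below apply. *)
Definition restr_law : {measure set U -> \bar R}.
Proof. by refine [the {measure set U -> \bar R} of pushforward (mrestr P mF) X]. Defined.

Lemma restr_lawE A : restr_law A = P (X @^-1` A `&` F).
Proof. by []. Qed.

End restricted_law.

(** Rays form a pi-system generating the Borel sets; laws can therefore be compared through their
    tail functions. *)
Lemma ray_measure_unique {R : realType} (m1 m2 : {measure set R -> \bar R}) :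
  (m1 setT < +oo)%E -> (forall x, m1 `]x, +oo[%classic = m2 `]x, +oo[%classic) ->
  forall A, measurable A -> m1 A = m2 A.
Proof.
move=> m1T m12 A mA.
apply: (measure_unique (@RGenOInfty.G R)
  (fun n : nat => `](- n%:R), +oo[%classic)) => //.
- exact: RGenOInfty.measurableE.
- move=> _ _ [x ->] [y ->]; exists (Num.max x y).
  by rewrite predeqE => z /=; rewrite !in_itv/= !andbT gt_max;
    split=> [[-> ->]|/andP].
- by move=> n; exists (- n%:R).
- rewrite predeqE => x; split=> // _.
  exists (Num.bound `|x|) => //=; rewrite in_itv/= andbT ltrNl.
  by rewrite (le_lt_trans (ler_norm _))// normrN archi_boundP.
- by move=> _ [x ->].
- move=> n; apply: le_lt_trans m1T.
  by apply: le_measure; rewrite ?inE.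
Qed.

Section product_uniqueness.
Context {R : realType}.

Lemma rectangle_measure_unique {d1 d2} {T1 : measurableType d1}
    {T2 : measurableType d2} (m1 m2 : {measure set (T1 * T2) -> \bar R}) :
  (m1 setT < +oo)%E ->
  (forall A B, measurable A -> measurable B -> m1 (A `*` B) = m2 (A `*` B)) ->
  forall S, measurable S -> m1 S = m2 S.
Proof.
move=> m1T m12 S mS.
pose C : set (set (T1 * T2)) :=
  [set C | exists A, measurable A /\ exists B, measurable B /\ C = A `*` B].
apply: (measure_unique C (fun=> setT)) => //.
- rewrite measurable_prod_measurableType //; congr (<<s _ >>).
  rewrite predeqE; split => [[A mA [B mB <-]]|[A [mA [B [mB ->]]]]].
    by exists A; split => //; exists B.
  by exists A => //; exists B.
- move=> /= _ _ [X1 [mX1 [X2 [mX2 ->]]]] [Y1 [mY1 [Y2 [mY2 ->]]]].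
  rewrite -setXI; exists (X1 `&` Y1); split; first exact: measurableI.
  by exists (X2 `&` Y2); split => //; exact: measurableI.
- move=> n; exists setT; split => //; exists setT; split => //.
  by rewrite setXTT.
- by rewrite bigcup_const.
- by move=> _ [A [mA [B [mB ->]]]]; exact: m12.
Qed.

(** Fixing the first side [A] as a restricting event leaves a measure on the last two coordinates,
    so uniqueness for two factors is used twice. *)
Lemma rectangle3_measure_unique {d1 d2 d3} {T1 : measurableType d1}
    {T2 : measurableType d2} {T3 : measurableType d3}
    (m1 m2 : {measure set (T1 * (T2 * T3)) -> \bar R}) :
  (m1 setT < +oo)%E ->
  (forall A B C, measurable A -> measurable B -> measurable C ->
     m1 (A `*` (B `*` C)) = m2 (A `*` (B `*` C))) ->
  forall S, measurable S -> m1 S = m2 S.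
Proof.
move=> m1T m12; apply: rectangle_measure_unique => // A S mA mS.
have mAT : measurable (A `*` [set: T2 * T3]) by exact: measurableX.
pose n (m : {measure set (T1 * (T2 * T3)) -> \bar R}) := restr_law m mAT (@measurable_snd _ _ T1 (T2 * T3)%type).
have nE m B : n m B = m (A `*` B).
  rewrite /n restr_lawE; congr (m _).
  by rewrite predeqE => -[x y] /=; split=> [[? []]|[]].
rewrite -!nE; apply: rectangle_measure_unique => //.
- rewrite /n restr_lawE; apply: le_lt_trans m1T.
  by apply: le_measure; rewrite ?inE// preimage_setT setTI.
- by move=> B C mB mC; rewrite !nE; exact: m12.
Qed.

End product_uniqueness.

Lemma ge0_integral_law {R : realType} {d d'} {T : measurableType d}
    {U : measurableType d'} (mu : {measure set T -> \bar R}) (X : T -> U)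
    (mX : measurable_fun setT X) (f : U -> \bar R) :
  measurable_fun setT f -> (forall x, (0 <= f x)%E) ->
  (\int[restr_law mu measurableT mX]_x f x = \int[mu]_x f (X x))%E.
Proof.
move=> mf f0; rewrite -(ge0_integral_pushforward mX mu (f := f) measurableT)//.
by apply: eq_measure_integral => A mA _; rewrite restr_lawE setIT.
Qed.

Section product_probability.
Context {R : realType} {d1 d2} {T1 : measurableType d1} {T2 : measurableType d2}.
Variables (P1 : probability T1 R) (P2 : probability T2 R).

Definition prodP : probability (T1 * T2)%type R := (P1 \x P2)%E.

Lemma prodPE A B : measurable A -> measurable B ->
  prodP (A `*` B) = (P1 A * P2 B)%E.
Proof. exact: product_measure1E. Qed.

Lemma ge0_integral_prodP (f : T1 * T2 -> \bar R) : measurable_fun setT f ->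
  (forall z, 0 <= f z)%E ->
  (\int[prodP]_z f z = \int[P1]_x \int[P2]_y f (x, y))%E.
Proof. exact: (fubini_tonelli1 (m1 := P1) (m2 := P2)). Qed.

Lemma ge0_integral_prodP2 (f : T1 * T2 -> \bar R) : measurable_fun setT f ->
  (forall z, 0 <= f z)%E ->
  (\int[prodP]_z f z = \int[P2]_y \int[P1]_x f (x, y))%E.
Proof. exact: (fubini_tonelli2 (m1 := P1) (m2 := P2)). Qed.

Lemma measurable_integral_r (f : T1 * T2 -> \bar R) : measurable_fun setT f ->
  (forall z, 0 <= f z)%E ->
  measurable_fun setT (fun x => \int[P2]_y f (x, y))%E.
Proof. exact: (measurable_fun_fubini_tonelli_F (m2 := P2)). Qed.

Lemma measurable_integral_l (f : T1 * T2 -> \bar R) : measurable_fun setT f ->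
  (forall z, 0 <= f z)%E ->
  measurable_fun setT (fun y => \int[P1]_x f (x, y))%E.
Proof. exact: (measurable_fun_fubini_tonelli_G (m1 := P1)). Qed.

End product_probability.

(** * Integration against densities and affine substitutions *)

Section density.
Import HBNNSimple.
Local Open Scope ereal_scope.
Context {R : realType} {d} {T : measurableType d}.
Variables (mu Q : {measure set T -> \bar R}) (g : T -> R).
Hypotheses (mg : measurable_fun setT g) (g0 : forall x, (0 <= g x)%R).
Hypothesis Qg : forall A, measurable A -> Q A = \int[mu]_(x in A) (g x)%:E.

Lemma ge0_integral_density (f : T -> \bar R) : measurable_fun setT f ->
  (forall x, 0 <= f x) -> \int[Q]_x f x = \int[mu]_x (f x * (g x)%:E).
Proof.
move=> mf f0; pose f_ := nnsfun_approx measurableT mf.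
have mgE : measurable_fun setT (EFin \o g) by exact/measurable_EFinP.
have g0E x : 0 <= (EFin \o g) x by rewrite lee_fin.
have fcvg x : (f_ n x)%:E @[n --> \oo] --> f x by apply: cvg_nnsfun_approx.
have fnd x n m : (n <= m)%N -> (f_ n x)%:E <= (f_ m x)%:E.
  by move=> nm; rewrite lee_fin; exact/lefP/nd_nnsfun_approx.
transitivity (limn (fun n => \int[Q]_x (f_ n x)%:E)).
  rewrite -monotone_convergence//.
  - by apply: eq_integral => x _; apply/esym/cvg_lim => //; exact: fcvg.
  - by move=> n; exact/measurable_EFinP.
  - by move=> n x _; rewrite lee_fin.
  - by move=> x _ n m; exact: fnd.
transitivity (limn (fun n => \int[mu]_x ((f_ n x)%:E * (g x)%:E))); last first.
  rewrite -monotone_convergence//.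
  - apply: eq_integral => x _; apply/cvg_lim => //.
    by apply: cvgeZr => //; exact: fcvg.
  - by move=> n; apply: emeasurable_funM => //; exact/measurable_EFinP.
  - by move=> n x _; rewrite mule_ge0 ?lee_fin.
  - by move=> x _ n m nm; rewrite lee_wpmul2r ?lee_fin// -lee_fin; exact: fnd.
congr (limn _); apply/funext => n.
under eq_integral do rewrite fimfunE -fsumEFin//.
rewrite ge0_integral_fsum//; last 2 first.
  - by move=> y; exact/measurable_EFinP/measurable_funM.
  - by move=> y x _; rewrite EFinM nnfun_muleindic_ge0.
under [in RHS]eq_integral.
  move=> x _; rewrite fimfunE -fsumEFin// ge0_mule_fsuml; last first.
    by move=> r; rewrite EFinM nnfun_muleindic_ge0.
  over.
rewrite [RHS]ge0_integral_fsum//; last 2 first.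
  - move=> r; apply: emeasurable_funM => //.
    exact/measurable_EFinP/measurable_funM.
  - move=> r x _; apply: mule_ge0; last exact: g0E.
    by rewrite EFinM nnfun_muleindic_ge0.
apply: eq_fsbigr => r _.
rewrite integralZl_indic_nnsfun//= integral_indic// setIT Qg//.
have [r0|r0] := ltP r 0%R.
  by rewrite preimage_nnfun0// integral_set0 mule0 integral0_eq// => x _;
    rewrite indic0 mulr0 mul0e.
rewrite integral_mkcond -ge0_integralZl//; last 2 first.
  by apply/(measurable_restrictT _ _).1 => //; exact: measurable_funTS.
  by move=> x _; apply: erestrict_ge0 => y _; rewrite lee_fin.
apply: eq_integral => x _; rewrite patchE indicE EFinM -muleA.
by case: ifPn => _; rewrite ?mul1e ?mul0e.
Qed.

End density.

Section lebesgue_affine.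
Context {R : realType}.
Local Notation mu := (@lebesgue_measure R).
Implicit Types f : R -> \bar R.

Lemma ge0_integral_translation f (a : R) : measurable_fun setT f ->
  (forall x, (0 <= f x)%E) -> (\int[mu]_x f (x + a)%R = \int[mu]_x f x)%E.
Proof.
move=> mf f0.
pose phi : measurableTypeR R -> measurableTypeR R := fun x => x + a.
have mphi : measurable_fun setT phi by exact: measurable_funD.
rewrite -(ge0_integral_law mu mphi)//.
apply: eq_measure_integral => A mA _; apply: esym; move: A mA.
apply: lebesgue_measure_unique => // _ [[x y] _ <-].
rewrite restr_lawE setIT /= (_ : phi @^-1` _ = `]x - a, y - a]%classic).
  by rewrite !lebesgue_measure_itv/= !lte_fin ltrD2r -!EFinB opprB addrA subrK.

by apply/seteqP; split=> z /=; rewrite !in_itv/= /phi ltrBlDr lerBrDr.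
Qed.

Lemma ge0_integral_dilation f (k : R) : 0 < k -> measurable_fun setT f ->
  (forall x, (0 <= f x)%E) ->
  (\int[mu]_x f x = k%:E * \int[mu]_x f (k * x)%R)%E.
Proof.
move=> k0 mf f0.
pose phi : measurableTypeR R -> measurableTypeR R := fun x => k * x.
have mphi : measurable_fun setT phi by exact: measurable_funM.
pose kn := NngNum (ltW k0).
rewrite -(ge0_integral_law mu mphi)//.
rewrite -[k]/(kn%:num) -(ge0_integral_mscale (restr_law mu measurableT mphi))//.
apply: eq_measure_integral => A mA _.
apply: lebesgue_measure_unique => // _ [[x y] _ <-].
rewrite [RHS](_ : _ = k%:E * mu (phi @^-1` `]x, y]))%E; last first.
  by rewrite -[in RHS](setIT (phi @^-1` _)).
rewrite (_ : phi @^-1` _ = `]x / k, y / k]%classic).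
  rewrite !lebesgue_measure_itv/= !lte_fin ltr_pM2r ?invr_gt0//.
  case: ifPn => _; last by rewrite mule0.
  by rewrite -!EFinB -EFinM -mulrBl mulrCA divff ?gt_eqF// mulr1.
apply/seteqP; split=> z /=; rewrite !in_itv/= /phi.
  by rewrite ltr_pdivrMr// ler_pdivlMr// mulrC.
by rewrite ltr_pdivrMr// ler_pdivlMr// mulrC.
Qed.

End lebesgue_affine.

(** * Gamma and beta distributions *)

Section gamma_beta.
Context {R : realType}.
Local Notation mu := (@lebesgue_measure R).

Lemma gam_dens_ge0 (l c x : R) : 0 <= gam_dens l c x.
Proof. by rewrite /gam_dens; case: ifPn => // _; rewrite mulr_ge0 ?powR_ge0 ?expR_ge0. Qed.

Lemma measurable_gam_dens (l c : R) : measurable_fun setT (gam_dens l c).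
Proof.
apply: measurable_fun_ifT => //; first exact: measurable_fun_ltr.
apply: measurable_funM; first exact: measurable_powR.
apply: measurableT_comp; first exact: measurable_expR.
by apply: measurableT_comp => //; exact: measurable_funM.
Qed.

Definition beta_dens (l1 l2 r : R) : R :=
  if (0 < r) && (r < 1) then r `^ (l1 - 1) * (1 - r) `^ (l2 - 1) else 0.

Lemma beta_dens_ge0 (l1 l2 r : R) : 0 <= beta_dens l1 l2 r.
Proof. by rewrite /beta_dens; case: ifPn => // _; rewrite mulr_ge0 ?powR_ge0. Qed.

Lemma measurable_beta_dens (l1 l2 : R) : measurable_fun setT (beta_dens l1 l2).
Proof.
apply: measurable_fun_ifT => //.
  by apply: measurable_and; exact: measurable_fun_ltr.
apply: measurable_funM; first exact: measurable_powR.
apply: (measurableT_comp (measurable_powR _)).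
exact: measurable_funB.
Qed.

(** With x = s r and y = s - s r the exponentials multiply to e^(-c s) and the powers separate; the
    leading [s] is the Jacobian of (s, r) |-> (x, y). *)
Lemma gam_dens_split (l1 l2 c s r : R) : 0 < s ->
  s * (gam_dens l1 c (s * r) * gam_dens l2 c (s - s * r)) =
  gam_dens (l1 + l2) c s * beta_dens l1 l2 r.
Proof.
move=> s0; rewrite /gam_dens /beta_dens s0 pmulr_rgt0//.
have [r0|r0] /= := ltP 0 r; last by rewrite mul0r !mulr0.
rewrite subr_gt0 gtr_pMr//.
have [r1|r1] := ltP r 1; last by rewrite !mulr0.
have -> : s - s * r = s * (1 - r) by ring.
have r1' : 0 < 1 - r by rewrite subr_gt0.
rewrite !powRM ?(ltW r0) ?(ltW s0) ?(ltW r1')//.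
have -> : expR (- (c * s)) = expR (- (c * (s * r))) * expR (- (c * (s * (1 - r)))).
  by rewrite -expRD; congr expR; ring.
have -> : s `^ (l1 + l2 - 1) = s * (s `^ (l1 - 1) * s `^ (l2 - 1)).
  rewrite -powRD; last by rewrite (gt_eqF s0) implybT.
  rewrite -{2}(powRr1 (ltW s0)) -powRD; last by rewrite (gt_eqF s0) implybT.
  by congr powR; ring.
by ring.
Qed.

(** The substitution s = x + y, r = x / s is made one coordinate at a time: a translation in y at
    fixed x, an exchange of the integrals, a dilation of x at fixed s. The content is that the sum
    and the share of two independent gamma variables are independent. *)
Lemma gamma_beta (l1 l2 c : R) (k : R * R -> \bar R) :
  measurable_fun setT k -> (forall z, 0 <= k z)%E ->
  (\int[mu]_x \int[mu]_y (k (x + y, x / (x + y))%R *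
     (gam_dens l1 c x * gam_dens l2 c y)%:E) =
   \int[mu]_s \int[mu]_r (k (s, r) *
     (gam_dens (l1 + l2) c s * beta_dens l1 l2 r)%:E))%E.
Proof.
move=> mk k0.
pose h (z : R * R) := (k (z.2, z.1 / z.2)%R
  * (gam_dens l1 c z.1 * gam_dens l2 c (z.2 - z.1)%R)%:E)%E.
have mh : measurable_fun setT h.
  apply: emeasurable_funM.
    apply: measurableT_comp => //; apply: measurable_fun_pair => //.
    by apply: measurable_fun_divr.
  apply/measurable_EFinP; apply: measurable_funM.
    by apply: measurableT_comp => //; exact: measurable_gam_dens.
  apply: measurableT_comp; first exact: measurable_gam_dens.
  by apply: measurable_funB.
have h0 z : (0 <= h z)%E.
  by rewrite mule_ge0// lee_fin mulr_ge0// gam_dens_ge0.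
transitivity (\int[mu]_x \int[mu]_s h (x, s))%E.
  apply: eq_integral => x _.
  have mhx : measurable_fun setT (fun s => h (x, s)).
    by apply: (measurableT_comp mh); exact: measurable_fun_pair.
  rewrite -(ge0_integral_translation x mhx (fun s => h0 (x, s))).
  apply: eq_integral => y _; rewrite /h /=.
  by rewrite (addrC y) (addrAC x) subrr add0r.
rewrite (fubini_tonelli (m1 := mu) (m2 := mu) h mh h0).
apply: eq_integral => s _.
have [s0|s0] := leP s 0.
  rewrite !integral0_eq// => x _.
    by rewrite [gam_dens (l1 + l2) c s]/gam_dens ltNge s0 mul0r mule0.
  rewrite /h /= /gam_dens; case: ifPn => [x0|_]; last by rewrite mul0r mule0.
  by rewrite subr_gt0 ltNge (le_trans s0 (ltW x0)) mulr0 mule0.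
have mhs : measurable_fun setT (fun x => h (x, s)).
  by apply: (measurableT_comp mh); exact: measurable_fun_pair.
rewrite (ge0_integral_dilation s0 mhs (fun x => h0 (x, s))).
have mhs' : measurable_fun setT (fun x : measurableTypeR R => h (s * x, s)).
  by apply: (measurableT_comp mhs); exact: measurable_funM.
rewrite -ge0_integralZl; first last.
- by rewrite lee_fin ltW.
- by move=> x _; exact: h0.
- exact: mhs'.
- exact: measurableT.
apply: eq_integral => r _; rewrite /h /= muleCA -EFinM gam_dens_split//.
by rewrite mulrAC divff ?gt_eqF// mul1r.
Qed.

End gamma_beta.

(** * Normalising constants and gamma measures *)

Section gamma_mass.
Context {R : realType}.
Local Notation mu := (@lebesgue_measure R).
Implicit Types l c s : R.

Definition gam_mass l c : \bar R := (\int[mu]_x (gam_dens l c x)%:E)%E.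

Lemma continuous_powR_gt0 l (x : R) : 0 < x -> {for x, continuous (@powR R ^~ l)}.
Proof.
move=> x0; apply: differentiable_continuous; apply/derivable1_diffP.
by apply: derivable_powR; rewrite in_itv/= andbT.
Qed.

(** The primitive x^l / l gives (1 - a^l) / l. The bound is uniform in [a], which permits a -> 0
    even if the integrand is unbounded at 0. *)
Lemma integral_powR_itv l (a : R) : 0 < l -> 0 < a < 1 ->
  (\int[mu]_(x in `[a, 1%R]) (x `^ (l - 1))%:E <= (l^-1)%:E)%E.
Proof.
move=> l0 /andP[a0 a1].
rewrite (@continuous_FTC2 _ _ (fun x => l^-1 * x `^ l) a 1 a1); first last.
- move=> x; rewrite in_itv/= => /andP[ax _].
  have x0 : 0 < x by exact: lt_trans ax.
  rewrite derive1Ml; last first.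
    by apply: derivable_powR; rewrite in_itv/= andbT.
  rewrite powR_derive1 ?in_itv/= ?x0//.
  by rewrite mulrA mulVf ?gt_eqF// mul1r.
- have cF x : 0 < x -> {for x, continuous (fun x : R => l^-1 * x `^ l)}.
    move=> x0; apply: cvgM; first exact: cvg_cst.
    exact: continuous_powR_gt0.
  split.
  + move=> x; rewrite in_itv/= => /andP[ax _].
    apply: derivableM => //; apply: derivable_powR.
    by rewrite in_itv/= andbT (lt_trans a0).
  + by apply: cvg_at_right_filter; exact: cF.
  + by apply: cvg_at_left_filter; exact: cF.
- apply: continuous_in_subspaceT => x; rewrite inE/= in_itv/= => /andP[ax _].
  by apply: continuous_powR_gt0; rewrite (lt_le_trans a0).
rewrite -EFinB lee_fin powR1 mulr1 gerBl mulr_ge0 ?powR_ge0// invr_ge0 ltW//.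
Qed.

Lemma integral_powR_fin l : 0 < l ->
  (\int[mu]_(x in `]0%R, 1%R]) (x `^ (l - 1))%:E < +oo)%E.
Proof.
move=> l0; apply: le_lt_trans (ltry l^-1).
(* The intervals start at 1/(n+2) because the bound on [[a, 1]] asks for a < 1. *)
have <- : \bigcup_n `[n.+2%:R^-1, 1]%classic = `]0, 1]%classic :> set R.
  apply/seteqP; split=> x /=.
    by move=> [n _] /=; rewrite !in_itv/= => /andP[nx ->]; rewrite andbT (lt_le_trans _ nx).
  rewrite in_itv/= => /andP[x0 x1].
  exists (Num.bound x^-1) => //=; rewrite in_itv/= x1 andbT.
  rewrite invf_ple// ?posrE//; apply: ltW.
  rewrite (lt_trans (archi_boundP _)) ?ltr_nat// invr_ge0 ltW//.
have cv : (\int[mu]_(x in `[n.+2%:R^-1%R, 1%R]) (x `^ (l - 1))%:E)%E @[n --> \oo] -->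
    (\int[mu]_(x in \bigcup_n `[n.+2%:R^-1%R, 1%R]%classic) (x `^ (l - 1))%:E)%E.
  apply: ge0_nondecreasing_set_cvg_integral.
  - move=> n m nm; apply/subsetPset => x /=; rewrite !in_itv/= => /andP[nx ->].
    by rewrite andbT (le_trans _ nx)// lef_pV2 ?posrE// ler_nat !ltnS.
  - by [].
  - move=> n; apply/measurable_EFinP; apply: measurable_funTS.
    exact: measurable_powR.
  - by move=> n x _; rewrite lee_fin powR_ge0.
rewrite -(cvg_lim _ cv)//; apply: lime_le; first by apply: cvgP cv.
apply: nearW => n; apply: integral_powR_itv => //.
by rewrite invr_gt0 ltr0n/= invf_lt1// ltr1n.
Qed.

(** The substitution x -> k x. It reduces finiteness to rate 1, and with k = (c + s) / c it later
    evaluates the Laplace transform of a gamma law. *)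
Lemma gam_mass_scale l c (k : R) : 0 < k ->
  gam_mass l c = ((k `^ l)%:E * gam_mass l (c * k))%E.
Proof.
move=> k0; rewrite /gam_mass.
have mg c' : measurable_fun setT (fun x => (gam_dens l c' x)%:E).
  by apply/measurable_EFinP; exact: measurable_gam_dens.
have g0 c' x : (0 <= (gam_dens l c' x)%:E)%E by rewrite lee_fin gam_dens_ge0.
rewrite (ge0_integral_dilation k0 (mg c) (g0 c)).
rewrite -ge0_integralZl; first last.
- by rewrite lee_fin ltW.
- by move=> x _; exact: g0.
- by apply: (measurableT_comp (mg c)); exact: measurable_funM.
- exact: measurableT.
rewrite -ge0_integralZl; first last.
- by rewrite lee_fin powR_ge0.
- by move=> x _; exact: g0.
- exact: mg.
- exact: measurableT.
apply: eq_integral => x _; rewrite -!EFinM; congr EFin.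
rewrite /gam_dens pmulr_rgt0//; case: ifPn => [x0|_]; last by rewrite !mulr0.
rewrite powRM ?ltW// !mulrA; congr (_ * _ * _).
by rewrite -{1}(powRr1 (ltW k0)) -powRD ?(gt_eqF k0) ?implybT//; congr powR; ring.
Qed.

Lemma gam_dens_le l : exists C : R, 0 <= C /\ forall x, 1 < x ->
  gam_dens l 1 x <= C * exponential_pdf 2^-1 x.
Proof.
(* [L] bounds [l - 1] from above and is positive even for l = 1. From ln y < y at y = x / (2 L)
   follows L ln x <= x / 2 + L ln (2 L), so half of the decay of e^(-x) absorbs the power. The
   factor 2 in the witness cancels the rate 1/2 in the exponential density. *)
pose L := `|l - 1| + 1.
have L0 : 0 < L by rewrite ltr_wpDl.
exists (2 * expR (L * ln (2 * L))); split; first by rewrite mulr_ge0 ?expR_ge0.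
move=> x x1; have x0 : 0 < x by exact: lt_trans x1.
rewrite /gam_dens x0 (exponential_pdfE _ (ltW x0)) mul1r.
have -> : 2 * expR (L * ln (2 * L)) * (2^-1 * expR (- 2^-1 * x)) =
   expR (L * ln (2 * L)) * expR (- 2^-1 * x) by field.
rewrite -expRD /powR gt_eqF// -expRD. rewrite ler_expR.
have lx0 : 0 <= ln x by rewrite ln_ge0// ltW.
have lx : (l - 1) * ln x <= L * ln x.
  by rewrite ler_wpM2r// /L ler_wpDr// ler_norm.
have lxL : L * ln x <= x / 2 + L * ln (2 * L).
  have -> : x = (x / (2 * L)) * (2 * L) by rewrite divfK// gt_eqF// mulr_gt0.
  rewrite lnM ?posrE ?divr_gt0 ?mulr_gt0// mulrDr lerD2r.
  have -> : x / (2 * L) * (2 * L) / 2 = L * (x / (2 * L)) by field; rewrite gt_eqF.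
  by rewrite ler_pM2l// ltW// ln_sublinear// divr_gt0// mulr_gt0.
rewrite (le_trans (lerD lx (lexx _)))// (le_trans (lerD lxL (lexx _)))//.
by have -> : x / 2 + L * ln (2 * L) + - x = L * ln (2 * L) + - 2^-1 * x by field.
Qed.

Lemma gam_mass1_fin l : 0 < l -> (gam_mass l 1 < +oo)%E.
Proof.
move=> l0; have [C [C0 gC]] := gam_dens_le l.
pose f1 (x : R) := (((fun x => (x `^ (l - 1))%:E) \_ `]0%R, 1%R]) x)%E.
pose f2 (x : R) := (C%:E * (exponential_pdf 2^-1 x)%:E)%E.
have mp : measurable_fun setT (fun x : R => (x `^ (l - 1))%:E).
  by apply/measurable_EFinP; exact: measurable_powR.
have mf1 : measurable_fun setT f1.
  by apply/(measurable_restrictT _ _).1 => //; exact: measurable_funTS.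
have me : measurable_fun setT (fun x : R => (exponential_pdf 2^-1 x)%:E).
  by apply/measurable_EFinP; exact: measurable_exponential_pdf.
have e0 (x : R) : (0 <= (exponential_pdf 2^-1 x)%:E)%E.
  by rewrite lee_fin exponential_pdf_ge0.
have mf2 : measurable_fun setT f2 by apply: emeasurable_funM.
have f10 x : (0 <= f1 x)%E by apply: erestrict_ge0 => y _; rewrite lee_fin powR_ge0.
have f20 x : (0 <= f2 x)%E by rewrite mule_ge0.
have : (gam_mass l 1 <= \int[mu]_x (f1 x + f2 x))%E.
  apply: ge0_le_integral.
  - exact: measurableT.
  - by move=> x _; rewrite lee_fin gam_dens_ge0.
  - by apply/measurable_EFinP; exact: measurable_gam_dens.
  - exact: emeasurable_funD.
  - move=> x _; have [x1|x1] := ltP 1 x.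
      by rewrite (le_trans _ (leeDr _ (f10 x)))// lee_fin; exact: gC.
    have [x0|x0] := ltP 0 x; last first.
      by rewrite /gam_dens ltNge x0/= adde_ge0.
    rewrite (le_trans _ (leeDl _ (f20 x)))// /f1 patchE mem_set/= ?in_itv/= ?x0// lee_fin /gam_dens x0.
    by rewrite ler_piMr ?powR_ge0// mul1r -expR0 ler_expR lerNl oppr0 ltW.
move=> /le_lt_trans; apply; rewrite ge0_integralD//.
rewrite lte_add_pinfty//.
  by rewrite -integral_mkcond; exact: integral_powR_fin.
rewrite ge0_integralZl// integral_exponential_pdf ?mule1 ?ltry//.
Qed.

Lemma gam_mass_fin l c : 0 < l -> 0 < c -> (gam_mass l c < +oo)%E.
Proof.
move=> l0 c0; have ic0 : 0 < c^-1 by rewrite invr_gt0.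
rewrite (gam_mass_scale l c ic0) divff ?gt_eqF//.
by rewrite lte_mul_pinfty ?lee_fin ?powR_ge0// gam_mass1_fin.
Qed.

Lemma gam_mass_gt0 l c : 0 < l -> 0 < c -> (0 < gam_mass l c)%E.
Proof.
move=> l0 c0; rewrite lt0e integral_ge0 ?andbT => [|x _]; last first.
  by rewrite lee_fin gam_dens_ge0.
apply/eqP => g0.
have mg : measurable_fun setT (fun x => (gam_dens l c x)%:E).
  by apply/measurable_EFinP; exact: measurable_gam_dens.
have : (\int[mu]_x `|(gam_dens l c x)%:E| = 0)%E.
  rewrite -[RHS]g0; apply: eq_integral => x _.
  by rewrite gee0_abs// lee_fin gam_dens_ge0.
move=> /(ae_eq_integral_abs mu measurableT mg).1 [N [mN N0 NS]].
(* A zero integral makes the density vanish off a null set, but it is positive on ]0, 1], which has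
   measure 1. *)
have : (mu `]0%R, 1%R] <= mu N)%E.
  apply: le_measure; rewrite ?inE//= => x /=; rewrite ?in_itv/= => /andP[x0 _].
  apply: NS => /= /(_ Logic.I) /eqP; rewrite eqe /gam_dens x0.
  by rewrite mulf_eq0 gt_eqF ?powR_gt0// gt_eqF ?expR_gt0.
by rewrite N0 lebesgue_measure_itv/= lte_fin ltr01 oppr0 adde0 lee_fin ler10.
Qed.

Lemma gamma_probE l c A : gamma_prob l c A =
  ((\int[mu]_(x in A) (gam_dens l c x)%:E) * ((fine (gam_mass l c))^-1)%:E)%E.
Proof. by []. Qed.

Lemma gamma_prob_density l c A : measurable A ->
  gamma_prob l c A =
  (\int[mu]_(x in A) ((fine (gam_mass l c))^-1 * gam_dens l c x)%:E)%E.
Proof.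
move=> mA; rewrite gamma_probE muleC.
under [RHS]eq_integral do rewrite EFinM.
rewrite ge0_integralZl//.
- by apply/measurable_EFinP; apply: measurable_funTS; exact: measurable_gam_dens.
- by move=> x _; rewrite lee_fin gam_dens_ge0.
- rewrite lee_fin invr_ge0 fine_ge0//; apply: integral_ge0 => x _.
  by rewrite lee_fin gam_dens_ge0.
Qed.

Lemma gamma_prob_setT l c : 0 < l -> 0 < c -> gamma_prob l c setT = 1%E.
Proof.
move=> l0 c0; rewrite gamma_probE -/(gam_mass l c).
have := gam_mass_gt0 l0 c0; have := gam_mass_fin l0 c0.
case: (gam_mass l c) => // r _; rewrite lte_fin => r0 /=.
by rewrite -EFinM divff ?gt_eqF.
Qed.

Let gamma_prob0 l c : gamma_prob l c set0 = 0%E.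
Proof. by rewrite gamma_probE integral_set0 mul0e. Qed.

Let gamma_prob_ge0 l c A : (0 <= gamma_prob l c A)%E.
Proof.
have g0 B : (0 <= \int[mu]_(x in B) (gam_dens l c x)%:E)%E.
  by apply: integral_ge0 => x _; rewrite lee_fin gam_dens_ge0.
rewrite gamma_probE; apply: mule_ge0; first exact: g0.
by rewrite lee_fin invr_ge0; apply: fine_ge0; exact: g0.
Qed.

Let gamma_prob_sigma_additive l c : semi_sigma_additive (gamma_prob l c).
Proof.
have k0 : 0 <= (fine (gam_mass l c))^-1.
  rewrite invr_ge0 fine_ge0//; apply: integral_ge0 => x _.
  by rewrite lee_fin gam_dens_ge0.
move=> F mF tF mUF; apply: cvg_toP.
  by apply: ereal_nondecreasing_is_cvgn => m n mn; exact: lee_sum_nneg_natr.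
rewrite gamma_prob_density// ge0_integral_bigcup//.
- apply: congr_lim; apply/funext => n; apply: eq_bigr => i _.
  exact: gamma_prob_density.
- apply/measurable_EFinP; apply: measurable_funTS.
  by apply: measurable_funM => //; exact: measurable_gam_dens.
- by move=> x _; rewrite lee_fin mulr_ge0// gam_dens_ge0.
Qed.

HB.instance Definition _ l c := isMeasure.Build _ _ _ (gamma_prob l c)
  (gamma_prob0 l c) (@gamma_prob_ge0 l c) (@gamma_prob_sigma_additive l c).

Lemma ge0_integral_gamma_prob l c (f : R -> \bar R) : measurable_fun setT f ->
  (forall x, 0 <= f x)%E ->
  (\int[gamma_prob l c]_x f x =
   ((fine (gam_mass l c))^-1)%:E * \int[mu]_x (f x * (gam_dens l c x)%:E))%E.
Proof.
move=> mf f0.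
have k0 : 0 <= (fine (gam_mass l c))^-1.
  rewrite invr_ge0 fine_ge0//; apply: integral_ge0 => x _.
  by rewrite lee_fin gam_dens_ge0.
(* The identity carries [gamma_prob] to [measurableTypeR R], the type on which Lebesgue measure
   lives, so that the density lemma applies. *)
pose idR : R -> measurableTypeR R := idfun.
have midR : measurable_fun setT idR by exact: measurable_id.
rewrite -(@ge0_integral_law _ _ _ R _ (gamma_prob l c) idR midR f mf f0).
rewrite (@ge0_integral_density _ _ _ mu
  (restr_law (gamma_prob l c) measurableT midR)
  (fun x => (fine (gam_mass l c))^-1 * gam_dens l c x)); first last.
- by move=> x; exact: f0.
- exact: mf.
- by move=> A mA; rewrite restr_lawE setIT; exact: gamma_prob_density.
- by move=> x; rewrite mulr_ge0// gam_dens_ge0.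
- by apply: measurable_funM => //; exact: measurable_gam_dens.
rewrite -ge0_integralZl; first last.
- by rewrite lee_fin.
- by move=> x _; rewrite mule_ge0 ?lee_fin ?gam_dens_ge0.
- apply: emeasurable_funM => //.
  by apply/measurable_EFinP; exact: measurable_gam_dens.
- exact: measurableT.
by apply: eq_integral => x _; rewrite EFinM muleCA.
Qed.

End gamma_mass.

(** * The local Toda map on gamma laws *)

Section gamma_product.
Context {R : realType}.
Local Notation mu := (@lebesgue_measure R).
Local Notation g := gam_dens.
Local Notation k l c := (fine (gam_mass l c))^-1.

Lemma inv_gam_mass_ge0 (l c : R) : 0 <= k l c.
Proof.
rewrite invr_ge0 fine_ge0//; apply: integral_ge0 => x _.
by rewrite lee_fin gam_dens_ge0.
Qed.

Lemma measurable_gam_densE (l c : R) : measurable_fun setT (EFin \o g l c).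
Proof. by apply/measurable_EFinP; exact: measurable_gam_dens. Qed.

Lemma ge0_integral_gamma_prob2 (l1 l2 c : R) (f : R * R -> \bar R) :
  measurable_fun setT f -> (forall z, 0 <= f z)%E ->
  (\int[gamma_prob l1 c]_x \int[gamma_prob l2 c]_y f (x, y) =
   (k l1 c * k l2 c)%:E *
   \int[mu]_x \int[mu]_y (f (x, y) * (g l1 c x * g l2 c y)%:E))%E.
Proof.
move=> mf f0.
have mfx x : measurable_fun setT (fun y => f (x, y)).
  by apply: (measurableT_comp mf); exact: measurable_fun_pair.
pose h (z : R * R) := (f z * (g l2 c z.2)%:E)%E.
have mh : measurable_fun setT h.
  apply: emeasurable_funM => //.
  by apply/measurable_EFinP; apply: measurableT_comp => //; exact: measurable_gam_dens.
have h0 z : (0 <= h z)%E by rewrite mule_ge0// lee_fin gam_dens_ge0.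
have mH : measurable_fun setT (fun x => \int[mu]_y h (x, y))%E.
  exact: (measurable_fun_fubini_tonelli_F (m2 := mu) h mh h0).
have H0 x : (0 <= \int[mu]_y h (x, y))%E by apply: integral_ge0 => y _; exact: h0.
transitivity (\int[gamma_prob l1 c]_x ((k l2 c)%:E * \int[mu]_y h (x, y)))%E.
  apply: eq_integral => x _; rewrite ge0_integral_gamma_prob//; exact: mfx.
rewrite ge0_integral_gamma_prob; first last.
- by move=> x; rewrite mule_ge0 ?lee_fin ?inv_gam_mass_ge0.
- exact: emeasurable_funM.
rewrite EFinM -muleA; congr (_ * _)%E.
transitivity ((k l2 c)%:E * \int[mu]_x ((\int[mu]_y h (x, y)) * (g l1 c x)%:E))%E.
  rewrite -ge0_integralZl; first last.
  - by rewrite lee_fin inv_gam_mass_ge0.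
  - by move=> x _; rewrite mule_ge0 ?lee_fin ?gam_dens_ge0.
  - apply: emeasurable_funM; [exact: mH|exact: measurable_gam_densE].
  - exact: measurableT.
  by apply: eq_integral => x _; rewrite muleA.
congr (_ * _)%E; apply: eq_integral => x _.
rewrite muleC -ge0_integralZl; first last.
- by rewrite lee_fin gam_dens_ge0.
- by move=> y _; exact: h0.
- by apply: (measurableT_comp mh); exact: measurable_fun_pair.
- exact: measurableT.
by apply: eq_integral => y _; rewrite /h /= EFinM muleCA.
Qed.

End gamma_product.

Section gamma_step.
Context {R : realType}.
Local Notation mu := (@lebesgue_measure R).
Local Notation g := gam_dens.
Local Notation k l c := (fine (gam_mass l c))^-1.
Variables (l1 l2 c : R) (m12 m1 mv : probability R R).
Hypotheses (m12E : forall A, measurable A -> m12 A = gamma_prob (l1 + l2) c A)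
  (m1E : forall A, measurable A -> m1 A = gamma_prob l1 c A)
  (mvE : forall A, measurable A -> mv A = gamma_prob l2 c (@GRing.inv R @^-1` A)).

(** The preimage of A x B x C under the local map, in coordinates (v, (i, j)) with i for I_{n+1}, j
    for J_n and v for V_n = 1/U_n. The third output is V_{n+1} rather than U_{n+1}, to match the
    affine recursion. *)
Definition toda_map_set (A B C : set R) : set (R * (R * R)) :=
  [set z | A (z.2.2 + z.1^-1) /\ B (z.2.1 * z.2.2 / (z.2.2 + z.1^-1)) /\
           C ((1 + z.2.2 * z.1) / z.2.1)].

Lemma measurable_toda_map_set A B C : measurable A -> measurable B ->
  measurable C -> measurable (toda_map_set A B C).
Proof.
move=> mA mB mC.
have mv1 : measurable_fun setT (fun z : R * (R * R) => z.1).
  exact: measurable_fst.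
have mi : measurable_fun setT (fun z : R * (R * R) => z.2.1).
  exact: (measurableT_comp measurable_fst measurable_snd).
have mj : measurable_fun setT (fun z : R * (R * R) => z.2.2).
  exact: (measurableT_comp measurable_snd measurable_snd).
have ma : measurable_fun setT (fun z : R * (R * R) => z.2.2 + z.1^-1).
  by apply: measurable_funD => //; exact: measurable_fun_invr.
apply: measurableI; first exact: (measurable_preimage ma).
apply: measurableI.
  apply: (measurable_preimage (X := fun z : R * (R * R) => z.2.1 * z.2.2 / (z.2.2 + z.1^-1))) => //.
  by apply: measurable_fun_divr => //; exact: measurable_funM.
apply: (measurable_preimage (X := fun z : R * (R * R) => (1 + z.2.2 * z.1) / z.2.1)) => //.
apply: measurable_fun_divr => //; apply: measurable_funD => //.
exact: measurable_funM.
Qed.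

(** Beta-gamma algebra twice. At fixed I = i, the sum s = J + U is the new I and the share r = J / s
    is an independent beta variable, while the new J and U are i r and i (1 - r). As (i, r) is again
    an independent gamma and beta pair, the same identity read backwards makes i r and i (1 - r)
    independent with laws Gam(l1) and Gam(l2). The constants leaving at the first use return at the
    second, so the beta constant is never computed. *)
Lemma gamma_toda_map A B C : measurable A -> measurable B -> measurable C ->
  (prodP mv (prodP m12 m1) (toda_map_set A B C) = m12 A * m1 B * mv C)%E.
Proof.
move=> mA mB mC; have mS := measurable_toda_map_set mA mB mC.
set S := toda_map_set A B C in mS *.
pose F (z : R * (R * R)) : \bar R := (\1_S z)%:E.
have mF : measurable_fun setT F by apply/measurable_EFinP; exact: measurable_indic.
have F0 z : (0 <= F z)%E by rewrite lee_fin.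
pose H (i : R) : \bar R := (\int[m1]_j \int[mv]_v F (v, (i, j)))%E.
have mG : measurable_fun setT (fun z => \int[mv]_v F (v, z))%E.
  exact: (measurable_integral_l mv mF F0).
have G0 z : (0 <= \int[mv]_v F (v, z))%E by apply: integral_ge0 => x _; exact: F0.
have mH : measurable_fun setT H.
  exact: (measurable_integral_r m1 mG G0).
have H0 i : (0 <= H i)%E by apply: integral_ge0 => x _; exact: G0.
have -> : (prodP mv (prodP m12 m1) S = \int[m12]_i H i)%E.
  transitivity (\int[prodP mv (prodP m12 m1)]_z F z)%E.
    by have := integral_indic (prodP mv (prodP m12 m1)) measurableT mS; rewrite setIT.
  rewrite (ge0_integral_prodP2 _ _ mF F0).
  exact: (ge0_integral_prodP _ _ mG G0).
(* [mv] is the law of 1/U; [C'] is the event [C] expressed for U itself. *)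
pose C' := @GRing.inv R @^-1` C.
have mC' : measurable C' by exact: (measurable_preimage measurable_invr).
pose K (i : R) (z : R * R) : R := \1_A z.1 * (\1_B (i * z.2) * \1_C' (i * (1 - z.2))).
have m1_ (D : set R) d (T : measurableType d) (f : T -> R) : measurable D ->
    measurable_fun setT f -> measurable_fun setT (fun z => \1_D (f z) : R).
  by move=> mD mf; apply: (measurableT_comp _ mf); exact: measurable_indic.
have mi1 (D : set R) (i : R) d (T : measurableType d) (f : T -> R) : measurable D ->
    measurable_fun setT f -> measurable_fun setT (fun z => \1_D (i * f z) : R).
  by move=> mD mf; apply: m1_ => //; exact: measurable_funM.
have mK i : measurable_fun setT (EFin \o K i).
  apply/measurable_EFinP; apply: measurable_funM; first exact: m1_.
  by apply: measurable_funM; apply: mi1 => //; exact: measurable_funB.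
have K0 i z : (0 <= (EFin \o K i) z)%E by rewrite lee_fin !mulr_ge0.
pose a : \bar R := (\int[mu]_s (\1_A s * g (l1 + l2) c s)%:E)%E.
pose D (i : R) : \bar R :=
  (\int[mu]_r (\1_B (i * r) * \1_C' (i * (1 - r)) * beta_dens l1 l2 r)%:E)%E.
(* First use: at fixed i the integral splits into [a], for the new I, and [D i], for the other two
   outputs. *)
have HE (i : R) : 0 < i -> H i = ((k l1 c * k l2 c)%:E * (a * D i))%E.
  move=> i0.
  transitivity (\int[gamma_prob l1 c]_x \int[gamma_prob l2 c]_y F (y^-1%R, (i, x)))%E.
    transitivity (\int[gamma_prob l1 c]_x \int[mv]_v F (v, (i, x)))%E.
      by apply: eq_measure_integral => A' mA' _; exact: m1E.
    apply: eq_integral => x _.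
    have mFx : measurable_fun setT (fun v => F (v, (i, x))).
      by apply: (measurableT_comp mF); exact: measurable_fun_pair.
    rewrite -(ge0_integral_law (gamma_prob l2 c) measurable_invr mFx (fun v => F0 _)).
    apply: eq_measure_integral => A' mA' _.
    by rewrite restr_lawE setIT; exact: mvE.
  have mf2 : measurable_fun setT (fun z : R * R => F (z.2^-1, (i, z.1))).
    apply: (measurableT_comp mF); apply: measurable_fun_pair; last first.
      by apply: measurable_fun_pair => //; exact: measurable_fst.
    by apply: measurable_fun_invr; exact: measurable_snd.
  rewrite (ge0_integral_gamma_prob2 l1 l2 c mf2 (fun z => F0 _)); congr (_ * _)%E.
  transitivity (\int[mu]_x \int[mu]_y ((EFin \o K i) (x + y, x / (x + y))%R *
     (g l1 c x * g l2 c y)%:E))%E.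
    apply: eq_integral => x _; apply: eq_integral => y _ /=.
    rewrite /gam_dens; case: ifPn => [x0|_]; last by rewrite mul0r !mule0.
    case: ifPn => [y0|_]; last by rewrite mulr0 !mule0.
    congr (_ * _)%E; rewrite /F /K; congr EFin => /=.
    have xy0 : 0 < x + y by exact: addr_gt0.
    have -> : \1_C' (i * (1 - x / (x + y))) = \1_C ((1 + x * y^-1) / i) :> R.
      have -> z : \1_C' z = \1_C z^-1 :> R.
        by rewrite !indicE; congr (nat_of_bool _)%:R; apply/idP/idP; rewrite !inE.
      congr (\1_C _).
      by field; rewrite !gt_eqF//=; apply/andP; split=> //; rewrite addrC addKr gt_eqF.
    have -> : \1_B (i * (x / (x + y))) = \1_B (i * x / (x + y)) :> R by rewrite mulrA.
    rewrite !indicE -!natrM !mulnb; congr (_%:R); congr nat_of_bool.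
    apply/idP/idP; rewrite !inE /S /toda_map_set /= invrK.
      by move=> [? [? ?]]; apply/and3P; split; rewrite inE.
    by move=> /and3P; rewrite !inE => -[].
  rewrite (gamma_beta l1 l2 c (mK i) (K0 i)).
  have mDr : measurable_fun setT (fun r =>
      (\1_B (i * r) * \1_C' (i * (1 - r)) * beta_dens l1 l2 r)%:E).
    apply/measurable_EFinP; apply: measurable_funM; last exact: measurable_beta_dens.
    by apply: measurable_funM; apply: mi1 => //; exact: measurable_funB.
  transitivity (\int[mu]_s ((\1_A s * g (l1 + l2) c s)%:E * D i))%E.
    apply: eq_integral => s _; rewrite -ge0_integralZl; first last.
    - by rewrite lee_fin mulr_ge0// gam_dens_ge0.
    - by move=> r _; rewrite lee_fin !mulr_ge0// beta_dens_ge0.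
    - exact: mDr.
    - exact: measurableT.
    by apply: eq_integral => r _; rewrite /K /= -!EFinM; congr EFin; ring.
  rewrite ge0_integralZr; first last.
  - apply: integral_ge0 => r _.
    by rewrite lee_fin !mulr_ge0// beta_dens_ge0.
  - by move=> s _; rewrite lee_fin mulr_ge0// gam_dens_ge0.
  - apply/measurable_EFinP; apply: measurable_funM; last exact: measurable_gam_dens.
    exact: m1_.
  - exact: measurableT.
  by [].
have indicP (l : R) (E : set R) : measurable E ->
    gamma_prob l c E = ((k l c)%:E * \int[mu]_x ((\1_E x)%:E * (g l c x)%:E))%E.
  move=> mE; rewrite -ge0_integral_gamma_prob.
  - by have := integral_indic (gamma_prob l c) measurableT mE; rewrite setIT.
  - by apply/measurable_EFinP; exact: measurable_indic.
  - by move=> x; rewrite lee_fin.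
have a0 : (0 <= a)%E.
  by apply: integral_ge0 => s _; rewrite lee_fin mulr_ge0// gam_dens_ge0.
pose Q (z : R * R) : R := \1_B (z.1 * z.2) * \1_C' (z.1 * (1 - z.2)).
have mQ : measurable_fun setT (EFin \o Q).
  apply/measurable_EFinP; apply: measurable_funM; apply: m1_ => //.
    exact: measurable_funM.
  by apply: measurable_funM => //; exact: measurable_funB.
have Q0 z : (0 <= (EFin \o Q) z)%E by rewrite lee_fin mulr_ge0.
pose hD (z : R * R) := ((EFin \o Q) z * (g (l1 + l2) c z.1 * beta_dens l1 l2 z.2)%:E)%E.
have mhD : measurable_fun setT hD.
  apply: emeasurable_funM => //; apply/measurable_EFinP; apply: measurable_funM.
    by apply: measurableT_comp => //; exact: measurable_gam_dens.
  by apply: measurableT_comp => //; exact: measurable_beta_dens.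
have hD0 z : (0 <= hD z)%E.
  by rewrite mule_ge0// lee_fin mulr_ge0 ?gam_dens_ge0 ?beta_dens_ge0.
have mID : measurable_fun setT (fun i : R => \int[mu]_r hD (i, r))%E.
  exact: (measurable_fun_fubini_tonelli_F (m2 := mu) hD mhD hD0).
have HD i : (H i * (g (l1 + l2) c i)%:E =
    ((k l1 c * k l2 c)%:E * a) * \int[mu]_r hD (i, r))%E.
  have [i0|i0] := ltP 0 i; last first.
    rewrite {1}/gam_dens ltNge i0 mule0 integral0_eq ?mule0// => r _.
    by rewrite /hD /= /gam_dens ltNge i0 mul0r mule0.
  rewrite HE// -!muleA; congr (_ * (_ * _))%E; rewrite /D muleC -ge0_integralZl; first last.
  - by rewrite lee_fin gam_dens_ge0.
  - by move=> r _; rewrite lee_fin !mulr_ge0// beta_dens_ge0.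
  - apply/measurable_EFinP; apply: measurable_funM; last exact: measurable_beta_dens.
    by apply: measurable_funM; apply: mi1 => //; exact: measurable_funB.
  - exact: measurableT.
  by apply: eq_integral => r _; rewrite /hD /Q /= -!EFinM; congr EFin; ring.
have kk0 : (0 <= (k l1 c * k l2 c)%:E * a)%E.
  by rewrite mule_ge0// lee_fin mulr_ge0// inv_gam_mass_ge0.
transitivity (\int[gamma_prob (l1 + l2) c]_i H i)%E.
  by apply: eq_measure_integral => E mE _; exact: m12E.
rewrite ge0_integral_gamma_prob//.
have -> : (\int[mu]_i (H i * (g (l1 + l2) c i)%:E) =
    ((k l1 c * k l2 c)%:E * a) * \int[mu]_i \int[mu]_r hD (i, r))%E.
  rewrite -ge0_integralZl; first last.
  - exact: kk0.
  - by move=> i _; apply: integral_ge0 => r _; exact: hD0.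
  - exact: mID.
  - exact: measurableT.
  by apply: eq_integral => i _; exact: HD.
(* Second use, from right to left, with i in the role of the sum: [Q] tests i r and i (1 - r). *)
rewrite -(gamma_beta l1 l2 c mQ Q0).
have -> : (\int[mu]_x \int[mu]_y ((EFin \o Q) (x + y, x / (x + y))%R *
     (g l1 c x * g l2 c y)%:E) =
   \int[mu]_x \int[mu]_y ((\1_B x * \1_C' y)%:E * (g l1 c x * g l2 c y)%:E))%E.
  apply: eq_integral => x _; apply: eq_integral => y _ /=.
  rewrite /gam_dens; case: ifPn => [x0|_]; last by rewrite mul0r !mule0.
  case: ifPn => [y0|_]; last by rewrite mulr0 !mule0.
  have xy0 : 0 < x + y by exact: addr_gt0.
  congr (_ * _)%E; congr EFin; rewrite /Q /=; congr (\1_B _ * \1_C' _).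
    by field; rewrite gt_eqF.
  by field; rewrite gt_eqF.
have mBC : measurable_fun setT (fun z : R * R => (\1_B z.1 * \1_C' z.2 : R)%:E).
  by apply/measurable_EFinP; apply: measurable_funM; exact: m1_.
have BC0 (z : R * R) : (0 <= (\1_B z.1 * \1_C' z.2 : R)%:E)%E by rewrite lee_fin mulr_ge0.
have BC : ((k l1 c * k l2 c)%:E * \int[mu]_x \int[mu]_y ((\1_B x * \1_C' y)%:E *
    (g l1 c x * g l2 c y)%:E) = m1 B * mv C)%E.
  rewrite -(ge0_integral_gamma_prob2 l1 l2 c mBC BC0).
  have BE : m1 B = (\int[gamma_prob l1 c]_x (\1_B x)%:E)%E.
    by have := integral_indic (gamma_prob l1 c) measurableT mB; rewrite setIT => ->; exact: m1E.
  have CE : mv C = (\int[gamma_prob l2 c]_x (\1_C' x)%:E)%E.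
    by have := integral_indic (gamma_prob l2 c) measurableT mC'; rewrite setIT => ->; exact: mvE.
  pose e := (\int[gamma_prob l2 c]_x (\1_C' x)%:E)%E.
  have e0 : (0 <= e)%E by apply: integral_ge0 => y _; rewrite lee_fin.
  transitivity ((\int[gamma_prob l1 c]_x (\1_B x)%:E) * e)%E; last first.
    by congr (_ * _)%E; [exact: esym BE|exact: esym CE].
  transitivity (\int[gamma_prob l1 c]_x ((\1_B x)%:E * e))%E; last first.
    apply: ge0_integralZr; [exact: measurableT| | |exact: e0].
    - by apply/measurable_EFinP; exact: measurable_indic.
    - by move=> x _; rewrite lee_fin.
  apply: eq_integral => x _.
  transitivity (\int[gamma_prob l2 c]_y ((\1_B x)%:E * (\1_C' y)%:E))%E.
    by apply: eq_integral => y _.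
  apply: ge0_integralZl; [exact: measurableT| | |by rewrite lee_fin].
  - by apply/measurable_EFinP; exact: measurable_indic.
  - by move=> y _; rewrite lee_fin.
have aE : m12 A = ((k (l1 + l2) c)%:E * a)%E.
  by rewrite (m12E mA) (indicP _ _ mA); congr (_ * _)%E.
by rewrite aE -[RHS]muleA -BC -!muleA; congr (_ * _)%E; rewrite muleCA.
Qed.

End gamma_step.

(** * Chains driven by i.i.d. inputs *)

Section probability_tools.
Context {R : realType} {d} {T : measurableType d}.

Definition pr (P : set T -> \bar R) (A : set T) : R := fine (P A).

Lemma prE (P : probability T R) A : measurable A -> P A = (pr P A)%:E.
Proof. by move=> mA; rewrite /pr fineK// fin_num_measure. Qed.

Lemma pr_ge0 (P : {measure set T -> \bar R}) A : 0 <= pr P A.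
Proof. by rewrite fine_ge0. Qed.

Lemma pr_setT (P : probability T R) : pr P setT = 1.
Proof. by rewrite /pr probability_setT. Qed.

Lemma measurable_forall (p : pred nat) (Q : nat -> set T) :
  (forall k, measurable (Q k)) -> measurable [set w | forall k, p k -> Q k w].
Proof.
move=> mQ; rewrite [X in measurable X](_ : _ = \bigcap_(k in [set k | p k]) Q k).
  exact: bigcap_measurableType.
by apply/seteqP; split=> w /= H k; exact: H.
Qed.

End probability_tools.

Section chain.
Context {R : realType} {d} {T : measurableType d}.
Variables (P : probability T R) (m12 m1 mv : probability R R).
Hypothesis inv : forall A B C : set R, measurable A -> measurable B ->
  measurable C ->
  prodP mv (prodP m12 m1) (toda_map_set A B C) = (m12 A * m1 B * mv C)%E.
Variables (i j : nat -> T -> R) (v0 : T -> R).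
Hypotheses (mi : forall k, measurable_fun setT (i k))
  (mj : forall k, measurable_fun setT (j k)) (mv0 : measurable_fun setT v0).

(** [i k] plays I_{k+1} and [j k] plays J_k, the inputs that the local map meets at site k;
    [vchain k] plays 1/U_k. *)
Fixpoint vchain (k : nat) (w : T) : R :=
  if k is k'.+1 then (1 + j k' w * vchain k' w) / i k' w else v0 w.

Definition ichain k w := j k w + (vchain k w)^-1.
Definition jchain k w := i k w * j k w / ichain k w.

Lemma measurable_vchain k : measurable_fun setT (vchain k).
Proof.
elim: k => [|k IH] //=; apply: measurable_fun_divr => //.
by apply: measurable_funD => //; exact: measurable_funM.
Qed.

Lemma measurable_ichain k : measurable_fun setT (ichain k).
Proof. by apply: measurable_funD => //; apply: measurable_fun_invr; exact: measurable_vchain. Qed.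

Lemma measurable_jchain k : measurable_fun setT (jchain k).
Proof.
apply: measurable_fun_divr; last exact: measurable_ichain.
exact: measurable_funM.
Qed.

Variable K : nat.
Hypothesis base : forall (A B : nat -> set R) (C : set R),
  (forall k, measurable (A k)) -> (forall k, measurable (B k)) -> measurable C ->
  P [set w | (forall k, (k < K)%N -> A k (i k w) /\ B k (j k w)) /\ C (v0 w)] =
  (\prod_(k < K) (pr m12 (A k) * pr m1 (B k)) * pr mv C)%:E.

Let future A B N w := forall k, (N <= k < K)%N -> A k (i k w) /\ B k (j k w).
Let past A B N w := forall k, (k < N)%N -> A k (ichain k w) /\ B k (jchain k w).

(** The invariant of the sweep: after N sites the outputs on the left, the carrier 1/U_N and the
    untouched inputs on the right are still independent with the prescribed marginals. Treating site
    N replaces its triple (v, i, j) by the image under the local map, whose product law [inv]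
    preserves. *)
Lemma chain_invariance_aux N : (N <= K)%N ->
  forall (A B : nat -> set R) (C : set R),
  (forall k, measurable (A k)) -> (forall k, measurable (B k)) -> measurable C ->
  P [set w | past A B N w /\ C (vchain N w) /\ future A B N w] =
  (\prod_(k < K) (pr m12 (A k) * pr m1 (B k)) * pr mv C)%:E.
Proof.
elim: N => [_|N IH NK] A B C mA mB mC.
  rewrite -base//; congr (P _); apply/seteqP; split=> w /=.
    by move=> [_ [Cw H]]; split=> // k kK; apply: H.
  by move=> [H Cw]; split=> //; split=> // k kK; apply: H.
have mi' (k : nat) (D : set R) : measurable D -> measurable (i k @^-1` D).
  exact: measurable_preimage.
have mj' (k : nat) (D : set R) : measurable D -> measurable (j k @^-1` D).
  exact: measurable_preimage.
(* [Q] collects the constraints at all sites other than N, which the move at N leaves alone. *)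
pose Q := [set w | past A B N w /\ future A B N.+1 w].
have mQ : measurable Q.
  apply: measurableI; apply: measurable_forall => k.
    apply: measurableI; apply: measurable_preimage => //.
      exact: measurable_ichain.
    exact: measurable_jchain.
  by apply: measurableI; [exact: mi'|exact: mj'].
pose X w := (vchain N w, (i N w, j N w)).
have mX : measurable_fun setT X.
  apply: measurable_fun_pair; first exact: measurable_vchain.
  exact: measurable_fun_pair.
pose c := \prod_(k < K | val k != N) (pr m12 (A k) * pr m1 (B k)).
have c0 : 0 <= c by apply: prodr_ge0 => k _; rewrite mulr_ge0// pr_ge0.
have prodN (A' B' : nat -> set R) : (forall k, k != N -> A' k = A k /\ B' k = B k) ->
    \prod_(k < K) (pr m12 (A' k) * pr m1 (B' k)) =
    c * (pr m12 (A' N) * pr m1 (B' N)).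
  move=> AB; rewrite (bigD1 (Ordinal NK))//= mulrC; congr (_ * _).
  rewrite /c; apply: eq_big => [k|k /eqP kN] //=.
  have [|-> ->//] := AB k.
  by apply/eqP => kN'; apply: kN; apply/val_inj.
pose law := restr_law P mQ mX.
pose law' := [the {measure set _ -> \bar R} of
  mscale (NngNum c0) (prodP mv (prodP m12 m1))].
(* On [Q] the triple has [c] times the product law. The induction hypothesis says so only for boxes,
   while [toda_map_set] is not a box in these coordinates; hence the passage through equality of
   measures. *)
have lawE S : measurable S -> law S = law' S.
  move: S; apply: rectangle3_measure_unique.
    rewrite restr_lawE preimage_setT setTI.
    by rewrite (le_lt_trans (probability_le1 P mQ))// ltry.
  move=> D A0 B0 mD mA0 mB0; rewrite restr_lawE.
  pose A' k := if k == N then A0 else A k.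
  pose B' k := if k == N then B0 else B k.
  transitivity (P [set w | past A' B' N w /\ D (vchain N w) /\ future A' B' N w]).
    congr (P _); apply/seteqP; split=> w /=.
      move=> [[Dv [A0i B0j]] [pw fw]]; split; last split=> //.
        by move=> k kN; rewrite /A' /B' (ltn_eqF kN); exact: pw.
      move=> k /andP[Nk kK]; rewrite /A' /B'; case: eqVneq => [->//|kN].
      by apply: fw; rewrite ltn_neqAle eq_sym kN Nk.
    move=> [pw [Dv fw]]; split; last split.
    - by split=> //; have := fw N; rewrite leqnn NK /A' /B' eqxx => /(_ isT).
    - by move=> k kN; have := pw k kN; rewrite /A' /B' (ltn_eqF kN).
    - move=> k /andP[Nk kK]; have := fw k; rewrite (ltnW Nk) kK /A' /B' (gtn_eqF Nk).
      exact.
  have mA' k : measurable (A' k) by rewrite /A'; case: ifP.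
  have mB' k : measurable (B' k) by rewrite /B'; case: ifP.
  rewrite (IH (ltnW NK) A' B' D mA' mB' mD).
  rewrite prodN; last by move=> k kN; rewrite /A' /B' (negbTE kN).
  rewrite /law' /= /mscale /= prodPE//; last exact: measurableX.
  rewrite prodPE// (prE mv mD) (prE m12 mA0) (prE m1 mB0) -!EFinM /A' /B' eqxx.
  by congr EFin; ring.
transitivity (law (toda_map_set (A N) (B N) C)).
  rewrite restr_lawE; congr (P _); apply/seteqP; split=> w /=.
    move=> [pw [Cw fw]]; split.
      by have [? ?] := pw N (ltnSn N); split.
    split=> // k kN; apply: pw; exact: ltnW.
  move=> [[? [? ?]] [pw fw]]; split=> // k; rewrite ltnS leq_eqVlt.
  by move=> /predU1P[->//|]; exact: pw.
rewrite lawE; last exact: measurable_toda_map_set.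
rewrite prodN// /law' /= /mscale /= inv// !prE// -!EFinM.
by congr EFin; ring.
Qed.

Lemma chain_invariance (A B : nat -> set R) (C : set R) :
  (forall k, measurable (A k)) -> (forall k, measurable (B k)) -> measurable C ->
  P [set w | (forall k, (k < K)%N -> A k (ichain k w) /\ B k (jchain k w)) /\
             C (vchain K w)] =
  (\prod_(k < K) (pr m12 (A k) * pr m1 (B k)) * pr mv C)%:E.
Proof.
move=> mA mB mC; rewrite -(chain_invariance_aux (leqnn K))//; congr (P _).
apply/seteqP; split=> w /=; last by move=> [? []].
by move=> [pw Cw]; split=> //; split=> // k; rewrite ltnNge andbN.
Qed.

End chain.

(** * The perpetuity of past ratios *)

Section perpetuity.
Context {R : realType}.
Implicit Types a b : nat -> R.

Definition ratio a b k : R := \prod_(l < k) (b l / a l).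
Definition term a b k : R := ratio a b k / a k.
Definition psum a b K : R := \sum_(k < K) term a b k.
Definition pval a b : \bar R := limn (EFin \o psum a b).
(** [fine] sends an infinite sum to 0. Replacing 0 by 1 makes the value positive for all positive
    data, so that its inverse can always serve as U. *)
Definition perp a b : R := if fine (pval a b) == 0 then 1 else fine (pval a b).

Lemma ratioS a b k : ratio a b k.+1 = b 0 / a 0 * ratio (a \o S) (b \o S) k.
Proof. by rewrite /ratio big_ord_recl. Qed.

Lemma ratioSr a b k : ratio a b k.+1 = ratio a b k * (b k / a k).
Proof. by rewrite /ratio big_ord_recr. Qed.

Lemma psumSr a b K : psum a b K.+1 = psum a b K + term a b K.
Proof. by rewrite /psum big_ord_recr. Qed.

(** Splitting off the most recent site shows that the partial sums obey the same affine recursion as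
    V. *)
Lemma psumS a b K : psum a b K.+1 = (1 + b 0 * psum (a \o S) (b \o S) K) / a 0.
Proof.
rewrite /psum big_ord_recl /term /ratio big_ord0 mulrDl; congr (_ + _).
rewrite mulrAC mulr_sumr; apply: eq_bigr => k _.
by rewrite -/(ratio a b _) ratioS /= mulrA.
Qed.

Section positive.
Variables (a b : nat -> R).
Hypotheses (a0 : forall k, 0 < a k) (b0 : forall k, 0 < b k).

Lemma ratio_gt0 k : 0 < ratio a b k.
Proof. by apply: prodr_gt0 => l _; rewrite divr_gt0. Qed.

Lemma term_gt0 k : 0 < term a b k.
Proof. by rewrite divr_gt0// ratio_gt0. Qed.

Lemma psum_nd : {homo psum a b : m n / (m <= n)%N >-> m <= n}.
Proof.
by apply: (homo_leq _ le_trans) => // n; rewrite psumSr lerDl ltW// term_gt0.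
Qed.

Lemma is_cvg_psumE : cvgn (EFin \o psum a b).
Proof.
by apply: ereal_nondecreasing_is_cvgn => m n mn; rewrite lee_fin psum_nd.
Qed.

Lemma psum_le_pval K : ((psum a b K)%:E <= pval a b)%E.
Proof.
apply: lime_ge; first exact: is_cvg_psumE.
by exists K => // n /= Kn; rewrite lee_fin psum_nd.
Qed.

Lemma pval_gt0 : (0 < pval a b)%E.
Proof.
apply: lt_le_trans (psum_le_pval 1).
by rewrite lte_fin /psum big_ord1 term_gt0.
Qed.

Lemma perp_gt0 : 0 < perp a b.
Proof.
rewrite /perp; case: ifPn => // f0.
by rewrite lt0r f0/= fine_ge0// ltW// pval_gt0.
Qed.

Lemma pval_fin : (pval a b < +oo)%E -> pval a b = (perp a b)%:E.
Proof.
move=> fin; have f : pval a b \is a fin_num by rewrite ge0_fin_numE// ltW// pval_gt0.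
rewrite /perp -[LHS]fineK//; case: ifPn => // /eqP f0.
by have := pval_gt0; rewrite -[pval a b]fineK// f0 ltxx.
Qed.

Lemma psum_le_perp K : (pval a b < +oo)%E -> psum a b K <= perp a b.
Proof. by move=> /pval_fin fin; rewrite -lee_fin -fin psum_le_pval. Qed.

Lemma cvg_psum : (pval a b < +oo)%E -> psum a b @ \oo --> perp a b.
Proof.
move=> fin; have : (EFin \o psum a b) @ \oo --> (perp a b)%:E.
  by rewrite -pval_fin//; exact: is_cvg_psumE.
exact: fine_cvg.
Qed.

Lemma pval_le M : (forall K, psum a b K <= M) -> (pval a b <= M%:E)%E.
Proof.
move=> h; apply: lime_le; first exact: is_cvg_psumE.
by apply: nearW => n; rewrite lee_fin.
Qed.

Lemma cvg_term : (pval a b < +oo)%E -> term a b @ \oo --> 0.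
Proof.
move=> fin; have h := cvg_psum fin.
rewrite (_ : term a b = (fun k => psum a b k.+1 - psum a b k)).
  rewrite -(subrr (perp a b)); apply: cvgB => //.
  by rewrite -(cvg_shiftS (psum a b)) in h.
by apply/funext => k; rewrite psumSr addrC addKr.
Qed.

Lemma pval_ge x : (x%:E < pval a b)%E -> exists K, x < psum a b K.
Proof.
move=> xp; apply/not_existsP => h.
have /pval_le : forall K, psum a b K <= x by move=> K; rewrite leNgt; apply/negP/h.
by rewrite leNgt xp.
Qed.

End positive.

Lemma pval_shift a b : (forall k, 0 < a k) -> (forall k, 0 < b k) ->
  (pval a b < +oo)%E -> (pval (a \o S) (b \o S) < +oo)%E /\
    perp a b = (1 + b 0%N * perp (a \o S) (b \o S)) / a 0%N.
Proof.
move=> a0 b0 fin.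
have aS k : 0 < (a \o S) k by exact: a0.
have bS k : 0 < (b \o S) k by exact: b0.
have finS : (pval (a \o S) (b \o S) < +oo)%E.
  apply: le_lt_trans (ltry (a 0%N * perp a b / b 0%N)).
  apply: pval_le => // K; rewrite ler_pdivlMr//.
  have := psum_le_perp a0 b0 K.+1 fin; rewrite psumS ler_pdivrMr// => h.
  by rewrite mulrC (mulrC (a 0%N)) (le_trans _ h)// lerDr.
split=> //.
have h : psum a b n.+1 @[n --> \oo] --> perp a b.
  by rewrite (cvg_shiftS (psum a b)); exact: cvg_psum.
have h' : psum a b n.+1 @[n --> \oo] --> (1 + b 0%N * perp (a \o S) (b \o S)) / a 0%N.
  rewrite (_ : (fun n => psum a b n.+1) =
    (fun K => (1 + b 0%N * psum (a \o S) (b \o S) K) / a 0%N)); last first.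
    by apply/funext => K; rewrite psumS.
  apply: cvgMl; apply: cvgD; first exact: cvg_cst.
  by apply: cvgMr; exact: cvg_psum.
exact: cvg_unique h h'.
Qed.

End perpetuity.

(** * Positive solutions of the affine recursion *)

Section affine_recursion.
Context {R : realType}.
Implicit Types (I J V : int -> R) (n : int).

Definition pastI I n (k : nat) : R := I (n - k%:Z).
(** Shifted by one against [pastI], since V_n is built from I_n and J_{n-1}. *)
Definition pastJ J n (k : nat) : R := J (n - k%:Z - 1).

Lemma pastIS I n : pastI I n \o S = pastI I (n - 1).
Proof. by apply/funext => k; rewrite /pastI /=; congr I; rewrite intS; ring. Qed.

Lemma pastJS J n : pastJ J n \o S = pastJ J (n - 1).
Proof. by apply/funext => k; rewrite /pastJ /=; congr J; rewrite intS; ring. Qed.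

Definition toda_affine I J V := forall n, V (n + 1) = (1 + J n * V n) / I (n + 1).

Lemma toda_affine_unroll I J V : toda_affine I J V -> forall K n,
  V n = psum (pastI I n) (pastJ J n) K
        + ratio (pastI I n) (pastJ J n) K * V (n - K%:Z).
Proof.
move=> VE; elim=> [|K IH] n.
  by rewrite /psum /ratio !big_ord0 add0r mul1r subr0.
have {1}-> : n = n - 1 + 1 by rewrite subrK.
rewrite VE subrK psumS ratioS pastIS pastJS (IH (n - 1)) /pastI /pastJ !subr0.
have -> : n - 1 - K%:Z = n - K.+1%:Z by rewrite intS; ring.
by ring.
Qed.

(** The remainder of the unrolled recursion is positive. Hence the mere existence of a positive
    solution makes the perpetuity finite. *)
Lemma toda_affine_psum_le I J V n : (forall m, 0 < I m) -> (forall m, 0 < J m) ->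
  (forall m, 0 < V m) -> toda_affine I J V ->
  forall K, psum (pastI I n) (pastJ J n) K <= V n.
Proof.
move=> I0 J0 V0 VE K; rewrite [leRHS](toda_affine_unroll VE K) lerDl mulr_ge0 ?ltW//.
by apply: ratio_gt0 => k; rewrite ?I0 ?J0.
Qed.

(** By the recursion I1_m = I_{m+1} V_{m+1} / V_m and J1_m = J_m V_m / V_{m+1}, so the ratio product
    at the next time telescopes. The outcome is quadratic in V, while the remainder of the unrolled
    recursion is linear in it; uniqueness exploits this gap. *)
Lemma term_next I J V n k : (forall m, 0 < I m) -> (forall m, 0 < J m) ->
  (forall m, 0 < V m) -> toda_affine I J V ->
  let I1 := fun m => J m + (V m)^-1 in
  let J1 := fun m => I (m + 1) * J m / I1 m in
  term (pastI I1 n) (pastJ J1 n) k =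
  ratio (pastI I n) (pastJ J n) k * V (n - k%:Z) ^+ 2 / (V n * V (n + 1) * I (n + 1)).
Proof.
move=> I0 J0 V0 VE I1 J1.
have nz (x : R) : 0 < x -> x != 0 by move=> x0; rewrite gt_eqF.
have I1E m : I1 m = I (m + 1) * V (m + 1) / V m.
  rewrite /I1 VE; have := nz _ (I0 (m + 1)); have := nz _ (V0 m).
  by move=> ? ?; field; apply/andP.
have I10 m : 0 < I1 m by rewrite I1E divr_gt0// mulr_gt0.
have J1E m : J1 m = J m * V m / V (m + 1).
  rewrite /J1 I1E; have := nz _ (I0 (m + 1)); have := nz _ (V0 m).
  by have := nz _ (V0 (m + 1)); move=> ? ? ?; field; apply/and3P.
have ratioE : ratio (pastI I1 n) (pastJ J1 n) k =
    ratio (pastI I n) (pastJ J n) k *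
    (V (n - k%:Z) * V (n - k%:Z + 1) * I (n - k%:Z + 1))
    / (V n * V (n + 1) * I (n + 1)).
  elim: k => [|k IH].
    rewrite /ratio !big_ord0 subr0 mul1r divff// !mulf_neq0 ?nz//.
  rewrite !ratioSr IH /pastI /pastJ J1E I1E subrK.
  have -> : n - k.+1%:Z = n - k%:Z - 1 by rewrite intS; ring.
  rewrite subrK; set m := n - k%:Z.
  have := nz _ (V0 n); have := nz _ (V0 (n + 1)); have := nz _ (I0 (n + 1)).
  have := nz _ (V0 m); have := nz _ (V0 (m + 1)); have := nz _ (I0 (m + 1)).
  have := nz _ (I0 m).
  by move=> *; field; do ?[apply/andP; split].
rewrite /term ratioE /pastI I1E; set m := n - k%:Z.
have := nz _ (V0 n); have := nz _ (V0 (n + 1)); have := nz _ (I0 (n + 1)).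
have := nz _ (V0 m); have := nz _ (V0 (m + 1)); have := nz _ (I0 (m + 1)).
by move=> *; field; do ?[apply/andP; split].
Qed.

(* If the excess [V n - perp] were positive, the next time step would have
   perpetuity terms bounded below along the times where [ratio <= 1]. *)
Lemma toda_affine_unique I J V V1 n :
  (forall m, 0 < I m) -> (forall m, 0 < J m) ->
  (forall m, 0 < V m) -> (forall m, 0 < V1 m) -> toda_affine I J V ->
  let I1 := fun m => J m + (V m)^-1 in
  let J1 := fun m => I (m + 1) * J m / I1 m in
  toda_affine I1 J1 V1 ->
  (forall N, exists2 k, (N <= k)%N & ratio (pastI I n) (pastJ J n) k <= 1) ->
  V n = perp (pastI I n) (pastJ J n).
Proof.
move=> I0 J0 V0 V10 VE I1 J1 V1E io.
set a := pastI I n in io *; set b := pastJ J n in io *.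
have a0 k : 0 < a k by exact: I0.
have b0 k : 0 < b k by exact: J0.
have I10 m : 0 < I1 m by rewrite addr_gt0// invr_gt0.
have J10 m : 0 < J1 m by rewrite divr_gt0// mulr_gt0.
have fin : (pval a b < +oo)%E.
  apply: le_lt_trans (ltry (V n)); apply: pval_le => //.
  exact: toda_affine_psum_le.
have VD : perp a b <= V n.
  by rewrite -lee_fin -pval_fin//; apply: pval_le => //; exact: toda_affine_psum_le.
apply/eqP; rewrite eq_le VD andbT leNgt; apply/negP => VD'.
pose D := V n - perp a b; have D0 : 0 < D by rewrite subr_gt0.
pose c := V n * V (n + 1) * I (n + 1).
have c0 : 0 < c by rewrite !mulr_gt0.
pose a1 := pastI I1 n; pose b1 := pastJ J1 n.
have a10 k : 0 < a1 k by exact: I10.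
have b10 k : 0 < b1 k by exact: J10.
have fin1 : (pval a1 b1 < +oo)%E.
  apply: le_lt_trans (ltry (V1 n)); apply: pval_le => //.
  exact: toda_affine_psum_le.
have Dc : 0 < D ^+ 2 / c by rewrite divr_gt0// exprn_gt0.
have /cvgrPdist_lt /(_ _ Dc) [N _ HN] := cvg_term a10 b10 fin1.
have [k Nk r1] := io N.
have := HN k Nk; rewrite sub0r normrN gtr0_norm ?term_gt0// ltNge => /negP; apply.
rewrite term_next// -/a -/b ler_pM2r ?invr_gt0//.
have r0 : 0 < ratio a b k by exact: ratio_gt0.
(* Unrolling [V n] and bounding the partial sum by [perp] leaves the excess below the remainder. *)
have DV : D <= ratio a b k * V (n - k%:Z).
  by rewrite lerBlDr {1}(toda_affine_unroll VE k n) addrC lerD2l// psum_le_perp.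
have DVr : D ^+ 2 <= (ratio a b k * V (n - k%:Z)) ^+ 2.
  by rewrite ler_sqr ?nnegrE ?(ltW D0)// (le_trans (ltW D0)).
(* As ratio <= 1, ratio^2 V^2 <= ratio V^2, the numerator of the term at the next time. That term is
   thus at least D^2 / c, against its convergence to 0. *)
apply: (le_trans DVr); rewrite exprMn ler_wpM2r ?sqr_ge0//.
by rewrite expr2 ler_piMr// ltW.
Qed.

End affine_recursion.

(** * Real-valued probabilities and almost sure events *)

Section pr_theory.
Context {R : realType} {d} {T : measurableType d} (P : probability T R).
Implicit Types A B C : set T.

Lemma pr_le A B : measurable A -> measurable B -> A `<=` B -> pr P A <= pr P B.
Proof.
move=> mA mB AB; rewrite -lee_fin -!prE//.
by apply: le_measure; rewrite ?inE.
Qed.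

Lemma pr_leU A B C : measurable A -> measurable B -> measurable C ->
  A `<=` B `|` C -> pr P A <= pr P B + pr P C.
Proof.
move=> mA mB mC ABC; rewrite -lee_fin EFinD -!prE//.
apply: (le_trans _ (measureU2 P mB mC)).
by apply: le_measure; rewrite ?inE//; exact: measurableU.
Qed.

Lemma pr0_ae A : measurable A -> pr P A = 0 -> {ae P, forall w, ~ A w}.
Proof.
move=> mA pA; exists A; split=> //; first by rewrite prE// pA.
by move=> w /= /contrapT.
Qed.

Lemma ae_pr0 A : measurable A -> {ae P, forall w, ~ A w} -> pr P A = 0.
Proof.
move=> mA [N [mN PN NS]]; apply/eqP; rewrite eq_le pr_ge0 andbT.
rewrite -lee_fin -prE// -[X in (_ <= X)%E]PN; apply: le_measure; rewrite ?inE//.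
by move=> w Aw; apply: NS => /= /(_ Aw).
Qed.

Lemma pr_ae_eq A B : measurable A -> measurable B ->
  {ae P, forall w, A w <-> B w} -> P A = P B.
Proof.
move=> mA mB AB.
have h A' B' : measurable A' -> measurable B' -> {ae P, forall w, A' w <-> B' w} ->
    pr P A' <= pr P B'.
  move=> mA' mB' AB'; have mD : measurable (A' `\` B') by exact: measurableD.
  rewrite -[leRHS]addr0 -(ae_pr0 mD).
    by apply: pr_leU => // w A'w; have [|] := pselect (B' w); [left|right].
  by apply: filterS AB' => w h [A'w]; apply; exact/h.
rewrite !prE//; congr EFin; apply/eqP; rewrite eq_le !h//.
by apply: filterS AB => w ->.
Qed.

Lemma ae_countable (I : countType) (Q : I -> T -> Prop) :
  (forall i, {ae P, forall w, Q i w}) -> {ae P, forall w i, Q i w}.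
Proof.
move=> aeQ.
pose Q' (n : nat) (w : T) := if unpickle n is Some i then Q i w else True.
have : {ae P, forall w n, Q' n w}.
  apply/ae_foralln => n; rewrite /Q'; case: unpickle => [i|]; first exact: aeQ.
  exact: aeW.
by apply: filterS => w h i; have := h (pickle i); rewrite /Q' pickleK.
Qed.

Lemma pr_decreasing (E : nat -> set T) (e : R) : 0 < e ->
  (forall n, measurable (E n)) -> (forall n m, (n <= m)%N -> E m `<=` E n) ->
  {ae P, forall w, exists n, ~ E n w} ->
  exists N, forall n, (N <= n)%N -> pr P (E n) <= e.
Proof.
move=> e0 mE ndE aeE.
have mI : measurable (\bigcap_n E n) by exact: bigcap_measurableType.
have PI : P (\bigcap_n E n) = 0%E.
  rewrite prE// (ae_pr0 mI)//; apply: filterS aeE => w [n nE] h.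
  exact/nE/h.
have h : (P \o E) @ \oo --> 0%E.
  rewrite -PI; apply: nonincreasing_cvg_mu => //.
    by rewrite (le_lt_trans (probability_le1 P (mE 0%N)))// ltry.
  by move=> n m nm; apply/subsetPset; exact: ndE.
have {}h : fine \o (P \o E) @ \oo --> (0 : R) by exact: fine_cvg h.
have /cvgrPdist_le /(_ _ e0) [N _ HN] := h.
exists N => n Nn; have := HN n Nn => /=.
by rewrite sub0r normrN ger0_norm// pr_ge0.
Qed.

(** Continuity from below, obtained from continuity from above for the differences of [A] and [E n],
    with a cover of [A] that is only almost sure. *)
Lemma pr_increasing (E : nat -> set T) (A : set T) (x : R) :
  (forall n, measurable (E n)) -> measurable A ->
  (forall n m, (n <= m)%N -> E n `<=` E m) ->
  (forall n, pr P (E n) <= x) ->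
  {ae P, forall w, A w -> exists n, E n w} -> pr P A <= x.
Proof.
move=> mE mA ndE Ex aeE; apply/ler_addgt0Pr => e e0.
pose D n := A `\` E n.
have mD n : measurable (D n) by exact: measurableD.
have [||N /(_ N (leqnn N)) DN] := pr_decreasing e0 mD.
- by move=> n m nm w [Aw nE]; split=> // Enw; apply: nE; exact: ndE Enw.
- apply: filterS aeE => w h; have [/h[n En]|nA] := pselect (A w).
    by exists n => -[].
  by exists 0%N => -[].
apply: (le_trans _ (lerD (Ex N) DN)).
by apply: pr_leU => // w Aw; have [|] := pselect (E N w); [left|right].
Qed.

End pr_theory.

(** * Random perpetuities: measurability and independence *)

Section measurable_perpetuity.
Context {R : realType} {d} {T : measurableType d}.
Variables (X Y : nat -> T -> R).
Hypotheses (mX : forall k, measurable_fun setT (X k))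
  (mY : forall k, measurable_fun setT (Y k)).

Lemma measurable_ratio k : measurable_fun setT (fun w => ratio (X^~ w) (Y^~ w) k).
Proof.
elim: k => [|k IH].
  by rewrite (_ : (fun _ => _) = cst 1)//; apply/funext => w; rewrite /ratio big_ord0.
under eq_fun do rewrite ratioSr.
by apply: measurable_funM => //; exact: measurable_fun_divr.
Qed.

Lemma measurable_term k : measurable_fun setT (fun w => term (X^~ w) (Y^~ w) k).
Proof. by apply: measurable_fun_divr => //; exact: measurable_ratio. Qed.

Lemma measurable_psum k : measurable_fun setT (fun w => psum (X^~ w) (Y^~ w) k).
Proof.
elim: k => [|k IH].
  by rewrite (_ : (fun _ => _) = cst 0)//; apply/funext => w; rewrite /psum big_ord0.
under eq_fun do rewrite psumSr.
by apply: measurable_funD => //; exact: measurable_term.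
Qed.

Hypotheses (X0 : forall k w, 0 < X k w) (Y0 : forall k w, 0 < Y k w).

Lemma measurable_pval : measurable_fun setT (fun w => pval (X^~ w) (Y^~ w)).
Proof.
apply: (emeasurable_fun_cvg (fun n w => (psum (X^~ w) (Y^~ w) n)%:E)).
  by move=> n; apply/measurable_EFinP; exact: measurable_psum.
by move=> w _; apply: is_cvg_psumE.
Qed.

Lemma measurable_perp : measurable_fun setT (fun w => perp (X^~ w) (Y^~ w)).
Proof.
have mf : measurable_fun setT (fun w => fine (pval (X^~ w) (Y^~ w))).
  by apply: measurableT_comp => //; exact: measurable_pval.
apply: measurable_fun_ifT => //.
exact: measurable_fun_eqr.
Qed.

Lemma measurable_pval_fin : measurable [set w | (pval (X^~ w) (Y^~ w) < +oo)%E].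
Proof.
rewrite -[X in measurable X]setTI; apply: emeasurable_fun_infty_o => //.
exact: measurable_pval.
Qed.

End measurable_perpetuity.

Section independence.
Context {R : realType} {d} {T : measurableType d} (P : probability T R).
Variables (X Y : nat -> T -> R).
Hypotheses (mX : forall k, measurable_fun setT (X k))
  (mY : forall k, measurable_fun setT (Y k)).
Hypotheses (X0 : forall k w, 0 < X k w) (Y0 : forall k w, 0 < Y k w).
Variables (F : set T) (mF : measurable F).
Hypothesis indep : forall (K : nat) (A B : nat -> set R),
  (forall k, measurable (A k)) -> (forall k, measurable (B k)) ->
  let E := [set w | forall k, (k < K)%N -> A k (X k w) /\ B k (Y k w)] in
  P (E `&` F) = (P E * P F)%E.

(** Cylinder events, written as constraints on the whole sequence that become trivial from some
    index on; in this form cylinders of different lengths intersect coordinatewise. *)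
Let G : set (set T) := [set E | exists K (A B : nat -> set R),
  [/\ forall k, measurable (A k), forall k, measurable (B k),
      forall k, (K <= k)%N -> A k = setT /\ B k = setT &
      E = [set w | forall k, A k (X k w) /\ B k (Y k w)]]].

Let G_measurable : G `<=` measurable.
Proof.
move=> _ [K [A [B [mA mB _ ->]]]].
rewrite [X in measurable X](_ : _ =
  [set w | forall k, predT k -> (X k @^-1` A k `&` Y k @^-1` B k) w]).
  by apply: measurable_forall => k; apply: measurableI; exact: measurable_preimage.
by apply/seteqP; split=> w /= H k; [move=> _|]; exact: H.
Qed.

Let GI : setI_closed G.
Proof.
move=> _ _ [K [A [B [mA mB AB ->]]]] [K' [A' [B' [mA' mB' AB' ->]]]].
exists (maxn K K'), (fun k => A k `&` A' k), (fun k => B k `&` B' k); split.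
- by move=> k; exact: measurableI.
- by move=> k; exact: measurableI.
- move=> k; rewrite geq_max => /andP[/AB[-> ->] /AB'[-> ->]].
  by rewrite !setTI.
- apply/seteqP; split=> w /=; first by move=> [H H'] k; have [] := H k; have [] := H' k.
  by move=> H; split=> k; have [[? ?] [? ?]] := H k.
Qed.

Lemma perp_independent C : measurable C ->
  P ((fun w => perp (X^~ w) (Y^~ w)) @^-1` C `&` F) =
  (P ((fun w => perp (X^~ w) (Y^~ w)) @^-1` C) * P F)%E.
Proof.
(* [T'] is [T] with the sub-sigma-algebra generated by the cylinders. Measurability of [perp] holds
   over any measurable space; over [T'] it puts the events of [perp] in the class that cylinders
   determine. *)
move=> mC; pose T' := g_sigma_algebraType G.
have GX k (A : set R) : measurable A -> G (X k @^-1` A).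
  move=> mA; exists k.+1, (fun l => if l == k then A else setT), (fun=> setT); split.
  - by move=> l; case: ifP.
  - by [].
  - by move=> l kl; rewrite gtn_eqF.
  - apply/seteqP; split=> w /= H; last by have := H k; rewrite eqxx => -[].
    by move=> l; case: eqVneq => [->|].
have GY k (A : set R) : measurable A -> G (Y k @^-1` A).
  move=> mA; exists k.+1, (fun=> setT), (fun l => if l == k then A else setT); split.
  - by [].
  - by move=> l; case: ifP.
  - by move=> l kl; rewrite gtn_eqF.
  - apply/seteqP; split=> w /= H; last by have := H k; rewrite eqxx => -[].
    by move=> l; case: eqVneq => [->|].
have mX' k : measurable_fun [set: T'] (X k : T' -> R).
  by move=> _ A mA; rewrite setTI; apply: sub_sigma_algebra; exact: GX.
have mY' k : measurable_fun [set: T'] (Y k : T' -> R).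
  by move=> _ A mA; rewrite setTI; apply: sub_sigma_algebra; exact: GY.
have mp := @measurable_perp _ _ T' X Y mX' mY' X0 Y0.
have : measurable ((fun w : T' => perp (X^~ w) (Y^~ w)) @^-1` C).
  exact: measurable_preimage.
move: (_ @^-1` C) => E GE.
pose m2 := [the {measure set T -> \bar R} of mscale (NngNum (pr_ge0 P F)) P].
transitivity (m2 E); last by rewrite /m2 /= /mscale /= -prE// muleC.
rewrite -[LHS]/(restr_law P mF (@measurable_id _ T setT) E).
apply: (g_sigma_algebra_measure_unique_trace G setT) => //.
- by move=> E' [/G_measurable].
- move=> A B [GA _] [GB _]; split=> //; exact: GI.
- rewrite restr_lawE preimage_setT setTI /m2 /= /mscale /= probability_setT mule1.
  by rewrite -prE.
- move=> _ [[K [A [B [mA mB AB ->]]]] _].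
  rewrite restr_lawE /m2 /= /mscale /= -prE// muleC.
  have := indep K mA mB; rewrite /= (_ : [set w | forall k, (k < K)%N -> _] =
    [set w | forall k, A k (X k w) /\ B k (Y k w)])//.
  apply/seteqP; split=> w /= H k; last by move=> _; exact: H.
  by have [/H//|/AB[-> ->]] := ltnP k K.
- rewrite restr_lawE preimage_setT setTI.
  by rewrite (le_lt_trans (probability_le1 P mF))// ltry.
- rewrite (_ : [set X | _] = G)//.
  by apply/seteqP; split=> [E' []|E' GE'] //; split.
Qed.

End independence.

Lemma measurable_gt {R : realType} {d} {T : measurableType d} (f : T -> R) (x : R) :
  measurable_fun setT f -> measurable [set w | x < f w].
Proof.
move=> mf; rewrite [X in measurable X](_ : _ = f @^-1` `]x, +oo[%classic).
  exact: measurable_preimage.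
by apply/seteqP; split=> w /=; rewrite in_itv/= andbT.
Qed.

(** * Ratio products along the past tend to zero in probability *)

Section ratio_vanishes.
Context {R : realType} {d} {T : measurableType d} (P : probability T R).
Variables (X Y : nat -> T -> R).
Hypotheses (mX : forall k, measurable_fun setT (X k))
  (mY : forall k, measurable_fun setT (Y k)).
Hypotheses (X0 : forall k w, 0 < X k w) (Y0 : forall k w, 0 < Y k w).
Hypothesis Xlaw : forall k A, measurable A -> P (X k @^-1` A) = P (X 0 @^-1` A).
Hypothesis fin : {ae P, forall w, (pval (X^~ w) (Y^~ w) < +oo)%E}.

(** A ratio is a term times [X k]. The terms tend to 0 almost surely because the perpetuity is
    finite, and the [X k] are tight because they share one law. *)
Lemma ratio_small (e h : R) : 0 < e -> 0 < h -> exists N, forall k, (N <= k)%N ->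
  pr P [set w | e < ratio (X^~ w) (Y^~ w) k] <= h.
Proof.
move=> e0 h0; have h20 : 0 < h / 2 by rewrite divr_gt0.
have [||||N1 HN1] := @pr_decreasing _ _ _ P (fun n => [set w | n%:R < X 0 w]) (h / 2).
- exact: h20.
- by move=> n; exact: measurable_gt.
- move=> n m nm w /=; apply: le_lt_trans; by rewrite ler_nat.
- apply: aeW => w; exists (Num.bound (X 0%N w)) => /=.
  by apply/negP; rewrite -leNgt ltW// archi_boundP// ltW.
(* If the ratio exceeds e while [X k] is at most N1 + 1, then the term exceeds this [c]. *)
pose c : R := e / N1.+1%:R.
have c0 : 0 < c by rewrite divr_gt0.
pose E n := \bigcup_(k in [set k | (n <= k)%N]) [set w | c < term (X^~ w) (Y^~ w) k].
have mtc k : measurable [set w | c < term (X^~ w) (Y^~ w) k].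
  by apply: measurable_gt; exact: measurable_term.
have mE n : measurable (E n) by exact: bigcup_measurable.
have [||||N2 HN2] := @pr_decreasing _ _ _ P E (h / 2).
- exact: h20.
- exact: mE.
- by move=> n m nm w [k /= mk ck]; exists k => //=; exact: leq_trans mk.
- apply: filterS fin => w finw.
  have /cvgrPdist_lt /(_ _ c0) [N _ HN] := cvg_term (X0^~ w) (Y0^~ w) finw.
  exists N => -[k /= Nk]; have := HN k Nk.
  rewrite /= sub0r normrN gtr0_norm ?term_gt0 // => ?.
  by apply/negP; rewrite -leNgt ltW.
exists N2 => k Nk; rewrite (splitr h).
have mA : measurable [set w | N1.+1%:R < X k w] by exact: measurable_gt.
have pX : pr P [set w | N1.+1%:R < X k w] <= h / 2.
  apply: le_trans (HN1 N1.+1 (leqnSn _)).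
  rewrite le_eqVlt; apply/orP; left; apply/eqP; congr fine.
  have := Xlaw k (measurable_itv `]N1.+1%:R, +oo[); congr (P _ = P _);
    by apply/seteqP; split=> w /=; rewrite in_itv/= andbT.
apply: le_trans (lerD pX (HN2 k Nk)).
have mr : measurable [set w | e < ratio (X^~ w) (Y^~ w) k].
  by apply: measurable_gt; exact: measurable_ratio.
apply: pr_leU => // w /= er.
have [|Xk] := ltP N1.+1%:R (X k w); first by left.
right; exists k => //=; apply: le_lt_trans (_ : e / X k w < _).
  by rewrite /c ler_pM2l// lef_pV2// posrE.
by rewrite /term ltr_pM2r// invr_gt0.
Qed.

(** Staying above 1 from N on is at most as likely as one single late ratio exceeding 1, which has
    arbitrarily small probability. *)
Lemma ratio_io : {ae P, forall w, forall N : nat,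
  exists2 k, (N <= k)%N & ratio (X^~ w) (Y^~ w) k <= 1}.
Proof.
apply/ae_foralln => N.
have mr k : measurable [set w | 1 < ratio (X^~ w) (Y^~ w) k].
  by apply: measurable_gt; exact: measurable_ratio.
pose A := [set w | forall k, (N <= k)%N -> [set w | 1 < ratio (X^~ w) (Y^~ w) k] w].
have mA : measurable A by exact: measurable_forall.
have A0 : pr P A = 0.
  apply/eqP; rewrite eq_le pr_ge0 andbT; apply/ler_addgt0Pr => h h0; rewrite add0r.
  have [N' HN'] := ratio_small ltr01 h0.
  apply: le_trans (HN' (maxn N N') (leq_maxr _ _)).
  by apply: pr_le => // w; apply; exact: leq_maxl.
apply: filterS (pr0_ae mA A0) => w nA; apply: contrapT => H; apply: nA => k Nk /=.
by rewrite ltNge; apply/negP => r1; apply: H; exists k.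
Qed.

End ratio_vanishes.

(** * The law of the perpetuity *)

Section perpetuity_law.
Context {R : realType} {d} {T : measurableType d} (P : probability T R).
Variables (X Y : nat -> T -> R).
Hypotheses (mX : forall k, measurable_fun setT (X k))
  (mY : forall k, measurable_fun setT (Y k)).
Hypotheses (X0 : forall k w, 0 < X k w) (Y0 : forall k w, 0 < Y k w).
Variables (m12 m1 mv : probability R R).
Hypothesis inv : forall A B C : set R, measurable A -> measurable B ->
  measurable C ->
  prodP mv (prodP m12 m1) (toda_map_set A B C) = (m12 A * m1 B * mv C)%E.
Hypothesis mv_gt0 : mv `]-oo, 0%R]%classic = 0%E.
Hypothesis iid : forall (K : nat) (A B : nat -> set R),
  (forall k, measurable (A k)) -> (forall k, measurable (B k)) ->
  P [set w | forall k, (k < K)%N -> A k (X k w) /\ B k (Y k w)] =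
  (\prod_(k < K) (pr m12 (A k) * pr m1 (B k)))%:E.

Let pos (u : R) : R := if 0 < u then u else 1.

Let pos_gt0 u : 0 < pos u. Proof. by rewrite /pos; case: ifP. Qed.

Let mpos : measurable_fun setT pos.
Proof. by apply: measurable_fun_ifT => //; exact: measurable_fun_ltr. Qed.

Let mv_pos C : measurable C -> mv (pos @^-1` C) = mv C.
Proof.
move=> mC; apply: pr_ae_eq => //; first exact: measurable_preimage.
exists `]-oo, 0]%classic; split=> // u /= H; rewrite in_itv/= leNgt.
by apply/negP => u0; apply: H; rewrite /pos u0.
Qed.

(** Inputs of a chain through M past sites. Lag M - 1 comes first, so the chain runs from the far
    past to the present; its start value sits in an extra factor of the probability space,
    independent of the data. *)
Let i (M k : nat) (z : T * R) := X (M.-1 - k)%N z.1.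
Let j (M k : nat) (z : T * R) := Y (M.-1 - k)%N z.1.
Let v M := vchain (i M) (j M) (fun z => pos z.2).

Let vE M z : v M M z =
  psum (X^~ z.1) (Y^~ z.1) M + ratio (X^~ z.1) (Y^~ z.1) M * pos z.2.
Proof.
suff H N : (N <= M)%N -> v M N z =
    psum (fun k => X (k + (M - N))%N z.1) (fun k => Y (k + (M - N))%N z.1) N +
    ratio (fun k => X (k + (M - N))%N z.1) (fun k => Y (k + (M - N))%N z.1) N
      * pos z.2.
  rewrite H// subnn; congr (psum _ _ _ + ratio _ _ _ * _);
    by apply/funext => k; rewrite addn0.
elim: N => [_|N IH NM]; first by rewrite /psum /ratio !big_ord0 add0r mul1r.
rewrite psumS ratioS /= add0n -/(v M) IH ?(ltnW NM)//.
have eS (f : nat -> R) : (fun k => f (k + (M - N.+1))%N) \o S = (fun k => f (k + (M - N))%N).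
  by apply/funext => k /=; congr f; lia.
rewrite (eS (X^~ z.1)) (eS (Y^~ z.1)) /i /j.
have -> : (M.-1 - N = M - N.+1)%N by lia.
by ring.
Qed.

Let mi M k : measurable_fun setT (i M k).
Proof. by apply: measurableT_comp => //; exact: measurable_fst. Qed.

Let mj M k : measurable_fun setT (j M k).
Proof. by apply: measurableT_comp => //; exact: measurable_fst. Qed.

Let mv0 : measurable_fun setT (fun z : T * R => pos z.2).
Proof. by apply: measurableT_comp => //; exact: measurable_snd. Qed.

Let mvM M : measurable_fun setT (v M M).
Proof. exact: measurable_vchain. Qed.

(** Stationarity: a start value of law [mv] yields an end value of law [mv], for every M. By [vE]
    the end value is a partial sum plus a ratio times the start value, so letting M grow identifies
    the law of the perpetuity. *)
Let law_v M C : measurable C -> prodP P mv (v M M @^-1` C) = mv C.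
Proof.
move=> mC.
have mT (k : nat) : measurable [set: R] by [].
have := @chain_invariance _ _ _ (prodP P mv) m12 m1 mv inv (i M) (j M)
  (fun z => pos z.2) (mi M) (mj M) mv0 M _ (fun=> setT) (fun=> setT) C mT mT mC.
rewrite big1; last by move=> k _; rewrite !pr_setT mulr1.
rewrite mul1r -prE// => <-.
  by congr (prodP P mv _); apply/seteqP; split=> z /=; [move=> ?; split|case].
move=> A B C' mA mB mC'.
pose E := [set w | forall k, (k < M)%N -> A (M.-1 - k)%N (X k w) /\ B (M.-1 - k)%N (Y k w)].
have -> : [set z | (forall k, (k < M)%N -> A k (i M k z) /\ B k (j M k z)) /\ C' (pos z.2)]
    = E `*` (pos @^-1` C').
  apply/seteqP; split=> -[w u] /=.
    move=> [H Cu]; split=> // k kM.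
    have := H (M.-1 - k)%N; rewrite /i /j /=.
    have -> : (M.-1 - (M.-1 - k) = k)%N by lia.
    by apply; lia.
  move=> [H Cu]; split=> // k kM.
  have := H (M.-1 - k)%N; rewrite /i /j /=.
  have -> : (M.-1 - (M.-1 - k) = k)%N by lia.
  by apply; lia.
have mE : measurable E.
  apply: measurable_forall => k; apply: measurableI;
    by apply: measurable_preimage.
rewrite prodPE//; last exact: measurable_preimage.
rewrite mv_pos// (prE mv mC') /E (@iid M (fun k => A (M.-1 - k)%N) (fun k => B (M.-1 - k)%N))// -EFinM; congr (_ * _)%:E.
rewrite [RHS](reindex_inj rev_ord_inj) /=; apply: eq_bigr => k _.
by congr (pr m12 (A _) * pr m1 (B _)); lia.
Qed.

Let G (x : R) := pr mv `]x, +oo[%classic.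

Let mray (x : R) : measurable (`]x, +oo[%classic : set R). Proof. by []. Qed.

Let pr_v M x : pr (prodP P mv) [set z | x < v M M z] = G x.
Proof.
apply: (congr1 fine); rewrite -[RHS](law_v M (mray x)); congr (prodP P mv _).
by apply/seteqP; split=> w /=; rewrite in_itv/= andbT.
Qed.

Let pr_fst (A : set T) : measurable A -> pr (prodP P mv) (A `*` setT) = pr P A.
Proof. by move=> mA; rewrite /pr prodPE// probability_setT mule1. Qed.

Let pr_snd (A : set R) : measurable A -> pr (prodP P mv) (setT `*` A) = pr mv A.
Proof. by move=> mA; rewrite /pr prodPE// probability_setT mul1e. Qed.

Let pr_psum M x : pr P [set w | x < psum (X^~ w) (Y^~ w) M] <= G x.
Proof.
have mp : measurable [set w | x < psum (X^~ w) (Y^~ w) M].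
  by apply: measurable_gt; exact: measurable_psum.
rewrite -(pr_v M) -(pr_fst mp); apply: pr_le.
- exact: measurableX.
- exact: measurable_gt.
- move=> -[w u] /= [xw _]; rewrite vE /=; apply: lt_le_trans xw _.
  by rewrite lerDl mulr_ge0// ltW// ratio_gt0.
Qed.

(** Each partial sum lies below a variable of law [mv]. An infinite perpetuity exceeds every x, an
    event of probability at most [G x], which vanishes as x grows. *)
Lemma ae_pval_fin : {ae P, forall w, (pval (X^~ w) (Y^~ w) < +oo)%E}.
Proof.
pose A := ~` [set w | (pval (X^~ w) (Y^~ w) < +oo)%E].
have mA : measurable A by apply: measurableC; exact: measurable_pval_fin.
have AG x : pr P A <= G x.
  apply: (@pr_increasing _ _ _ P (fun n => [set w | x < psum (X^~ w) (Y^~ w) n])) => //.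
  - by move=> n; apply: measurable_gt; exact: measurable_psum.
  - by move=> n m nm w /=; move/lt_le_trans; apply; exact: psum_nd.
  - apply: aeW => w /= /negP; rewrite -leNgt leye_eq => /eqP pw.
    by apply: pval_ge => //; rewrite pw ltry.
have A0 : pr P A = 0.
  apply/eqP; rewrite eq_le pr_ge0 andbT; apply/ler_addgt0Pr => h h0; rewrite add0r.
  have [||||N /(_ N (leqnn N)) HN] :=
    @pr_decreasing _ _ _ mv (fun n => `]n%:R, +oo[%classic) h.
  - exact: h0.
  - by [].
  - move=> n m nm u /=; rewrite !in_itv/= !andbT; apply: le_lt_trans.
    by rewrite ler_nat.
  - apply: aeW => u; exists (Num.bound `|u|) => /=; rewrite in_itv/= andbT.
    by apply/negP; rewrite -leNgt ltW// (le_lt_trans (ler_norm _))// archi_boundP.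
  exact: le_trans (AG _) HN.
by apply: filterS (pr0_ae mA A0) => w /=; rewrite /A /= notK.
Qed.

Lemma perp_law C : measurable C ->
  P ((fun w => perp (X^~ w) (Y^~ w)) @^-1` C) = mv C.
Proof.
have mp := measurable_perp mX mY X0 Y0.
have m12E k A : measurable A -> P (X k @^-1` A) = m12 A.
  move=> mA.
  have := @iid k.+1 (fun l => if l == k then A else setT) (fun=> setT) _ _.
  rewrite big_ord_recr/= eqxx pr_setT mulr1 big1 ?mul1r.
    rewrite -prE// => <-; last by [].
    - congr (P _); apply/seteqP; split=> w /=.
        by move=> Aw l _; split=> //; case: eqVneq => [->|].
      by move=> H; have [] := H k (ltnSn k); rewrite eqxx.
    - by move=> l; case: ifP.
  by move=> l _; rewrite (ltn_eqF (ltn_ord l)) !pr_setT mulr1.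
move: C; suff H x : pr P [set w | x < perp (X^~ w) (Y^~ w)] = G x.
  move=> C mC; rewrite -[RHS](ray_measure_unique
    (m1 := restr_law P measurableT mp) (m2 := mv)) ?restr_lawE ?setIT//.
    by rewrite preimage_setT (le_lt_trans (probability_le1 P measurableT))// ltry.
  move=> x; rewrite restr_lawE setIT [RHS]prE// -/(G x) -H -prE; last exact: measurable_gt.
  by congr (P _); apply/seteqP; split=> w /=; rewrite in_itv/= andbT.
have mpx y : measurable [set w | y < perp (X^~ w) (Y^~ w)] by exact: measurable_gt.
apply/eqP; rewrite eq_le; apply/andP; split.
  apply: (@pr_increasing _ _ _ P (fun n => [set w | x < psum (X^~ w) (Y^~ w) n])) => //.
  - by move=> n; apply: measurable_gt; exact: measurable_psum.
  - by move=> n m nm w /=; move/lt_le_trans; apply; exact: psum_nd.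
  - apply: filterS ae_pval_fin => w fin /= xw.
    by apply: pval_ge => //; rewrite pval_fin// lte_fin.
(* The end value exceeds [perp] by at most ratio times start value. This is at most e unless the
   ratio is above [dl] or the start above N1 + 1, which has total probability at most h. Right
   continuity of the tail then removes e. *)
have Ge e : 0 < e -> G (x + e) <= pr P [set w | x < perp (X^~ w) (Y^~ w)].
  move=> e0; apply/ler_addgt0Pr => h h0; have h20 : 0 < h / 2 by rewrite divr_gt0.
  have [||||N1 /(_ _ (leqnSn N1)) HN1] :=
    @pr_decreasing _ _ _ mv (fun n => [set u | n%:R < pos u]) (h / 2).
  - exact: h20.
  - by move=> n; exact: measurable_gt.
  - by move=> n m nm u /=; apply: le_lt_trans; rewrite ler_nat.
  - apply: aeW => u; exists (Num.bound (pos u)) => /=.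
    by apply/negP; rewrite -leNgt ltW// archi_boundP// ltW.
  pose dl := e / N1.+1%:R; have dl0 : 0 < dl by rewrite divr_gt0.
  have Xlaw k A : measurable A -> P (X k @^-1` A) = P (X 0%N @^-1` A).
    by move=> mA; rewrite !m12E.
  have [M /(_ M (leqnn M)) HM] := ratio_small mX mY X0 Y0 Xlaw ae_pval_fin dl0 h20.
  pose nf := ~` [set w | (pval (X^~ w) (Y^~ w) < +oo)%E].
  have mnf : measurable nf by apply: measurableC; exact: measurable_pval_fin.
  have nf0 : pr P nf = 0 by apply: (ae_pr0 mnf); apply: filterS ae_pval_fin => w /= ? /(_ _).
  pose B1 := [set w | x < perp (X^~ w) (Y^~ w)] `|` nf.
  have mB1 : measurable B1 by exact: measurableU.
  pose B2 := [set w | dl < ratio (X^~ w) (Y^~ w) M].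
  have mB2 : measurable B2 by apply: measurable_gt; exact: measurable_ratio.
  pose B3 := [set u | N1.+1%:R < pos u].
  have mB3 : measurable B3 by exact: measurable_gt.
  have pB1 : pr P B1 <= pr P [set w | x < perp (X^~ w) (Y^~ w)].
    by rewrite -[leRHS]addr0 -nf0; exact: pr_leU.
  rewrite (splitr h) addrA -(pr_v M).
  have mB1T : measurable (B1 `*` [set: R]) by exact: measurableX.
  have mB2T : measurable (B2 `*` [set: R]) by exact: measurableX.
  have mB3T : measurable ([set: T] `*` B3) by exact: measurableX.
  apply: le_trans (_ : pr (prodP P mv) ((B1 `*` setT) `|` (B2 `*` setT)) +
    pr (prodP P mv) (setT `*` B3) <= _); last first.
    apply: lerD; last by rewrite pr_snd.
    apply: le_trans (pr_leU (prodP P mv) (measurableU _ _ mB1T mB2T) mB1T mB2T _) _ => //.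
    by rewrite !pr_fst//; apply: lerD.
  apply: pr_leU => //.
  - exact: measurable_gt.
  - exact: measurableU.
  - move=> [w u] /=; rewrite vE /= => xv.
    have [fin|nfin] := pselect ((pval (X^~ w) (Y^~ w) < +oo)%E); last first.
      by left; left; split=> //; right.
    have [B2w|nB2] := ltP dl (ratio (X^~ w) (Y^~ w) M); first by left; right.
    have [B3u|nB3] := ltP N1.+1%:R (pos u); first by right.
    left; left; split=> //; left => /=.
    rewrite -(ltrD2r e); apply: lt_le_trans xv _.
    rewrite lerD ?psum_le_perp//.
    rewrite [leRHS](_ : e = dl * N1.+1%:R); last by rewrite divfK.
    by rewrite ler_pM// ltW// ratio_gt0.
apply: (@pr_increasing _ _ _ mv (fun n => `]x + n.+1%:R^-1, +oo[%classic)) => //.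
- move=> n m nm u /=; rewrite !in_itv/= !andbT; apply: le_lt_trans.
  by rewrite lerD2l lef_pV2// ?posrE// ler_nat.
- by move=> n; apply: Ge; rewrite invr_gt0.
- apply: aeW => u /=; rewrite in_itv/= andbT => xu.
  have ux0 : 0 < u - x by rewrite subr_gt0.
  exists (Num.bound (u - x)^-1); rewrite /= in_itv/= andbT -ltrBrDl.
  rewrite invf_plt ?posrE//; apply: lt_trans (archi_boundP _) _.
    by rewrite invr_ge0 ltW.
  by rewrite ltr_nat.
Qed.

End perpetuity_law.

(** * I.i.d. families of pairs and the Toda step *)

Lemma prod_iota {R : realType} K (F : nat -> R) :
  \prod_(k <- iota 0 K) F k = \prod_(k < K) F k.
Proof. by rewrite -{1}(subn0 K) -/(index_iota 0 K) big_mkord. Qed.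

Section pair_iid.
Context {R : realType} {d} {T : measurableType d} (P : probability T R).
Variables (m12 m1 : probability R R).

Definition pair_event (K L : eqType) (X : K -> T -> R) (Y : L -> T -> R)
    (s : seq K) (t : seq L) (A : K -> set R) (B : L -> set R) : set T :=
  [set w | (forall k, k \in s -> A k (X k w)) /\
           (forall l, l \in t -> B l (Y l w))].

(** The two sequences have separate index types and lists because they are reindexed separately: the
    past of n pairs I_{n-k} with J_{n-k-1}, a chain site pairs I_{n+1} with J_n, the mirror pairs
    I_{-n} with J_{-n-1}. *)
Definition pair_iid (K L : eqType) (X : K -> T -> R) (Y : L -> T -> R) :=
  forall (s : seq K) (t : seq L) (A : K -> set R) (B : L -> set R),
    uniq s -> uniq t -> (forall k, measurable (A k)) ->
    (forall l, measurable (B l)) ->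
    P (pair_event X Y s t A B) =
    ((\prod_(k <- s) pr m12 (A k)) * \prod_(l <- t) pr m1 (B l))%:E.

Lemma measurable_pair_event (K L : eqType) (X : K -> T -> R) (Y : L -> T -> R)
    s t A B :
  (forall k, measurable_fun setT (X k)) -> (forall l, measurable_fun setT (Y l)) ->
  (forall k, measurable (A k)) -> (forall l, measurable (B l)) ->
  measurable (pair_event X Y s t A B).
Proof.
have H (I : eqType) (Z : I -> T -> R) (r : seq I) (C : I -> set R) :
    (forall k, measurable_fun setT (Z k)) -> (forall k, measurable (C k)) ->
    measurable [set w | forall k, k \in r -> C k (Z k w)].
  move=> mZ mC; elim: r => [|x r IH].
    by rewrite (_ : [set _ | _] = setT)//; apply/seteqP.
  rewrite (_ : [set _ | _] = (Z x @^-1` C x) `&` [set w | forall k, k \in r -> C k (Z k w)]).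
    by apply: measurableI => //; exact: measurable_preimage.
  apply/seteqP; split=> w /=.
    move=> h; split; first by apply: h; rewrite mem_head.
    by move=> k kr; apply: h; rewrite inE kr orbT.
  by move=> [hx h] k; rewrite inE => /predU1P[->//|]; exact: h.
by move=> mX mY mA mB; apply: measurableI; exact: H.
Qed.

Lemma pair_iid_reindex (K L K' L' : eqType) (X : K -> T -> R) (Y : L -> T -> R)
    (f : K' -> K) (f' : K -> K') (g : L' -> L) (g' : L -> L') :
  cancel f f' -> cancel g g' -> pair_iid X Y -> pair_iid (X \o f) (Y \o g).
Proof.
move=> fK gK iid s t A B us ut mA mB.
have -> : pair_event (X \o f) (Y \o g) s t A B =
    pair_event X Y (map f s) (map g t) (A \o f') (B \o g').
  apply/seteqP; split=> w /= [HA HB]; split=> k.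
  - by move=> /mapP[x xs ->]; rewrite /= fK; exact: HA.
  - by move=> /mapP[x xs ->]; rewrite /= gK; exact: HB.
  - by move=> ks; have := HA (f k) (map_f f ks); rewrite /= fK.
  - by move=> ks; have := HB (g k) (map_f g ks); rewrite /= gK.
rewrite iid.
- rewrite !big_map; congr (_ * _)%:E; apply: eq_bigr => k _ /=.
    by rewrite fK.
  by rewrite gK.
- by rewrite map_inj_uniq//; exact: can_inj fK.
- by rewrite map_inj_uniq//; exact: can_inj gK.
- by move=> k; exact: mA.
- by move=> k; exact: mB.
Qed.

Lemma pair_iid_nat (X Y : nat -> T -> R) : pair_iid X Y ->
  forall K A B, (forall k, measurable (A k)) -> (forall k, measurable (B k)) ->
  P [set w | forall k, (k < K)%N -> A k (X k w) /\ B k (Y k w)] =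
  (\prod_(k < K) (pr m12 (A k) * pr m1 (B k)))%:E.
Proof.
move=> iid K A B mA mB.
have := iid (iota 0 K) (iota 0 K) A B (iota_uniq _ _) (iota_uniq _ _) mA mB.
rewrite -big_split /= prod_iota => <-; congr (P _).
apply/seteqP; split=> w /=.
  by move=> h; split=> k; rewrite mem_iota add0n => /= /h[].
by move=> [HA HB] k kK; split; [apply: HA|apply: HB]; rewrite mem_iota add0n.
Qed.

Lemma pair_iid_disjoint (K L : eqType) (X : K -> T -> R) (Y : L -> T -> R)
    s s' t t' A A' B B' : pair_iid X Y ->
  uniq s -> uniq s' -> uniq t -> uniq t' ->
  ~~ has (mem s) s' -> ~~ has (mem t) t' ->
  (forall k, measurable (A k)) -> (forall k, measurable (B k)) ->
  (forall k, measurable (A' k)) -> (forall k, measurable (B' k)) ->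
  P (pair_event X Y s t A B `&` pair_event X Y s' t' A' B') =
  (P (pair_event X Y s t A B) * P (pair_event X Y s' t' A' B'))%E.
Proof.
move=> iid us us' ut ut' ss' tt' mA mB mA' mB'.
have mix (I : eqType) (r r' : seq I) (C C' : I -> set R) : ~~ has (mem r) r' ->
    forall k, k \in r' -> (if k \in r then C k else C' k) = C' k.
  by move=> /hasPn h k /h /= /negbTE ->.
have -> : pair_event X Y s t A B `&` pair_event X Y s' t' A' B' =
    pair_event X Y (s ++ s') (t ++ t') (fun k => if k \in s then A k else A' k)
      (fun k => if k \in t then B k else B' k).
  apply/seteqP; split=> w /=.
    move=> [[HA HB] [HA' HB']]; split=> k; rewrite mem_cat; case: ifPn => //=.
    - by move=> ks _; exact: HA.
    - by move=> _; exact: HA'.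
    - by move=> ks _; exact: HB.
    - by move=> _; exact: HB'.
  move=> [HA HB]; split; split=> k kr.
  - by have := HA k; rewrite mem_cat kr => /(_ isT).
  - by have := HB k; rewrite mem_cat kr => /(_ isT).
  - by have := HA k; rewrite (mix _ _ _ _ _ ss')// mem_cat kr orbT => /(_ isT).
  - by have := HB k; rewrite (mix _ _ _ _ _ tt')// mem_cat kr orbT => /(_ isT).
rewrite !iid//; first last.
- by move=> k; case: ifP.
- by move=> k; case: ifP.
- by rewrite cat_uniq ut ut' tt'.
- by rewrite cat_uniq us us' ss'.
rewrite -EFinM !big_cat /= mulrACA; congr ((_ * _) * (_ * _))%:E.
- by apply: eq_big_seq => k ->.
- by apply: eq_big_seq => k ->.
- by apply: eq_big_seq => k kr /=; rewrite (mix _ _ _ _ _ ss').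
- by apply: eq_big_seq => k kr /=; rewrite (mix _ _ _ _ _ tt').
Qed.

Lemma prod_sub_uniq (K : eqType) (s u : seq K) (F : K -> R) : uniq s -> uniq u ->
  {subset s <= u} ->
  \prod_(k <- u) (if k \in s then F k else 1) = \prod_(k <- s) F k.
Proof.
move=> us uu su; rewrite -big_mkcond /= -big_filter; apply: perm_big.
apply: uniq_perm => //; first exact: filter_uniq.
by move=> k; rewrite mem_filter; case: (boolP (k \in s)) => //= /su ->.
Qed.

(** The two lists are replaced by their union, with the full set as constraint wherever an index was
    absent. *)
Lemma pair_iid_rect (K : eqType) (X Y : K -> T -> R) :
  (forall (s : seq K) (A B : K -> set R), uniq s ->
    (forall k, measurable (A k)) -> (forall k, measurable (B k)) ->
    P (pair_event X Y s s A B) =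
    (\prod_(k <- s) (pr m12 (A k) * pr m1 (B k)))%:E) ->
  pair_iid X Y.
Proof.
move=> iid s t A B us ut mA mB; pose u := undup (s ++ t).
have su : {subset s <= u} by move=> k ks; rewrite mem_undup mem_cat ks.
have tu : {subset t <= u} by move=> k ks; rewrite mem_undup mem_cat ks orbT.
have -> : pair_event X Y s t A B = pair_event X Y u u
    (fun k => if k \in s then A k else setT) (fun k => if k \in t then B k else setT).
  apply/seteqP; split=> w /= [HA HB]; split=> k.
  - by move=> _; case: ifPn => // /HA.
  - by move=> _; case: ifPn => // /HB.
  - by move=> ks; have := HA k (su _ ks); rewrite ks.
  - by move=> ks; have := HB k (tu _ ks); rewrite ks.
rewrite iid ?undup_uniq//; [|by move=> k; case: ifP|by move=> k; case: ifP].
rewrite big_split /=; congr (_ * _)%:E.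
  rewrite -(prod_sub_uniq _ us (undup_uniq _) su); apply: eq_bigr => k _.
  by case: ifP => //; rewrite pr_setT.
rewrite -(prod_sub_uniq _ ut (undup_uniq _) tu); apply: eq_bigr => k _.
by case: ifP => //; rewrite pr_setT.
Qed.

Lemma pair_iid_ae_eq (K L : eqType) (X X' : K -> T -> R) (Y Y' : L -> T -> R) :
  (forall k, measurable_fun setT (X k)) -> (forall l, measurable_fun setT (Y l)) ->
  (forall k, measurable_fun setT (X' k)) -> (forall l, measurable_fun setT (Y' l)) ->
  {ae P, forall w, (forall k, X k w = X' k w) /\ (forall l, Y l w = Y' l w)} ->
  pair_iid X Y -> pair_iid X' Y'.
Proof.
move=> mX mY mX' mY' XX' iid s t A B us ut mA mB; rewrite -iid//.
apply: pr_ae_eq; [exact: measurable_pair_event..|].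
apply: filterS XX' => w [HX HY]; split=> -[HA HB]; split=> k ks.
- by rewrite HX; exact: HA.
- by rewrite HY; exact: HB.
- by rewrite -HX; exact: HA.
- by rewrite -HY; exact: HB.
Qed.

End pair_iid.

Section shifted_events.
Context {R : realType} {d} {T : measurableType d}.
Variables (X Y : int -> T -> R).

Definition nat_event (f g : nat -> int) K (A B : nat -> set R) : set T :=
  [set w | forall k, (k < K)%N -> A k (X (f k) w) /\ B k (Y (g k) w)].

Lemma nat_eventE f f' g g' K A B : cancel f f' -> cancel g g' ->
  nat_event f g K A B =
  pair_event X Y (map f (iota 0 K)) (map g (iota 0 K)) (A \o f') (B \o g').
Proof.
move=> fK gK; apply/seteqP; split=> w /=.
  move=> H; split=> m /mapP[k]; rewrite mem_iota add0n => /= kK ->.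
    by rewrite fK; have [] := H k kK.
  by rewrite gK; have [] := H k kK.
move=> [HA HB] k kK; have ks : k \in iota 0 K by rewrite mem_iota add0n.
by split; [have := HA _ (map_f f ks)|have := HB _ (map_f g ks)]; rewrite /= ?fK ?gK.
Qed.

End shifted_events.

(** * One time step on i.i.d. data *)

Section toda_step.
Context {R : realType} {d} {T : measurableType d} (P : probability T R).
Variables (m12 m1 : probability R R) (X Y : int -> T -> R).
Hypotheses (mX : forall k, measurable_fun setT (X k))
  (mY : forall k, measurable_fun setT (Y k)).
Hypotheses (X0 : forall k w, 0 < X k w) (Y0 : forall k w, 0 < Y k w).
Hypothesis iid : pair_iid P m12 m1 X Y.

Lemma past_iid (n : int) :
  pair_iid P m12 m1 (fun k : nat => X (n - k%:Z)) (fun k : nat => Y (n - k%:Z - 1)).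
Proof.
have fK : cancel (fun k : nat => n - k%:Z) (fun m => `|(n - m)%R|%N) by move=> k; lia.
have gK : cancel (fun k : nat => n - k%:Z - 1) (fun m => `|(n - 1 - m)%R|%N) by move=> k; lia.
exact: (pair_iid_reindex fK gK iid).
Qed.

Lemma past_law (n : int) k A : measurable A -> P (X (n - k%:Z) @^-1` A) = P (X (n - 0%:Z) @^-1` A).
Proof.
move=> mA.
have h (l : nat) : P (X (n - l%:Z) @^-1` A) = (pr m12 A)%:E.
  have := @past_iid n [:: l] [::] (fun=> A) (fun=> setT).
  rewrite !big_cons !big_nil !mulr1 => <- //; congr (P _).
  apply/seteqP; split=> w /=; last by move=> [h _]; apply: (h l); rewrite mem_head.
  by move=> Aw; split=> m; rewrite ?inE // => /eqP ->.
by rewrite !h.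
Qed.

(** The past of n comprises I up to n and J up to n - 1, whence the strict inequality for [f] and
    the weak one for [g]. *)
Lemma past_future (n : int) (K K' : nat) (f g : nat -> int) f' g' A B A' B' :
  cancel f f' -> cancel g g' -> (forall k, n < f k) -> (forall k, n <= g k) ->
  (forall k, measurable (A k)) -> (forall k, measurable (B k)) ->
  (forall k, measurable (A' k)) -> (forall k, measurable (B' k)) ->
  let E := nat_event X Y (fun k => n - k%:Z) (fun k => n - k%:Z - 1) K A B in
  let F := nat_event X Y f g K' A' B' in
  P (E `&` F) = (P E * P F)%E.
Proof.
move=> fK gK nf ng mA mB mA' mB' E F.
have hK : cancel (fun k : nat => n - k%:Z) (fun m => `|(n - m)%R|%N) by move=> k; lia.
have hK' : cancel (fun k : nat => n - k%:Z - 1) (fun m => `|(n - 1 - m)%R|%N) by move=> k; lia.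
rewrite /E /F (nat_eventE _ _ _ _ _ hK hK') (nat_eventE _ _ _ _ _ fK gK).
apply: pair_iid_disjoint iid _ _ _ _ _ _ _ _ _ _.
- by rewrite map_inj_uniq ?iota_uniq//; exact: can_inj hK.
- by rewrite map_inj_uniq ?iota_uniq//; exact: can_inj fK.
- by rewrite map_inj_uniq ?iota_uniq//; exact: can_inj hK'.
- by rewrite map_inj_uniq ?iota_uniq//; exact: can_inj gK.
- apply/hasPn => _ /mapP[k _ ->]; apply/mapP => -[l _ fl].
  by have := nf k; rewrite fl; lia.
- apply/hasPn => _ /mapP[k _ ->]; apply/mapP => -[l _ fl].
  by have := ng k; rewrite fl; lia.
- by move=> k; exact: mA.
- by move=> k; exact: mB.
- by move=> k; exact: mA'.
- by move=> k; exact: mB'.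
Qed.

Definition Vperp (n : int) (w : T) := perp (pastI (X^~ w) n) (pastJ (Y^~ w) n).

Lemma measurable_Vperp n : measurable_fun setT (Vperp n).
Proof.
exact: (@measurable_perp _ _ _ (fun k : nat => X (n - k%:Z))
  (fun k : nat => Y (n - k%:Z - 1))).
Qed.

Lemma Vperp_gt0 n w : 0 < Vperp n w.
Proof. by apply: perp_gt0 => k; [exact: X0|exact: Y0]. Qed.

Definition Istep n w := Y n w + (Vperp n w)^-1.
Definition Jstep n w := X (n + 1) w * Y n w / Istep n w.

Lemma measurable_Istep n : measurable_fun setT (Istep n).
Proof.
by apply: measurable_funD => //; apply: measurable_fun_invr; exact: measurable_Vperp.
Qed.

Lemma measurable_Jstep n : measurable_fun setT (Jstep n).
Proof.
apply: measurable_fun_divr; last exact: measurable_Istep.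
exact: measurable_funM.
Qed.

Lemma Istep_gt0 n w : 0 < Istep n w.
Proof. by rewrite addr_gt0// invr_gt0 Vperp_gt0. Qed.

Lemma Jstep_gt0 n w : 0 < Jstep n w.
Proof. by rewrite divr_gt0 ?Istep_gt0// mulr_gt0. Qed.

Lemma perp_future n (K' : nat) (f g : nat -> int) f' g' A' B' C :
  cancel f f' -> cancel g g' -> (forall k, n < f k) -> (forall k, n <= g k) ->
  (forall k, measurable (A' k)) -> (forall k, measurable (B' k)) -> measurable C ->
  let F := nat_event X Y f g K' A' B' in
  P (Vperp n @^-1` C `&` F) = (P (Vperp n @^-1` C) * P F)%E.
Proof.
move=> fK gK nf ng mA' mB' mC F.
have mF : measurable F.
  rewrite /F (nat_eventE _ _ _ _ _ fK gK).
  by apply: measurable_pair_event => // k; [exact: mA'|exact: mB'].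
apply: (@perp_independent _ _ _ P (fun k : nat => X (n - k%:Z))
  (fun k : nat => Y (n - k%:Z - 1))) => // K A B mA mB E.
exact: past_future fK gK nf ng mA mB mA' mB'.
Qed.

Section finite.
Hypothesis fin : forall n,
  {ae P, forall w, (pval (pastI (X^~ w) n) (pastJ (Y^~ w) n) < +oo)%E}.

Lemma Vperp_affine : {ae P, forall w, toda_affine (X^~ w) (Y^~ w) (Vperp^~ w)}.
Proof.
apply: ae_countable => n; apply: filterS (fin (n + 1)) => w finw.
have [_] := @pval_shift _ (pastI (X^~ w) (n + 1)) (pastJ (Y^~ w) (n + 1))
  (fun k => X0 (n + 1 - k%:Z) w) (fun k => Y0 (n + 1 - k%:Z - 1) w) finw.
by rewrite pastIS pastJS addrK /pastI /pastJ subr0 addrK.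
Qed.

Lemma past_ratio_io : {ae P, forall w n (N : nat),
  exists2 k, (N <= k)%N & ratio (pastI (X^~ w) n) (pastJ (Y^~ w) n) k <= 1}.
Proof.
apply: ae_countable => n.
apply: (@ratio_io _ _ _ P (fun k : nat => X (n - k%:Z))
  (fun k : nat => Y (n - k%:Z - 1))) => //; last exact: fin.
by move=> k A mA; exact: past_law.
Qed.

End finite.

Section stationary.
Variable mv : probability R R.
Hypothesis inv : forall A B C : set R, measurable A -> measurable B ->
  measurable C ->
  prodP mv (prodP m12 m1) (toda_map_set A B C) = (m12 A * m1 B * mv C)%E.
Hypothesis mv_gt0 : mv `]-oo, 0%R]%classic = 0%E.

Lemma stationary_fin n :
  {ae P, forall w, (pval (pastI (X^~ w) n) (pastJ (Y^~ w) n) < +oo)%E}.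
Proof.
apply: (@ae_pval_fin _ _ _ P (fun k : nat => X (n - k%:Z))
  (fun k : nat => Y (n - k%:Z - 1)) _ _ _ _ m12 m1 mv) => //.
exact/pair_iid_nat/past_iid.
Qed.

Lemma Vperp_law n C : measurable C -> P (Vperp n @^-1` C) = mv C.
Proof.
apply: (@perp_law _ _ _ P (fun k : nat => X (n - k%:Z))
  (fun k : nat => Y (n - k%:Z - 1)) _ _ _ _ m12 m1 mv) => //.
exact/pair_iid_nat/past_iid.
Qed.

(** Finitely many sites lie in a window to the right of some -N. [Vperp] at -N has law [mv] and is
    independent of the inputs in the window, so the chain started from it has i.i.d. outputs. Almost
    surely these are [Istep] and [Jstep], because [Vperp] solves the recursion. *)
Lemma step_iid : pair_iid P m12 m1 Istep Jstep.
Proof.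
apply: pair_iid_rect => s A B us mA mB.
have [N HN] : exists N : nat, forall m, m \in s -> (`|m| < N)%N.
  elim: s {us} => [|x s [N IH]]; first by exists 0%N.
  exists (maxn N `|x|.+1) => m; rewrite inE => /predU1P[->|/IH mN].
    by rewrite leq_max ltnSn orbT.
  by rewrite leq_max mN.
(* Site k of the chain is lattice site k - N; [f1] is one ahead because site n consumes I_{n+1} and
   J_n. *)
pose f (k : nat) : int := k%:Z - N%:Z; pose f' (m : int) := `|(m + N%:Z)%R|%N.
have fK : cancel f f' by move=> k; rewrite /f /f'; lia.
pose f1 (k : nat) : int := f k + 1; pose f1' (m : int) := f' (m - 1).
have f1K : cancel f1 f1' by move=> k; rewrite /f1 /f1' addrK.
pose i k := X (f1 k); pose j k := Y (f k); pose v0 := Vperp (- N%:Z).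
(* The window from -N to N - 1 contains [s]. *)
pose K := (N + N)%N.
pose A' k := if f k \in s then A (f k) else setT.
pose B' k := if f k \in s then B (f k) else setT.
have mA' k : measurable (A' k) by rewrite /A'; case: ifP.
have mB' k : measurable (B' k) by rewrite /B'; case: ifP.
have mi k : measurable_fun setT (i k) by exact: mX.
have mj k : measurable_fun setT (j k) by exact: mY.
have mv0 : measurable_fun setT v0 by exact: measurable_Vperp.
have base (A0 B0 : nat -> set R) (C : set R) :
  (forall k, measurable (A0 k)) -> (forall k, measurable (B0 k)) -> measurable C ->
  P [set w | (forall k, (k < K)%N -> A0 k (i k w) /\ B0 k (j k w)) /\ C (v0 w)] =
  (\prod_(k < K) (pr m12 (A0 k) * pr m1 (B0 k)) * pr mv C)%:E.
  move=> mA0 mB0 mC.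
  transitivity (P (v0 @^-1` C `&` nat_event X Y f1 f K A0 B0)).
    by congr (P _); apply/seteqP; split=> w /= [? ?].
  rewrite (perp_future _ f1K fK)//; first last.
  - by move=> k; rewrite /f; lia.
  - by move=> k; rewrite /f1 /f; lia.
  rewrite Vperp_law// (prE mv mC) muleC.
  have -> // := pair_iid_nat (pair_iid_reindex f1K fK iid) K mA0 mB0.
have chain := chain_invariance inv mi mj mv0 base mA' mB' (@measurableT _ R).
rewrite pr_setT mulr1 in chain.
transitivity (\prod_(k < K) (pr m12 (A' k) * pr m1 (B' k)))%:E; last first.
  have sub : {subset s <= map f (iota 0 K)}.
    move=> m ms; apply/mapP; exists (f' m); have := HN m ms; rewrite /f' /f.
      by rewrite mem_iota add0n /= /K; lia.
    by lia.
  rewrite -(prod_sub_uniq _ us _ sub); last first.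
    by rewrite map_inj_uniq ?iota_uniq//; exact: can_inj fK.
  rewrite big_map prod_iota; congr EFin.
  by apply: eq_bigr => k _; rewrite /A' /B'; case: ifP; rewrite ?pr_setT ?mulr1.
rewrite -chain; apply: pr_ae_eq.
- apply: measurable_pair_event => //; [exact: measurable_Istep|exact: measurable_Jstep].
- apply: measurableI; last first.
    by rewrite [X in measurable X](_ : _ = setT)//; apply/seteqP.
  apply: measurable_forall => k; apply: measurableI; apply: measurable_preimage => //.
    exact: measurable_ichain.
  exact: measurable_jchain.
apply: filterS (Vperp_affine stationary_fin) => w aff.
have vE k : vchain i j v0 k w = Vperp (f k) w.
  have f0 : f 0%N = - N%:Z by rewrite /f; lia.
  have fS l : f l.+1 = f l + 1 by rewrite /f; lia.
  elim: k => [|k IH]; first by rewrite f0.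
  by rewrite fS aff [LHS]/= IH.
have iE k : ichain i j v0 k w = Istep (f k) w by rewrite /ichain vE.
have jE k : jchain i j v0 k w = Jstep (f k) w by rewrite /jchain iE.
split=> /= [[HA HB]|[H _]].
  split=> // k kK; rewrite iE jE /A' /B'; case: ifPn => // ks.
  by split; [exact: HA|exact: HB].
have H' m : m \in s -> A m (Istep m w) /\ B m (Jstep m w).
  move=> ms; have := HN m ms => mN; have fm : f (f' m) = m by rewrite /f /f'; lia.
  have := H (f' m); rewrite iE jE /A' /B' fm ms; apply.
  by rewrite /f' /K; lia.
by split=> m /H'[].
Qed.

End stationary.
End toda_step.

(** * Deterministic uniqueness and the two-sided flow *)

Section half_solutions.
Context {R : realType}.

(** Time is the first index, so that [I t] is one row of data. Only t >= 0 occurs: pinning down U at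
    time t uses the row at t + 1 and never an earlier one. *)
Definition half_sol (I J U : nat -> int -> R) : Prop := forall t n,
  [/\ 0 < I t n, 0 < J t n & 0 < U t n] /\
  [/\ I t.+1 n = J t n + U t n,
      J t.+1 n = I t (n + 1) * J t n / I t.+1 n
    & U t (n + 1) = I t (n + 1) * U t n / I t.+1 n].

Lemma half_affine I J U : half_sol I J U ->
  forall t, toda_affine (I t) (J t) (fun n => (U t n)^-1).
Proof.
move=> h t n; have [[_ J0 U0] [IE _ UE]] := h t n; have [[I0 _ _] _] := h t (n + 1).
rewrite UE IE; have JU0 : 0 < J t n + U t n by rewrite addr_gt0.
by field; rewrite !gt_eqF.
Qed.

Lemma half_sol_Vperp I J U t n : half_sol I J U ->
  (forall N : nat, exists2 k, (N <= k)%N &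
     ratio (pastI (I t) n) (pastJ (J t) n) k <= 1) ->
  (U t n)^-1 = perp (pastI (I t) n) (pastJ (J t) n).
Proof.
move=> h io.
apply: (toda_affine_unique (V := fun m => (U t m)^-1)
  (V1 := fun m => (U t.+1 m)^-1)) io.
- by move=> m; have [[]] := h t m.
- by move=> m; have [[]] := h t m.
- by move=> m; rewrite invr_gt0; have [[]] := h t m.
- by move=> m; rewrite invr_gt0; have [[]] := h t.+1 m.
- exact: half_affine.
- have := half_affine h t.+1; congr toda_affine; apply/funext => m.
    by rewrite invrK; have [_ []] := h t m.
  by rewrite invrK; have [_ [<- ->]] := h t m.
Qed.

(** Row by row: the data at time t determine U through the perpetuity, and together they determine
    the data at t + 1. *)
Lemma half_unique I J U I' J' U' : half_sol I J U -> half_sol I' J' U' ->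
  I' 0%N = I 0%N -> J' 0%N = J 0%N ->
  (forall t n (N : nat), exists2 k, (N <= k)%N &
     ratio (pastI (I t) n) (pastJ (J t) n) k <= 1) ->
  forall t, [/\ I' t = I t, J' t = J t & U' t = U t].
Proof.
move=> h h' I00 J00 io.
have UE t : I' t = I t -> J' t = J t -> U' t = U t.
  move=> It Jt; apply/funext => n; apply: invr_inj.
  rewrite (half_sol_Vperp h (io t n)) (half_sol_Vperp h'); first by rewrite It Jt.
  by rewrite It Jt; exact: io.
elim=> [|t [It Jt Ut]]; first by split=> //; exact: UE.
have I1 : I' t.+1 = I t.+1.
  by apply/funext => n; have [_ [-> _ _]] := h t n; have [_ [-> _ _]] := h' t n;
    rewrite Jt Ut.
have J1 : J' t.+1 = J t.+1.
  by apply/funext => n; have [_ [_ -> _]] := h t n; have [_ [_ -> _]] := h' t n;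
    rewrite Jt It I1.
by split=> //; exact: UE.
Qed.

Lemma toda_sol_half (I J U : int -> int -> R) : toda_sol I J U ->
  half_sol (fun t n => I n t%:Z) (fun t n => J n t%:Z) (fun t n => U n t%:Z).
Proof.
by move=> h t n; have := h n t%:Z; rewrite (_ : t%:Z + 1 = t.+1%:Z)// intS addrC.
Qed.

Lemma shift_mirrorK (n : int) : - (- n - 1) - 1 = n. Proof. by lia. Qed.

(* Space-time reversal: the local map [(I,J,U) -> (J+U, IJ/(J+U), IU/(J+U))]
   is an involution, so it exchanges the two time directions. *)
Lemma toda_sol_mirror (I J U : int -> int -> R) : toda_sol I J U ->
  toda_sol (fun n t => I (- n) (- t)) (fun n t => J (- n - 1) (- t))
    (fun n t => U (- n) (- t - 1)).
Proof.
move=> h n t.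
have nE : - n = - n - 1 + 1 by rewrite subrK.
have tE : - t = - (t + 1) + 1 by rewrite opprD subrK.
have nE' : - (n + 1) = - n - 1 by rewrite opprD.
have tE' : - t - 1 = - (t + 1) by rewrite opprD.
have [[In Jn _] _] := h (- n) (- t); have [[_ Jn1 _] _] := h (- n - 1) (- t).
have [[I1 _ U1] [IE _ _]] := h (- n) (- (t + 1)).
have [[I2 J2 U2] [I2E JE UE]] := h (- n - 1) (- (t + 1)).
rewrite -tE in I2E JE UE; rewrite -nE in JE UE.
rewrite nE' tE'; split; first by split.
have s0 : 0 < J (- n - 1) (- (t + 1)) + U (- n - 1) (- (t + 1)) by exact: addr_gt0.
split.
- rewrite JE UE I2E; field; rewrite gt_eqF//.
- by rewrite JE I2E; field; rewrite !gt_eqF.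
- by rewrite UE I2E; field; rewrite !gt_eqF.
Qed.

Section glue.
Variables (I J U I' J' U' : nat -> int -> R).
Hypotheses (h : half_sol I J U) (h' : half_sol I' J' U').
Hypotheses (I0 : forall n, I' 0%N n = I 0%N (- n)) (J0 : forall n, J' 0%N n = J 0%N (- n - 1)).

(** [Negz s] is -(s + 1), read off the mirrored solution. U lives between times t and t + 1, so
    [glueU] uses the mirrored index s where [glueI] and [glueJ] use s + 1. *)
Definition glueI (n t : int) : R :=
  match t with Posz s => I s n | Negz s => I' s.+1 (- n) end.
Definition glueJ (n t : int) : R :=
  match t with Posz s => J s n | Negz s => J' s.+1 (- n - 1) end.
Definition glueU (n t : int) : R :=
  match t with Posz s => U s n | Negz s => U' s (- n) end.

Lemma glue_sol : toda_sol glueI glueJ glueU.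
Proof.
move=> n [s|s].
  have -> : Posz s + 1 = Posz s.+1 by rewrite intS addrC.
  exact: h.
have gI m : glueI m (Negz s + 1) = I' s (- m).
  case: s => [|s]; first by rewrite I0 opprK.
  by have -> : Negz s.+1 + 1 = Negz s by lia.
have gJ m : glueJ m (Negz s + 1) = J' s (- m - 1).
  case: s {gI} => [|s]; first by rewrite J0 shift_mirrorK.
  by have -> : Negz s.+1 + 1 = Negz s by lia.
rewrite gI gJ /=; have [[i1 j1 u1] [IE JE UE]] := h' s (- n - 1).
rewrite subrK in JE UE.
have [[_ j2 _] _] := h' s.+1 (- n - 1); have [[i2 _ _] _] := h' s.+1 (- n).
have [[i3 _ u3] _] := h' s (- n).
have nE : - (n + 1) = - n - 1 by rewrite opprD.
have s0 : 0 < J' s (- n - 1) + U' s (- n - 1) by exact: addr_gt0.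
rewrite nE; split; first by split.
by split; rewrite ?JE ?UE IE; field; rewrite ?gt_eqF.
Qed.

Lemma glue_unique (K L W : int -> int -> R) :
  (forall t n (N : nat), exists2 k, (N <= k)%N &
     ratio (pastI (I t) n) (pastJ (J t) n) k <= 1) ->
  (forall t n (N : nat), exists2 k, (N <= k)%N &
     ratio (pastI (I' t) n) (pastJ (J' t) n) k <= 1) ->
  toda_sol K L W -> (forall n, K n 0 = I 0%N n /\ L n 0 = J 0%N n) ->
  [/\ K = glueI, L = glueJ & W = glueU].
Proof.
move=> io io' sol KL.
have u := half_unique h (toda_sol_half sol) _ _ io.
have {}u := u (funext (fun n => (KL n).1)) (funext (fun n => (KL n).2)).
have u' := half_unique h' (toda_sol_half (toda_sol_mirror sol)) _ _ io'.
have {}u' t : [/\ (fun n => K (- n) (- t%:Z)) = I' t,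
    (fun n => L (- n - 1) (- t%:Z)) = J' t
    & (fun n => W (- n) (- t%:Z - 1)) = U' t].
  apply: u'; apply/funext => n; rewrite oppr0 ?I0 ?J0; first exact: (KL _).1.
  exact: (KL _).2.
split; apply/funext => n; apply/funext => -[s|s] /=.
- by have [<- _ _] := u s.
- by have [<- _ _] := u' s.+1; rewrite opprK NegzE.
- by have [_ <- _] := u s.
- by have [_ <- _] := u' s.+1; rewrite shift_mirrorK NegzE.
- by have [_ _ <-] := u s.
- by have [_ _ <-] := u' s; rewrite opprK NegzE -opprD (intS s) addrC.
Qed.

End glue.
End half_solutions.

(** * Iterating the step on i.i.d. data *)

Section toda_flow.
Context {R : realType} {d} {T : measurableType d} (P : probability T R).
Variables (m12 m1 mv : probability R R).
Hypothesis inv : forall A B C : set R, measurable A -> measurable B ->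
  measurable C ->
  prodP mv (prodP m12 m1) (toda_map_set A B C) = (m12 A * m1 B * mv C)%E.
Hypothesis mv_gt0 : mv `]-oo, 0%R]%classic = 0%E.

Definition gen_iid (p : (int -> T -> R) * (int -> T -> R)) : Prop :=
  [/\ forall k, measurable_fun setT (p.1 k), forall k, measurable_fun setT (p.2 k),
      forall k w, 0 < p.1 k w, forall k w, 0 < p.2 k w & pair_iid P m12 m1 p.1 p.2].

Fixpoint flow (p : (int -> T -> R) * (int -> T -> R)) (t : nat) :=
  if t is t'.+1 then
    let q := flow p t' in (Istep q.1 q.2, Jstep q.1 q.2)
  else p.

Lemma flow_iid p t : gen_iid p -> gen_iid (flow p t).
Proof.
move=> gp; elim: t => [//|t [mX mY X0 Y0 iid]]; split=> /=.
- exact: measurable_Istep.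
- exact: measurable_Jstep.
- exact: Istep_gt0.
- exact: Jstep_gt0.
- exact: step_iid iid _ inv mv_gt0.
Qed.

Lemma flow_half_sol p : gen_iid p -> {ae P, forall w,
  half_sol (fun t n => (flow p t).1 n w) (fun t n => (flow p t).2 n w)
    (fun t n => (Vperp (flow p t).1 (flow p t).2 n w)^-1) /\
  forall t n (N : nat), exists2 k, (N <= k)%N &
     ratio (pastI ((flow p t).1^~ w) n) (pastJ ((flow p t).2^~ w) n) k <= 1}.
Proof.
move=> gp.
have : {ae P, forall w t,
    toda_affine ((flow p t).1^~ w) ((flow p t).2^~ w)
      (Vperp (flow p t).1 (flow p t).2 ^~ w) /\
    forall n (N : nat), exists2 k, (N <= k)%N &
     ratio (pastI ((flow p t).1^~ w) n) (pastJ ((flow p t).2^~ w) n) k <= 1}.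
  apply: ae_countable => t; have [mX mY X0 Y0 iid] := flow_iid t gp.
  have fin := stationary_fin mX mY X0 Y0 iid inv mv_gt0.
  apply: filterS2 (Vperp_affine X0 Y0 fin) (past_ratio_io mX mY X0 Y0 iid fin).
  by move=> w ? ?.
apply: filterS => w H; split; last by move=> t; have [] := H t.
move=> t n; have [mX mY X0 Y0 _] := flow_iid t gp.
have V0 m : 0 < Vperp (flow p t).1 (flow p t).2 m w by exact: Vperp_gt0.
split; first by split=> //; rewrite invr_gt0.
split=> //; have [aff _] := H t; rewrite aff /= /Istep.
have := V0 n; have := X0 (n + 1) w; have := Y0 n w.
set x := (flow p t).1 _ _; set y := (flow p t).2 _ _; set v := Vperp _ _ _ _.
move=> y0 x0 v0; have : 0 < 1 + y * v by rewrite addr_gt0// mulr_gt0.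
have : 0 < y * v + 1 by rewrite addr_gt0// mulr_gt0.
by move=> ? ?; field; rewrite !gt_eqF.
Qed.

Lemma flow_toda_step (X Y : int -> T -> R) : gen_iid (X, Y) ->
  {ae P, forall w, toda_step (X^~ w) (Y^~ w) (Istep X Y ^~ w) (Jstep X Y ^~ w)}.
Proof.
move=> g.
(* The mirror of the row at time 0; it is again i.i.d. with the same marginals, and its forward flow
   supplies the negative times. *)
pose p' : (int -> T -> R) * (int -> T -> R) := (fun n => X (- n), fun n => Y (- n - 1)).
have g' : gen_iid p'.
  have [mX mY X0 Y0 iid] := g; split=> //=.
  have gK : cancel (fun n : int => - n - 1) (fun n => - n - 1).
    exact: shift_mirrorK.
  exact: pair_iid_reindex (@opprK int) gK iid.
apply: filterS2 (flow_half_sol g) (flow_half_sol g') => w [h io] [h' io'].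
have I0 (n : int) : (flow p' 0).1 n w = (flow (X, Y) 0).1 (- n) w by [].
have J0 (n : int) : (flow p' 0).2 n w = (flow (X, Y) 0).2 (- n - 1) w by [].
eexists; eexists; eexists; split; first exact: glue_sol h h' I0 J0.
- by [].
- by move=> K L W sol KL; exact: (glue_unique h h' I0 J0 io io' sol KL).
- by [].
Qed.

End toda_flow.

Section mfun_pack.
Context {d d'} {T : measurableType d} {U : measurableType d'} {f : T -> U}.
Variable mf : measurable_fun setT f.
HB.instance Definition _ := isMeasurableFun.Build d d' T U f mf.
Definition mfun_of : {mfun T >-> U} := f.
End mfun_pack.

Section gamma_laws.
Context {R : realType}.
Variables (l c : R).
Hypotheses (l0 : 0 < l) (c0 : 0 < c).

HB.instance Definition _ := Measure_isProbability.Build _ _ _ (gamma_prob l c)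
  (gamma_prob_setT l0 c0).

Definition gammaP : probability R R := gamma_prob l c.

(** The stationary law of V = 1/U when U is gamma. *)
Definition inv_gammaP : probability R R :=
  distribution gammaP (mfun_of (@measurable_invr R)).

Lemma gamma_prob_le0 : gamma_prob l c `]-oo, 0%R]%classic = 0%E.
Proof.
rewrite gamma_probE integral0_eq ?mul0e// => x /=.
by rewrite in_itv/= /gam_dens => x0; rewrite ltNge x0.
Qed.

Lemma inv_gammaP_le0 : inv_gammaP `]-oo, 0%R]%classic = 0%E.
Proof.
rewrite -[RHS]gamma_prob_le0 /inv_gammaP /= /distribution /pushforward /=.
by congr (gamma_prob l c _); apply/seteqP; split=> x /=; rewrite !in_itv/= invr_le0.
Qed.

End gamma_laws.

Section positive_version.
Context {R : realType} {d} {T : measurableType d}.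

(** The perpetuity lemmas ask for positivity at every point, while the data are positive only almost
    surely; the value 1 is an arbitrary filler on a null set. *)
Definition pos_version (f : T -> R) (w : T) : R := if 0 < f w then f w else 1.

Lemma pos_version_gt0 f w : 0 < pos_version f w.
Proof. by rewrite /pos_version; case: ifP. Qed.

Lemma measurable_pos_version f : measurable_fun setT f ->
  measurable_fun setT (pos_version f).
Proof. by move=> mf; apply: measurable_fun_ifT => //; exact: measurable_fun_ltr. Qed.

Lemma pos_versionE f w : 0 < f w -> pos_version f w = f w.
Proof. by rewrite /pos_version => ->. Qed.

End positive_version.

(** * Invariance of the gamma laws *)

Section existence.
Context {R : realType} {d} {T : measurableType d} (P : probability T R).

Lemma pair_iid_same_law m12 m1 (X Y X' Y' : int -> T -> R) :
  pair_iid P m12 m1 X Y -> pair_iid P m12 m1 X' Y' -> same_law_pairs P X Y X' Y'.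
Proof.
have E (U V : int -> T -> R) s A B : rect_event U V s A B =
    pair_event U V (undup s) (undup s) A B.
  apply/seteqP; split=> w /=.
    by move=> H; split=> k; rewrite mem_undup => /H[].
  by move=> [HA HB] k ks; split; [apply: HA|apply: HB]; rewrite mem_undup.
move=> iid iid' s A B mAB.
have mA k : measurable (A k) by have [] := mAB k.
have mB k : measurable (B k) by have [] := mAB k.
by rewrite !E iid ?iid' ?undup_uniq.
Qed.

Lemma pairs_independent_iid (m12 m1 : probability R R) (X Y : int -> T -> R) :
  pairs_independent P X Y ->
  (forall n (A B : set R), measurable A -> measurable B ->
     P (X n @^-1` A `&` Y n @^-1` B) = (m12 A * m1 B)%E) ->
  pair_iid P m12 m1 X Y.
Proof.
move=> ind law; apply: pair_iid_rect => s A B us mA mB.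
have := ind s A B us (fun n => conj (mA n) (mB n)).
have -> : rect_event X Y s A B = pair_event X Y s s A B.
  apply/seteqP; split=> w /=; first by move=> H; split=> k /H[].
  by move=> [HA HB] k ks; split; [exact: HA|exact: HB].
move=> ->; rewrite -prodEFin; apply: eq_bigr => n _.
by rewrite law// !prE.
Qed.

Lemma gamma_toda_invariant (lam1 lam2 c : R) (I0 J0 : int -> {RV P >-> R}) :
  0 < lam1 -> 0 < lam2 -> 0 < c ->
  pairs_independent P (fun n => I0 n) (fun n => J0 n) ->
  (forall n (A B : set R), measurable A -> measurable B ->
     P (I0 n @^-1` A `&` J0 n @^-1` B) =
     (gamma_prob (lam1 + lam2) c A * gamma_prob lam1 c B)%E) ->
  toda_invariant I0 J0.
Proof.
move=> l1 l2 c0 ind law; have l12 : 0 < lam1 + lam2 by exact: addr_gt0.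
pose m12 := gammaP l12 c0; pose m1 := gammaP l1 c0; pose mv := inv_gammaP l2 c0.
have iid : pair_iid P m12 m1 (fun n => I0 n) (fun n => J0 n).
  exact: pairs_independent_iid.
have inv A B C : measurable A -> measurable B -> measurable C ->
    prodP mv (prodP m12 m1) (toda_map_set A B C) = (m12 A * m1 B * mv C)%E.
  by apply: (@gamma_toda_map _ lam1 lam2 c).
have mv0 := inv_gammaP_le0 l2 c0.
pose X n := pos_version (I0 n); pose Y n := pos_version (J0 n).
have mX n : measurable_fun setT (X n) by exact: measurable_pos_version.
have mY n : measurable_fun setT (Y n) by exact: measurable_pos_version.
have XE : {ae P, forall w n, 0 < I0 n w /\ 0 < J0 n w}.
  apply: ae_countable => n.
  have pI : P (I0 n @^-1` `]-oo, 0]%classic) = 0%E.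
    have := law n _ setT (measurable_itv `]-oo, 0]) measurableT.
    by rewrite preimage_setT setIT gamma_prob_le0 mul0e.
  have pJ : P (J0 n @^-1` `]-oo, 0]%classic) = 0%E.
    have := law n setT _ measurableT (measurable_itv `]-oo, 0]).
    by rewrite preimage_setT setTI gamma_prob_le0 mule0.
  have aI : {ae P, forall w, 0 < I0 n w}.
    exists (I0 n @^-1` `]-oo, 0]%classic); split=> //.
      exact: measurable_preimage.
    by move=> w /= /negP; rewrite in_itv/= leNgt.
  have aJ : {ae P, forall w, 0 < J0 n w}.
    exists (J0 n @^-1` `]-oo, 0]%classic); split=> //.
      exact: measurable_preimage.
    by move=> w /= /negP; rewrite in_itv/= leNgt.
  by apply: filterS2 aI aJ.
have iidXY : pair_iid P m12 m1 X Y.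
  apply: pair_iid_ae_eq iid => //; apply: filterS XE => w H.
  by split=> n; have [? ?] := H n; rewrite ?/X ?/Y pos_versionE.
have g : gen_iid P m12 m1 (X, Y).
  by split=> //= n w; exact: pos_version_gt0.
have X0 n w : 0 < X n w by exact: pos_version_gt0.
have Y0 n w : 0 < Y n w by exact: pos_version_gt0.
have mI n : measurable_fun setT (Istep X Y n) by exact: measurable_Istep.
have mJ n : measurable_fun setT (Jstep X Y n) by exact: measurable_Jstep.
exists (fun n => mfun_of (mI n)), (fun n => mfun_of (mJ n)); split.
  apply: filterS2 XE (flow_toda_step inv mv0 g) => w H.
  by congr toda_step; apply/funext => n; have [? ?] := H n; rewrite ?/X ?/Y pos_versionE.
apply: pair_iid_same_law iid; exact: step_iid iidXY _ inv mv0.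
Qed.

End existence.

(** * Laplace transforms *)

Section laplace_uniqueness.
Context {R : realType}.
Implicit Types (m : probability R R) (s x : R).

Local Notation D := (`]0%R, +oo[%classic : set R).

Definition laplace m s : \bar R := (\int[m]_(x in D) (expR (- (s * x)))%:E)%E.

Let mexp s : measurable_fun setT (fun x : R => expR (- (s * x))).
Proof.
apply: measurableT_comp; first exact: measurable_expR.
by apply: measurableT_comp => //; exact: measurable_funM.
Qed.

(** At s = 0 this is an approximate indicator of a half line that expands into exponentials, so the
    Laplace transform determines its integral. The factor e^(-s x) serves the induction on N:
    multiplication by e^(-b x) shifts s to s + b. *)
Let sieve s b N x : R := expR (- (s * x)) * (1 - expR (- (b * x))) ^+ N.

Let msieve s b N : measurable_fun setT (sieve s b N).
Proof.
apply: measurable_funM; first exact: mexp.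
by apply: measurable_funX; apply: measurable_funB.
Qed.

Let sieve_bound s b N x : 0 <= s -> 0 <= b -> 0 < x -> 0 <= sieve s b N x <= 1.
Proof.
move=> s0 b0 x0.
have e1 r : 0 <= r -> expR (- (r * x)) <= 1.
  by move=> r0; rewrite -expR0 ler_expR oppr_le0 mulr_ge0// ltW.
have u0 : 0 <= 1 - expR (- (b * x)) by rewrite subr_ge0 e1.
have u1 : 1 - expR (- (b * x)) <= 1 by rewrite gerBl expR_ge0.
by rewrite /sieve mulr_ge0 ?expR_ge0 ?exprn_ge0//= mulr_ile1 ?expR_ge0 ?exprn_ge0 ?e1// exprn_ile1.
Qed.

Let sieve_integrable m s b N : 0 <= s -> 0 <= b ->
  m.-integrable D (EFin \o sieve s b N).
Proof.
move=> s0 b0; apply: (@le_integrable _ _ R m D _ _ (cst 1%E)) => //.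
- by apply/measurable_EFinP; exact: measurable_funTS.
- move=> x /=; rewrite in_itv/= andbT => x0.
  have /andP[h0 h1] := sieve_bound N s0 b0 x0.
  by rewrite normr1 lee_fin ger0_norm.
- exact: finite_measure_integrable_cst.
Qed.

Let sieve_eq m1 m2 b : m1 D = m2 D ->
  (forall s, 0 < s -> laplace m1 s = laplace m2 s) -> 0 <= b ->
  forall N s, 0 <= s ->
  (\int[m1]_(x in D) (sieve s b N x)%:E = \int[m2]_(x in D) (sieve s b N x)%:E)%E.
Proof.
move=> mD lap b0; elim=> [|N IH] s s0.
  have E m : (\int[m]_(x in D) (sieve s b 0 x)%:E = laplace m s)%E.
    by apply: eq_integral => x _; rewrite /sieve expr0 mulr1.
  rewrite !E; have [->|s0'] := eqVneq s 0; last by rewrite lap// lt0r s0' s0.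
  have E0 m : laplace m 0 = m D.
    rewrite /laplace -[RHS]mul1e -[X in (X * _)%E]/(1%:E) -integral_cst//.
    by apply: eq_integral => x _; rewrite mul0r oppr0 expR0.
  by rewrite !E0.
have E m : (\int[m]_(x in D) (sieve s b N.+1 x)%:E =
    \int[m]_(x in D) (sieve s b N x)%:E - \int[m]_(x in D) (sieve (s + b) b N x)%:E)%E.
  rewrite -integralB//; [|exact: sieve_integrable|by apply: sieve_integrable => //; exact: addr_ge0].
  apply: eq_integral => x _; rewrite -EFinB; congr EFin.
  rewrite /sieve exprS (_ : - ((s + b) * x) = - (s * x) + - (b * x)); last by ring.
  by rewrite expRD; ring.
by rewrite !E !IH// addr_ge0.
Qed.

Lemma bernoulli_le (z : R) N : 0 <= z <= 1 -> 1 - N%:R * z <= (1 - z) ^+ N.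
Proof.
move=> /andP[z0 z1]; elim: N => [|N IH]; first by rewrite mul0r subr0 expr0.
rewrite exprS; apply: le_trans (ler_wpM2l _ IH); last by rewrite subr_ge0.
rewrite -natr1; have : 0 <= N%:R * z * z by rewrite !mulr_ge0.
nra.
Qed.

Lemma one_sub_expn_le (z : R) N : 0 <= z <= 1 -> (1 - z) ^+ N <= (1 + N%:R * z)^-1.
Proof.
move=> /andP[z0 z1]; have Nz : 0 <= N%:R * z by rewrite mulr_ge0.
apply: le_trans (_ : expR (- z) ^+ N <= _).
  by apply: lerXn2r; rewrite ?nnegrE ?subr_ge0 ?expR_ge0// expR_ge1Dx.
rewrite -expRM_natl mulrN expRN lef_pV2 ?posrE ?expR_gt0//; last first.
  by rewrite ltr_wpDr.
exact: expR_ge1Dx.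
Qed.

Lemma exp_small (q e : R) : 0 <= q < 1 -> 0 < e -> exists N, forall n, (N <= n)%N -> q ^+ n <= e.
Proof.
move=> /andP[q0 q1] e0.
have /cvgrPdist_le /(_ _ e0) [N _ HN] : (q ^+ n) @[n --> \oo] --> 0.
  by apply: cvg_expr; rewrite ger0_norm.
exists N => n Nn; have := HN n Nn => /=.
by rewrite sub0r normrN ger0_norm// exprn_ge0.
Qed.

(** With N = 2^n and b = a n, N e^(-b x) = (2 e^(-a x))^n, which tends to 0 or to infinity according
    to the side of ln 2 / a on which x lies. So (1 - e^(-b x))^N tends to 1 or to 0, by Bernoulli's
    inequality and by the bound 1 / (1 + N z). *)
Let tail_le m1 m2 (t t' : R) : m1 D = m2 D ->
  (forall s, 0 < s -> laplace m1 s = laplace m2 s) -> 0 < t -> t < t' ->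
  m2 `]-oo, 0]%classic = 0%E ->
  pr m1 `]t', +oo[%classic <= pr m2 `]t, +oo[%classic.
Proof.
move=> mD lap t0 tt' m20; apply/ler_addgt0Pr => e e0.
have e20 : 0 < e / 2 by rewrite divr_gt0.
(* The threshold ln 2 / a is put midway between t and t', which makes both [q1] and [q2] less than
   1. *)
pose tau := (t + t') / 2.
have [ttau taut'] : t < tau /\ tau < t' by have := midf_lt tt' => -[].
have tau0 : 0 < tau by exact: lt_trans ttau.
pose a := ln 2 / tau.
have ln20 : 0 < ln (2 : R) by rewrite ln_gt0// ltr1n.
have a0 : 0 < a by rewrite divr_gt0.
have atau : a * tau = ln 2 by rewrite /a divfK// gt_eqF.
have e2 : expR (- (a * tau)) = 2^-1 by rewrite atau expRN lnK// posrE.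
pose q1 := 2 * expR (- (a * t')).
have q1b : 0 <= q1 < 1.
  rewrite mulr_ge0 ?expR_ge0//= -[ltRHS](_ : 2 * expR (- (a * tau)) = 1).
    by rewrite ltr_pM2l// ltr_expR ltrN2 ltr_pM2l.
  by rewrite e2 divff.
pose q2 := (2 * expR (- (a * t)))^-1.
have q2b : 0 <= q2 < 1.
  rewrite invr_ge0 mulr_ge0 ?expR_ge0//= invf_lt1 ?mulr_gt0 ?expR_gt0//.
  rewrite -[ltLHS](_ : 2 * expR (- (a * tau)) = 1).
    by rewrite ltr_pM2l// ltr_expR ltrN2 ltr_pM2l.
  by rewrite e2 divff.
have [N1 HN1] := exp_small q1b e20; have [N2 HN2] := exp_small q2b e20.
pose n := maxn N1 N2; pose N := (2 ^ n)%N; pose b := a * n%:R.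
have b0 : 0 <= b by rewrite mulr_ge0// ltW.
have NE x : N%:R * expR (- (b * x)) = (2 * expR (- (a * x))) ^+ n.
  by rewrite exprMn natrX -expRM_natl; congr (_ * expR _); rewrite /b; ring.
have zb x : 0 < x -> 0 <= expR (- (b * x)) <= 1.
  by move=> x0; rewrite expR_ge0/= -expR0 ler_expR oppr_le0 mulr_ge0// ltW.
have F1 x : t' < x -> 1 - e / 2 <= sieve 0 b N x.
  move=> t'x; have x0 : 0 < x by rewrite (lt_trans _ t'x)// (lt_trans t0).
  rewrite /sieve mul0r oppr0 expR0 mul1r; apply: le_trans (bernoulli_le N (zb x x0)).
  rewrite lerB// NE; apply: le_trans (HN1 n (leq_maxl _ _)).
  apply: lerXn2r; rewrite ?nnegrE ?mulr_ge0 ?expR_ge0// /q1.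
  by rewrite ler_pM2l// ler_expR lerN2 ler_pM2l// ltW.
have F2 x : 0 < x -> x <= t -> sieve 0 b N x <= e / 2.
  move=> x0 xt.
  rewrite /sieve mul0r oppr0 expR0 mul1r; apply: le_trans (one_sub_expn_le N (zb x x0)) _.
  apply: le_trans (HN2 n (leq_maxr _ _)); rewrite NE /q2 exprVn.
  have h y : 0 < (2 * expR (- (a * y))) ^+ n by rewrite exprn_gt0// mulr_gt0 ?expR_gt0.
  rewrite lef_pV2 ?posrE ?addr_gt0 ?h//.
  rewrite ler_wpDl//; apply: lerXn2r; rewrite ?nnegrE ?mulr_ge0 ?expR_ge0//.
  by rewrite ler_pM2l// ler_expR lerN2 ler_pM2l.
have mF : measurable_fun D (fun x => (sieve 0 b N x)%:E).
  by apply/measurable_EFinP; exact: measurable_funTS.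
have F0 x : D x -> (0 <= (sieve 0 b N x)%:E)%E.
  rewrite /= in_itv/= andbT => x0; have := sieve_bound N (lexx 0) b0 x0.
  by rewrite lee_fin => /andP[].
(* For e >= 2 the claim is trivial; otherwise 1 - e / 2 is positive, as the lower bound of the
   integral requires. *)
have [e2le|e2gt] := leP (1 - e / 2) 0.
  have : pr m1 `]t', +oo[%classic <= 1.
    by rewrite -lee_fin -prE//; exact: probability_le1.
  have := pr_ge0 m2 `]t, +oo[%classic.
  lra.
have lower : (((1 - e / 2) * pr m1 `]t', +oo[%classic)%R%:E <=
    \int[m1]_(x in D) (sieve 0 b N x)%:E)%E.
  apply: le_trans (_ : \int[m1]_(x in `]t', +oo[%classic) (1 - e / 2)%R%:E <= _)%E.
    by rewrite integral_cst// EFinM -prE.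
  apply: le_trans (_ : \int[m1]_(x in `]t', +oo[%classic) (sieve 0 b N x)%:E <= _)%E.
    apply: ge0_le_integral => //.
    - by move=> x _; rewrite lee_fin ltW.
    - by apply/measurable_EFinP; exact: measurable_funTS.
    - by move=> x /=; rewrite in_itv/= andbT lee_fin; exact: F1.
  apply: ge0_subset_integral => //.
  by move=> x /=; rewrite !in_itv/= !andbT; apply: lt_trans; exact: lt_trans tt'.
have upper : (\int[m2]_(x in D) (sieve 0 b N x)%:E <=
    (e / 2 + pr m2 `]t, +oo[%classic)%R%:E)%E.
  apply: le_trans (_ : \int[m2]_(x in D) ((e / 2)%R%:E + (\1_(`]t, +oo[%classic) x)%:E) <= _)%E.
    apply: ge0_le_integral => //.
    - apply: emeasurable_funD => //; apply/measurable_EFinP; apply: measurable_funTS.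
      exact: measurable_indic.
    - move=> x Dx; have x0 : 0 < x by move: Dx; rewrite /= in_itv/= andbT.
      rewrite -EFinD lee_fin indicE; have [tx|xt] := ltP t x; last first.
        by rewrite (le_trans (F2 x x0 xt))// lerDl.
      rewrite mem_set/= ?in_itv/= ?tx//.
      have /andP[_ h] := sieve_bound N (lexx 0) b0 x0.
      by rewrite (le_trans h)// lerDr ltW.
  rewrite ge0_integralD//; first last.
  - by apply/measurable_EFinP; apply: measurable_funTS; exact: measurable_indic.
  - by move=> x _; rewrite lee_fin ltW.
  rewrite integral_cst// EFinD; apply: leeD.
    rewrite -[leRHS]mule1; apply: lee_wpmul2l; first by rewrite lee_fin ltW.
    exact: probability_le1.
  rewrite integral_indic// -prE//; apply: le_measure; rewrite ?inE//.
  exact: measurableI.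
have := le_trans lower; rewrite (sieve_eq mD lap b0 N (lexx 0)) => /(_ _ upper).
rewrite lee_fin => h.
have p1 : pr m1 `]t', +oo[%classic <= 1.
  by rewrite -lee_fin -prE//; exact: probability_le1.
have : e / 2 * pr m1 `]t', +oo[%classic <= e / 2 by rewrite ler_piMr// ltW.
move: h; rewrite mulrBl mul1r; lra.
Qed.

Lemma laplace_unique m1 m2 : m1 `]-oo, 0%R]%classic = 0%E ->
  m2 `]-oo, 0%R]%classic = 0%E ->
  (forall s, 0 < s -> laplace m1 s = laplace m2 s) ->
  forall A, measurable A -> m1 A = m2 A.
Proof.
move=> m10 m20 lap.
have mD m : m `]-oo, 0%R]%classic = 0%E -> m D = 1%E.
  by move=> m0; rewrite -setCitvl probability_setC// m0 sube0.
have mD12 : m1 D = m2 D by rewrite !mD.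
have le m m' (t : R) : m D = m' D -> (forall s, 0 < s -> laplace m s = laplace m' s) ->
    m `]-oo, 0%R]%classic = 0%E -> m' `]-oo, 0%R]%classic = 0%E ->
    pr m `]t, +oo[%classic <= pr m' `]t, +oo[%classic.
  move=> mm' lap' m0 m'0; have [t0|t0] := ltP 0 t; last first.
    have -> : pr m' `]t, +oo[%classic = 1.
      apply/eqP; rewrite eq_le -!lee_fin -prE// probability_le1//= -(mD _ m'0).
      apply: le_measure; rewrite ?inE// => x /=; rewrite !in_itv/= !andbT.
      exact: le_lt_trans.
    by rewrite -lee_fin -prE//; exact: probability_le1.
  apply: (@pr_increasing _ _ _ m (fun n => `]t + n.+1%:R^-1, +oo[%classic)) => //.
  - move=> n k nk u /=; rewrite !in_itv/= !andbT; apply: le_lt_trans.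
    by rewrite lerD2l lef_pV2// ?posrE// ler_nat.
  - by move=> n; apply: tail_le => //; rewrite ltrDl invr_gt0.
  - apply: aeW => u /=; rewrite in_itv/= andbT => xu.
    have ux0 : 0 < u - t by rewrite subr_gt0.
    exists (Num.bound (u - t)^-1); rewrite /= in_itv/= andbT -ltrBrDl.
    rewrite invf_plt ?posrE//; apply: lt_trans (archi_boundP _) _.
      by rewrite invr_ge0 ltW.
    by rewrite ltr_nat.
move=> A mA; apply: ray_measure_unique => //.
  by rewrite (le_lt_trans (probability_le1 m1 measurableT))// ltry.
move=> t; rewrite [LHS](prE m1 (measurable_itv _)) [RHS](prE m2 (measurable_itv _)).
congr EFin; apply/eqP.
by rewrite eq_le !le// => s s0; rewrite lap.
Qed.

End laplace_uniqueness.

Section gamma_laplace.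
Context {R : realType}.

(** The factor e^(-s x) changes the rate from c to c + s, and scaling compares the two normalising
    constants. *)
Lemma laplace_gammaP (l c : R) (l0 : 0 < l) (c0 : 0 < c) (s : R) : 0 < s ->
  laplace (gammaP l0 c0) s = ((c / (c + s)) `^ l)%:E.
Proof.
move=> s0; have cs0 : 0 < c + s by exact: addr_gt0.
pose f (x : R) := (((fun x => (expR (- (s * x)))%:E) \_ `]0%R, +oo[) x)%E.
have me : measurable_fun setT (fun x : R => (expR (- (s * x)))%:E).
  apply/measurable_EFinP; apply: measurableT_comp; first exact: measurable_expR.
  by apply: measurableT_comp => //; exact: measurable_funM.
have mf : measurable_fun setT f.
  by apply/(measurable_restrictT _ _).1 => //; exact: measurable_funTS.
have f0 x : (0 <= f x)%E by apply: erestrict_ge0 => y _; rewrite lee_fin expR_ge0.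
rewrite /laplace integral_mkcond.
transitivity (\int[gamma_prob l c]_x f x)%E; first by [].
rewrite (ge0_integral_gamma_prob l c mf f0).
have -> : (\int[lebesgue_measure]_x (f x * (gam_dens l c x)%:E) = gam_mass l (c + s))%E.
  apply: eq_integral => x _; rewrite /f patchE /gam_dens.
  case: ifPn => x0; last first.
    by rewrite mul0e; case: ifPn => // x0'; move: x0; rewrite notin_setE /= in_itv/= x0'.
  move: x0; rewrite inE/= in_itv/= andbT => x0; rewrite x0 -EFinM; congr EFin.
  rewrite mulrCA -expRD; congr (_ * expR _); ring.
have k0 : 0 < (c + s) / c by rewrite divr_gt0.
have := gam_mass_scale l c k0.
have -> : c * ((c + s) / c) = c + s by field; rewrite gt_eqF.
have := gam_mass_gt0 l0 cs0; have := gam_mass_fin l0 cs0.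
case: (gam_mass l (c + s)) => // r _; rewrite lte_fin => r0 -> /=.
have kl0 : ((c + s) / c) `^ l != 0 by rewrite gt_eqF// powR_gt0.
have h : ((c + s) / c) `^ l * (c / (c + s)) `^ l = 1.
  rewrite -powRM ?divr_ge0 ?ltW//.
  by rewrite [X in powR X](_ : _ = 1) ?powR1//; field; rewrite !gt_eqF.
rewrite -EFinM invfM mulfVK ?gt_eqF//; congr EFin.
by apply: (mulfI kl0); rewrite h divff.
Qed.

End gamma_laplace.

Lemma is_derive1M {R : realType} (f g : R -> R) (x a b : R) :
  is_derive x (1 : R) f a -> is_derive x (1 : R) g b ->
  is_derive x (1 : R) (fun y => f y * g y) (f x * b + g x * a).
Proof. by move=> df dg; exact: (@is_deriveM _ _ f g). Qed.

Lemma is_derive1V {R : realType} (f : R -> R) (x a : R) : f x != 0 ->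
  is_derive x (1 : R) f a -> is_derive x (1 : R) (fun y => (f y)^-1) (- a / f x ^+ 2).
Proof.
move=> f0 df; apply: (is_derive_eq (is_deriveV f0 df)).
by rewrite /GRing.scale/= mulNr mulrC mulNr.
Qed.

Lemma Rintegral_gt0 {R : realType} {d} {T : measurableType d} (P : probability T R)
    (f : T -> R) :
  P.-integrable setT (EFin \o f) -> (forall w, 0 < f w) -> 0 < \int[P]_w f w.
Proof.
move=> intf f0; rewrite lt_neqAle; apply/andP; split; last first.
  by apply: Rintegral_ge0 => w _; exact: ltW.
rewrite eq_sym; apply/negP => /eqP E.
have mf : measurable_fun setT (EFin \o f) by exact: measurable_int intf.
have h : (\int[P]_w `|(EFin \o f) w| = 0)%E.
  rewrite -[RHS]/(0%:E) -E /Rintegral fineK; last exact: integrable_fin_num.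
  by apply: eq_integral => w _ /=; rewrite gtr0_norm.
have [N [mN N0 sub]] := (ae_eq_integral_abs P measurableT mf).1 h.
have NT : N = setT.
  apply/seteqP; split=> // w _; apply: sub => /= /(_ Logic.I) [fw0].
  by have := f0 w; rewrite fw0 ltxx.
by move: (esym (probability_setT P)); rewrite -NT => /(fun e => etrans e N0)/eqP; rewrite onee_eq0.
Qed.

(** * Exponential moments of a positive variable *)

Section exponential_moments.
Context {R : realType} {d} {T : measurableType d} (P : probability T R).
Variable X : T -> R.
Hypotheses (mX : measurable_fun setT X) (X0 : forall w, 0 < X w).

(** Up to the sign (-1)^k, the k-th derivative of the Laplace transform; at s > 0 it is finite for
    every positive [X]. *)
Definition emom (k : nat) (s : R) : R := \int[P]_w (X w ^+ k * expR (- (s * X w))).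

Lemma measurable_emom k s : measurable_fun setT (fun w => X w ^+ k * expR (- (s * X w))).
Proof.
apply: measurable_funM; first exact: measurable_funX.
apply: measurableT_comp; first exact: measurable_expR.
by apply: measurableT_comp => //; exact: measurable_funM.
Qed.

(** One term of the exponential series, (s x)^k / k!, is at most e^(s x). *)
Lemma emom_bound k (s x : R) : 0 < s -> 0 <= x -> x ^+ k * expR (- (s * x)) <= k`!%:R / s ^+ k.
Proof.
move=> s0 x0; rewrite ler_pdivlMr ?exprn_gt0// mulrAC -exprMn mulrC expRN.
rewrite mulrC ler_pdivrMr ?expR_gt0// [x * s]mulrC.
have sx0 : 0 <= s * x by rewrite mulr_ge0// ltW.
case: k => [|k]; first by rewrite expr0 fact0 mul1r -expR0 ler_expR.
have h : (s * x) ^+ k.+1 / (k.+1)`!%:R <= expR (s * x).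
  by apply: le_trans (expR_ge1Dxn k sx0); rewrite lerDr.
by rewrite [leRHS]mulrC; move: h; rewrite ler_pdivrMr ?ltr0n ?fact_gt0.
Qed.

Lemma emom_integrable k s : 0 < s ->
  P.-integrable setT (EFin \o (fun w => X w ^+ k * expR (- (s * X w)))).
Proof.
move=> s0; apply: (@le_integrable _ _ R P setT _ _ (cst (k`!%:R / s ^+ k)%:E)) => //.
- by apply/measurable_EFinP; exact: measurable_emom.
- move=> w _ /=; rewrite lee_fin.
  have x0 := ltW (X0 w).
  have k0 : 0 <= k`!%:R / s ^+ k by rewrite divr_ge0// exprn_ge0// ltW.
  rewrite (ger0_norm k0) ger0_norm; first exact: emom_bound.
  by rewrite mulr_ge0 ?expR_ge0// exprn_ge0.
- exact: finite_measure_integrable_cst.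
Qed.

Lemma is_derive_emom k (s : R) : 0 < s -> is_derive s (1 : R) (emom k) (- emom k.+1 s).
Proof.
move=> s0.
pose f (s : R) (w : T) : R := X w ^+ k * expR (- (s * X w)).
have df (x : R) w : is_derive x (1 : R) (f ^~ w) (- (X w ^+ k.+1 * expR (- (x * X w)))).
  have d1 : is_derive x (1 : R) (fun x : R => - (x * X w)) (- X w).
    by apply: is_derive_eq; rewrite scaler0 add0r scaler1.
  have d2 : is_derive x (1 : R) (fun x : R => expR (- (x * X w))) (expR (- (x * X w)) * - X w).
    exact: (is_derive1_comp (is_derive_expR _) d1).
  apply: (is_derive_eq (is_derive1M (f := fun=> X w ^+ k) (is_derive_cst _ _ _) d2)).
  by rewrite mulr0 addr0 exprS; ring.
have k1 : 0 < s / 2 by rewrite divr_gt0.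
have Is : `](s / 2), (s + 1)[%classic s by rewrite /= in_itv/=; apply/andP; split; lra.
(* A constant dominates the derivative for x in ]s/2, s + 1[: there e^(-x X) <= e^(-(s/2) X), and
   [emom_bound] applies at s/2. *)
pose G (w : T) : R := (k.+1)`!%:R / (s / 2) ^+ k.+1.
have G0 w : 0 <= G w by rewrite /G divr_ge0// exprn_ge0// ltW.
have intf x : `](s / 2), (s + 1)[%classic x -> P.-integrable setT (EFin \o f x).
  by rewrite /= in_itv/= => /andP[x0 _]; apply: emom_integrable; lra.
have derf x w : `](s / 2), (s + 1)[%classic x -> [set: T] w -> derivable (f ^~ w) x 1.
  by move=> _ _; case: (df x w).
have d1E x w : partial1of2 f x w = - (X w ^+ k.+1 * expR (- (x * X w))).
  by rewrite partial1of2E; case: (df x w).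
have G_ub x w : `](s / 2), (s + 1)[%classic x -> [set: T] w -> `|partial1of2 f x w| <= G w.
  rewrite /= in_itv/= => /andP[x0 _] _; rewrite d1E normrN ger0_norm; last first.
    by rewrite mulr_ge0 ?expR_ge0// exprn_ge0// ltW.
  apply: le_trans (emom_bound k.+1 k1 (ltW (X0 w))).
  rewrite ler_wpM2l ?exprn_ge0 ?(ltW (X0 w))// ler_expR lerN2 ler_wpM2r ?(ltW (X0 w))//.
  exact: ltW.
have intG : P.-integrable setT (EFin \o G) by exact: finite_measure_integrable_cst.
apply: DeriveDef; first exact: (derivable_under_integral measurableT Is intf derf G0 intG G_ub).
rewrite -derive1E (differentiation_under_integral measurableT Is intf derf G0 intG G_ub).
rewrite /emom -mulN1r -RintegralZl//; last exact: emom_integrable.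
by apply: eq_Rintegral => w _; rewrite d1E mulN1r.
Qed.

Lemma emom_gt0 k (s : R) : 0 < s -> 0 < emom k s.
Proof.
move=> s0; apply: Rintegral_gt0; first exact: emom_integrable.
by move=> w; rewrite mulr_gt0 ?expR_gt0// exprn_gt0.
Qed.

Lemma emom0_le1 (s : R) : 0 < s -> emom 0 s <= 1.
Proof.
move=> s0; have -> : 1 = \int[P]_w (cst 1 w) :> R.
  by rewrite Rintegral_cst// mul1r -[LHS]/(fine 1%E) -(probability_setT P).
apply: le_Rintegral => //; first exact: emom_integrable.
- exact: finite_measure_integrable_cst.
- move=> w _; rewrite expr0 mul1r -expR0 ler_expR oppr_le0 mulr_ge0 ?ltW//.
Qed.

(** The differential equations for the transforms hold only for s > 0; this limit supplies their
    initial condition at 0. *)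
Lemma emom0_cvg : (emom 0 (n.+1%:R^-1 : R)) @[n --> \oo] --> (1 : R).
Proof.
apply: fine_cvg => /=.
have -> : 1%:E = (\int[P]_w (cst 1%E w))%E :> \bar R.
  by rewrite integral_cst// -[LHS]mule1 -(probability_setT P).
apply: (@dominated_cvg _ _ _ P setT measurableT _ _ (cst 1%E)) => //=.
- by move=> n; apply/measurable_EFinP; exact: measurable_emom.
- move=> w _; apply: cvg_EFin; first exact: nearW.
  under eq_fun do rewrite /= expr0 mul1r.
  have h : - (n.+1%:R^-1 * X w) @[n --> \oo] --> (- (0 * X w) : R).
    by apply: cvgN; apply: cvgM; [exact: (@cvg_harmonic R)|exact: cvg_cst].
  have := continuous_cvg _ (@continuous_expR R _) h.
  by rewrite mul0r oppr0 expR0; apply.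
- exact: finite_measure_integrable_cst.
- move=> n w _; rewrite lee_fin expr0 mul1r ger0_norm ?expR_ge0//.
  by rewrite -expR0 ler_expR oppr_le0 mulr_ge0 ?invr_ge0 ?ltW.
Qed.

Lemma emom0_laplace (s : R) : 0 < s ->
  laplace (distribution P (mfun_of mX)) s = (emom 0 s)%:E.
Proof.
move=> s0; rewrite /laplace /emom /Rintegral fineK; last first.
  by apply: integrable_fin_num => //; exact: (emom_integrable 0).
rewrite ge0_integral_pushforward//.
- rewrite (_ : _ @^-1` _ = setT); last first.
    by apply/seteqP; split=> w //= _; rewrite in_itv/= X0.
  by apply: eq_integral => w _ /=; rewrite expr0 mul1r.
- apply/measurable_EFinP; apply: measurableT_comp; first exact: measurable_expR.
  by apply: measurableT_comp => //; exact: measurable_funM.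
Qed.

End exponential_moments.

(** * Lukacs' characterization of the gamma laws *)

Section exponential_solutions.
Context {R : realType}.

Lemma zero_derive_const (f : R -> R) :
  (forall s : R, 0 < s -> is_derive s (1 : R) f 0) ->
  forall a b, 0 < a -> 0 < b -> f a = f b.
Proof.
move=> df; suff lt a b : 0 < a -> a < b -> f a = f b.
  move=> a b a0 b0; have [ab|ba|->//] := ltgtP a b; first exact: lt.
  by apply/esym; exact: lt.
move=> a0 ab.
have pos x : x \in `[a, b] -> 0 < x by rewrite in_itv/= => /andP[/(lt_le_trans a0)].
have [c _] : exists2 c, c \in `]a, b[ & f b - f a = 0 * (b - a).
  apply: (@MVT _ f (fun=> 0)) => //.
    by move=> x xab; apply: df; apply: pos; exact: subset_itv_oo_cc.
  by apply: derivable_within_continuous => x /pos /df [].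
by rewrite mul0r => /eqP; rewrite subr_eq0 => /eqP.
Qed.

Lemma linear_ode_const (f h H : R -> R) :
  (forall s : R, 0 < s -> is_derive s (1 : R) f (- (h s * f s))) ->
  (forall s : R, 0 < s -> is_derive s (1 : R) H (h s)) ->
  forall a b, 0 < a -> 0 < b -> f a * expR (H a) = f b * expR (H b).
Proof.
move=> df dH; apply: zero_derive_const => s s0.
have d1 : is_derive s (1 : R) (fun s => expR (H s)) (expR (H s) * h s).
  exact: (is_derive1_comp (is_derive_expR _) (dH s s0)).
by apply: (is_derive_eq (is_derive1M (df s s0) d1)); ring.
Qed.

(** f e^H is constant on s > 0, and its value is read off along s = 1/(n+1). *)
Lemma linear_ode_sol (f h H : R -> R) (H0 : R) :
  (forall s : R, 0 < s -> is_derive s (1 : R) f (- (h s * f s))) ->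
  (forall s : R, 0 < s -> is_derive s (1 : R) H (h s)) ->
  f n.+1%:R^-1 @[n --> \oo] --> (1 : R) -> H n.+1%:R^-1 @[n --> \oo] --> H0 ->
  forall s : R, 0 < s -> f s = expR (H0 - H s).
Proof.
move=> df dH f1 cH s s0.
have eH : expR (H n.+1%:R^-1) @[n --> \oo] --> expR H0.
  by have := continuous_cvg _ (@continuous_expR R _) cH; apply.
have : f s * expR (H s) = 1 * expR H0.
  have A : f n.+1%:R^-1 * expR (H n.+1%:R^-1) @[n --> \oo] --> 1 * expR H0 by exact: cvgM.
  have B : f n.+1%:R^-1 * expR (H n.+1%:R^-1) @[n --> \oo] --> f s * expR (H s).
    under eq_fun do rewrite (linear_ode_const df dH _ s0) ?invr_gt0//.
    exact: cvg_cst.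
  exact: (cvg_unique _ B A).
by rewrite mul1r expRD expRN => <-; rewrite mulfK ?gt_eqF ?expR_gt0.
Qed.

(** The solutions are multiples of (s + c)^(-l). For c = 0 such a function is unbounded near 0,
    against f <= 1, so c is positive. *)
Lemma linear_ode_log (f : R -> R) (l c : R) : 0 < l -> 0 <= c ->
  (forall s : R, 0 < s -> is_derive s (1 : R) f (- (l / (s + c) * f s))) ->
  (forall s, 0 < s -> 0 < f s <= 1) ->
  f n.+1%:R^-1 @[n --> \oo] --> (1 : R) ->
  0 < c /\ forall s, 0 < s -> f s = (c / (c + s)) `^ l.
Proof.
move=> l0 c0 df fb f1.
have dH (s : R) : 0 < s -> is_derive s (1 : R) (fun s => l * ln (s + c)) (l / (s + c)).
  move=> s0; have sc : 0 < s + c by exact: ltr_pwDl.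
  have d1 : is_derive s (1 : R) (fun s => ln (s + c)) ((s + c)^-1 * 1).
    apply: (is_derive1_comp (f := @ln R)); first exact: is_derive1_ln.
    by apply: is_derive_eq; rewrite addr0.
  apply: (is_derive_eq (is_derive1M (f := fun=> l) (is_derive_cst _ _ _) d1)).
  by rewrite mulr0 addr0 mulr1.
have c1 : 0 < c.
  rewrite lt_neqAle c0 andbT; apply/eqP => cE.
  pose C := f 1 * expR (l * ln (1 + c)).
  have C0 : 0 < C by rewrite mulr_gt0 ?expR_gt0//; case/andP: (fb 1 ltr01).
  (* At this s one has l ln s = ln C - l, so C s^(-l) = e^l exceeds 1. *)
  pose s := expR (ln C / l - 1); have s0 : 0 < s by exact: expR_gt0.
  have := linear_ode_const df dH s0 ltr01; rewrite -/C -cE addr0 expRK => E.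
  have [_ fs] := andP (fb s s0).
  have : C < C.
    rewrite -{1}E; apply: le_lt_trans (_ : _ <= expR (l * (ln C / l - 1))) _.
      by rewrite ler_piMl// expR_ge0.
    rewrite -[ltRHS]lnK ?posrE// ltr_expR mulrBr mulr1 mulrC divfK ?gt_eqF//.
    by rewrite gtrBl.
  by rewrite ltxx.
split=> // s s0.
have cH : l * ln (n.+1%:R^-1 + c) @[n --> \oo] --> l * ln c.
  apply: cvgM; first exact: cvg_cst.
  have h : n.+1%:R^-1 + c @[n --> \oo] --> (0 + c : R).
    by apply: cvgD; [exact: (@cvg_harmonic R)|exact: cvg_cst].
  rewrite add0r in h.
  by have := continuous_cvg _ (continuous_ln c1) h; apply.
rewrite (linear_ode_sol df dH f1 cH s0) -mulrBr /powR.
have cs : 0 < c + s by exact: addr_gt0.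
by rewrite mulf_eq0 invr_eq0 !gt_eqF//= ln_div ?posrE// [s + c]addrC.
Qed.

End exponential_solutions.

Section independence.
Context {R : realType} {d} {T : measurableType d} (P : probability T R).

Definition indep (U W : T -> R) : Prop := forall A B, measurable A -> measurable B ->
  P (U @^-1` A `&` W @^-1` B) = (P (U @^-1` A) * P (W @^-1` B))%E.

Lemma indep_Rintegral (U W : T -> R) (f g : R -> R) :
  measurable_fun setT U -> measurable_fun setT W -> indep U W ->
  measurable_fun setT f -> measurable_fun setT g ->
  (forall x, 0 <= f x) -> (forall x, 0 <= g x) ->
  P.-integrable setT (EFin \o (fun w => f (U w))) ->
  P.-integrable setT (EFin \o (fun w => g (W w))) ->
  \int[P]_w (f (U w) * g (W w)) = (\int[P]_w f (U w)) * (\int[P]_w g (W w)).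
Proof.
move=> mU mW UW mf mg f0 g0 fi gi.
have mUW : measurable_fun setT (fun w => (U w, W w)) by exact: measurable_fun_pair.
pose PU := distribution P (mfun_of mU); pose PW := distribution P (mfun_of mW).
pose h (z : R * R) := (f z.1 * g z.2)%:E.
have mh : measurable_fun setT h.
  apply/measurable_EFinP; apply: measurable_funM.
    by apply: (measurableT_comp mf); exact: measurable_fst.
  by apply: (measurableT_comp mg); exact: measurable_snd.
have h0 z : (0 <= h z)%E by rewrite lee_fin mulr_ge0.
rewrite /Rintegral -fineM; [|exact: integrable_fin_num..].
congr fine; rewrite -(ge0_integral_law P mUW mh h0).
transitivity (\int[prodP PU PW]_z h z)%E.
  apply: eq_measure_integral => A mA _.
  apply: rectangle_measure_unique => // [|B C mB mC].
    rewrite restr_lawE setIT; apply: (@le_lt_trans _ _ 1%E); last exact: ltry.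
    exact/probability_le1/measurable_preimage.
  rewrite restr_lawE setIT; apply: etrans (esym (prodPE PU PW mB mC)).
  exact: UW.
rewrite ge0_integral_prodP//.
transitivity (\int[PU]_x ((f x)%:E * \int[PW]_y (g y)%:E))%E.
  apply: eq_integral => x _; rewrite -ge0_integralZl//.
  - by apply/measurable_EFinP.
  - by move=> y _; rewrite lee_fin.
  - by rewrite lee_fin.
rewrite ge0_integralZr//; last 3 first.
- by apply/measurable_EFinP.
- by move=> y _; rewrite lee_fin.
- by apply: integral_ge0 => y _; rewrite lee_fin.
rewrite (ge0_integral_distribution (mfun_of mU)) ?(ge0_integral_distribution (mfun_of mW))//.
- by apply/measurable_EFinP.
- by apply/measurable_EFinP.
Qed.

End independence.

Section dirac_laplace.
Context {R : realType}.
Lemma laplace_dirac (a s : R) : 0 < a -> laplace (\d_a : probability R R) s = (expR (- (s * a)))%:E.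
Proof.
move=> a0; rewrite /laplace integral_dirac//.
  by rewrite diracE mem_set ?mul1e//= in_itv/= a0.
apply/measurable_EFinP; apply: measurable_funTS; apply: measurableT_comp; first exact: measurable_expR.
by apply: measurableT_comp => //; exact: measurable_funM.
Qed.
End dirac_laplace.

(** * Differential equations from the moment identities *)

Section moment_equations.
Context {R : realType}.
(** [x k] and [z k] stand for the exponential moments of X and of S = X + Y, [y] for the transform
    of Y, [m k] for E[B^k] with B = X / S. Then [xy] is the identity X^k e^(-sX) e^(-sY) = B^k S^k
    e^(-sS), averaged using independence of X, Y and of S, B. *)
Variables (x z : nat -> R -> R) (y : R -> R) (m : nat -> R).
Hypotheses (dx : forall k (s : R), 0 < s -> is_derive s (1 : R) (x k) (- x k.+1 s))
  (dz : forall k (s : R), 0 < s -> is_derive s (1 : R) (z k) (- z k.+1 s))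
  (x0 : forall k (s : R), 0 < s -> 0 < x k s)
  (z0 : forall k (s : R), 0 < s -> 0 < z k s)
  (xy : forall k (s : R), 0 < s -> x k s * y s = m k * z k s)
  (m0 : m 0 = 1) (m1_lt1 : m 1 < 1) (m_gt0 : forall k, 0 < m k)
  (x_le1 : forall s : R, 0 < s -> x 0 s <= 1) (z_le1 : forall s : R, 0 < s -> z 0 s <= 1)
  (x1 : x 0 n.+1%:R^-1 @[n --> \oo] --> (1 : R))
  (z1 : z 0 n.+1%:R^-1 @[n --> \oo] --> (1 : R)).

Lemma is_derive_pos0 (f : R -> R) (a s : R) : (forall u, 0 < u -> f u = 0) -> 0 < s ->
  is_derive s (1 : R) f a -> a = 0.
Proof.
move=> f0 s0 df; have [_ <-] := df.
rewrite (near_eq_derive (g := cst 0)); first by rewrite derive_cst.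
by near=> u; apply: f0; near: u; exact: lt_nbhsr.
Unshelve. all: end_near. Qed.

(** The case k = 0 of [xy] gives y = z 0 / x 0, which eliminates y from the others. *)
Lemma xz_ratio k s : 0 < s -> x k s * z 0 s = m k * z k s * x 0 s.
Proof.
move=> s0; have zE : z 0 s = x 0 s * y s by rewrite xy// m0 mul1r.
by rewrite zE mulrCA xy// mulrC.
Qed.

(* The derivative of the first moment identity, with the second one substituted. *)
Lemma second_moment s : 0 < s ->
  (m 1 - m 2) * (z 2 s * z 0 s) = (m 1 - m 1 ^+ 2) * z 1 s ^+ 2.
Proof.
move=> s0.
have zero u : 0 < u -> x 1 u * z 0 u + (- m 1) * (z 1 u * x 0 u) = 0.
  by move=> u0; rewrite xz_ratio//; ring.
have D : is_derive s (1 : R) (fun u => x 1 u * z 0 u + (- m 1) * (z 1 u * x 0 u))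
    (x 1 s * - z 1 s + z 0 s * - x 2 s +
     ((- m 1) * (z 1 s * - x 1 s + x 0 s * - z 2 s) + (z 1 s * x 0 s) * 0)).
  apply: is_deriveD; first exact: is_derive1M (dx 1 s0) (dz 0 s0).
  apply: (is_derive1M (f := fun=> - m 1)).
  exact: is_derive1M (dz 1 s0) (dx 0 s0).
have E := is_derive_pos0 zero s0 D.
have h1 := xz_ratio 1 s0; have h2 := xz_ratio 2 s0.
have nz : x 0 s != 0 by rewrite gt_eqF// x0.
apply: (mulIf nz).
transitivity (z 0 s * (m 1 * (z 2 s * x 0 s) - m 2 * z 2 s * x 0 s)); first by ring.
rewrite -h2.
have -> : m 1 * (z 2 s * x 0 s) - x 2 s * z 0 s = (1 - m 1) * (z 1 s * x 1 s).
  by move: E; lra.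
transitivity ((1 - m 1) * z 1 s * (x 1 s * z 0 s)); first by ring.
by rewrite h1; ring.
Qed.

Let K := (m 1 - m 1 ^+ 2) / (m 1 - m 2).

(* [z 0 / z 1] has constant derivative [K - 1]. *)
Lemma ratio_affine : exists k b : R,
  [/\ 0 <= k, 0 <= b & forall s : R, 0 < s -> z 0 s = (k * s + b) * z 1 s].
Proof.
have nz k (s : R) : 0 < s -> z k s != 0 by move=> s0; rewrite gt_eqF// z0.
(* If m 1 = m 2, the second moment identity makes m 1 equal to its square, against 0 < m 1 < 1. *)
have m12 : m 1 - m 2 != 0.
  apply/eqP => E; have := second_moment ltr01; rewrite E mul0r => /esym/eqP.
  rewrite mulf_eq0 sqrf_eq0 (negbTE (nz 1%N 1 ltr01)) orbF expr2 -{1}[m 1]mulr1 -mulrBr.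
  by rewrite mulf_eq0 !gt_eqF// subr_gt0.
have z20 (s : R) : 0 < s -> z 2 s * z 0 s = K * z 1 s ^+ 2.
  have KE : (m 1 - m 2) * K = m 1 - m 1 ^+ 2 by rewrite mulrC divfK.
  by move=> s0; apply: (mulfI m12); rewrite second_moment// -KE [RHS]mulrA.
have dq (s : R) : 0 < s -> is_derive s (1 : R) (fun s => z 0 s * (z 1 s)^-1 + (1 - K) * s) 0.
  move=> s0.
  have d1 : is_derive s (1 : R) (fun s => (1 - K) * s) ((1 - K) * 1 + s * 0).
    exact: (is_derive1M (f := fun=> 1 - K)).
  have d2 := is_derive1M (dz 0 s0) (is_derive1V (nz 1%N s s0) (dz 1 s0)).
  apply: (is_derive_eq (is_deriveD d2 d1)).
  have -> : z 0 s * (- - z 2 s / z 1 s ^+ 2) = (z 2 s * z 0 s) / z 1 s ^+ 2 by ring.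
  by rewrite z20// mulfK ?expf_neq0 ?nz// mulrN mulVf ?nz//; ring.
pose k := K - 1; pose b := z 0 1 / z 1 1 - k.
have q (s : R) : 0 < s -> z 0 s / z 1 s = k * s + b.
  move=> s0; have := zero_derive_const dq s0 ltr01; rewrite mulr1 /b /k => E.
  by apply/eqP; rewrite -subr_eq0; apply/eqP; move: E; lra.
have q0 (s : R) : 0 < s -> 0 < k * s + b by move=> s0; rewrite -q// divr_gt0 ?z0.
have k0 : 0 <= k.
  rewrite leNgt; apply/negP => k0.
  have bk : 0 < k + b by have := q0 1 ltr01; rewrite mulr1.
  (* This number is -b / k, the root of k s + b, where [q0] fails. *)
  have s0 : 0 < 1 - (k + b) / k by rewrite subr_gt0 (lt_trans _ ltr01)// pmulr_rlt0// invr_lt0.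
  have := q0 _ s0; rewrite mulrBr mulr1 mulrCA mulfV ?lt_eqF// mulr1; lra.
exists k, b; split=> //.
- rewrite leNgt; apply/negP => b0.
  have {}k0 : 0 < k by have := q0 1 ltr01; rewrite mulr1; lra.
  have s0 : 0 < - b / k by rewrite divr_gt0// oppr_gt0.
  by have := q0 _ s0; rewrite mulrCA mulfV ?gt_eqF// mulr1 addNr ltxx.
- by move=> s s0; rewrite -q// divfK ?nz.
Qed.

(** The derivatives are - z 0 / (k s + b) for z 0 and - m 1 x 0 / (k s + b) for x 0. A zero slope k
    gives exponentials, the Dirac case. Otherwise c = b / k, and the exponents 1 / k and m 1 / k are
    l1 + l2 and l1. *)
Lemma moment_solutions :
  (exists a b : R, [/\ 0 < a, 0 < b,
     forall s : R, 0 < s -> x 0 s = expR (- (s * a)) &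
     forall s : R, 0 < s -> z 0 s = expR (- (s * b))]) \/
  exists l1 l2 c : R, [/\ 0 < l1, 0 < l2, 0 < c,
     forall s : R, 0 < s -> z 0 s = (c / (c + s)) `^ (l1 + l2) &
     forall s : R, 0 < s -> x 0 s = (c / (c + s)) `^ l1].
Proof.
have [k [b [k0 b0 zE]]] := ratio_affine.
have xE (s : R) : 0 < s -> (k * s + b) * x 1 s = m 1 * x 0 s.
  move=> s0; have nz : z 1 s != 0 by rewrite gt_eqF// z0.
  apply: (mulIf nz); rewrite mulrAC -zE// mulrC xz_ratio//; ring.
have M0 := m_gt0 1.
move: k0; rewrite le_eqVlt => /predU1P[k0|k0].
  have {}b0 : 0 < b.
    rewrite lt_neqAle b0 andbT; apply/eqP => bE; have := zE 1 ltr01.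
    by rewrite -k0 -bE mul0r add0r mul0r => /eqP; rewrite gt_eqF ?z0.
  left; exists (m 1 / b), b^-1; split.
  - exact: divr_gt0.
  - by rewrite invr_gt0.
  - move=> s s0; rewrite -[- _]add0r.
    apply: (linear_ode_sol (f := x 0) (h := fun=> m 1 / b) (H := fun s => s * (m 1 / b)) (H0 := 0)) => //.
    + move=> u u0; apply: (is_derive_eq (dx 0 u0)); congr (- _).
      by rewrite mulrAC -xE// -k0 mul0r add0r mulrAC mulfV ?gt_eqF// mul1r.
    + move=> u u0; by apply: is_derive_eq; rewrite scaler0 add0r /GRing.scale/= mulr1.
    + rewrite -[X in _ --> X](mul0r (m 1 / b)); apply: cvgM; [exact: (@cvg_harmonic R)|exact: cvg_cst].
  - move=> s s0; rewrite -[- _]add0r.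
    apply: (linear_ode_sol (f := z 0) (h := fun=> b^-1) (H := fun s => s * b^-1) (H0 := 0)) => //.
    + move=> u u0; apply: (is_derive_eq (dz 0 u0)); congr (- _).
      by rewrite zE// -k0 mul0r add0r mulKf ?gt_eqF.
    + move=> u u0; by apply: is_derive_eq; rewrite scaler0 add0r /GRing.scale/= mulr1.
    + rewrite -[X in _ --> X](mul0r b^-1); apply: cvgM; [exact: (@cvg_harmonic R)|exact: cvg_cst].
right; have c0 : 0 <= b / k by rewrite divr_ge0// ltW.
have sc (s : R) : 0 < s -> s * k + b != 0 by move=> s0; rewrite gt_eqF// ltr_pwDl// mulr_gt0.
have [||||c1 zS] := @linear_ode_log R (z 0) k^-1 (b / k) _ c0.
- by rewrite invr_gt0.
- move=> s s0; apply: (is_derive_eq (dz 0 s0)); congr (- _).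
  by rewrite zE//; field; rewrite sc//= gt_eqF.
- by move=> s s0; rewrite z0// z_le1.
- exact: z1.
have [||||_ xS] := @linear_ode_log R (x 0) (m 1 / k) (b / k) _ c0.
- exact: divr_gt0.
- move=> s s0; apply: (is_derive_eq (dx 0 s0)); congr (- _).
  have -> : m 1 / k / (s + b / k) * x 0 s = (m 1 * x 0 s) / (s * k + b).
    by field; rewrite sc//= gt_eqF.
  by rewrite -xE// [k * s]mulrC mulrAC mulfV ?mul1r ?sc.
- by move=> s s0; rewrite x0// x_le1.
- exact: x1.
exists (m 1 / k), ((1 - m 1) / k), (b / k); split=> //.
- exact: divr_gt0.
- by rewrite divr_gt0// subr_gt0.
- by move=> s s0; rewrite zS//; congr (_ `^ _); rewrite -mulrDl addrC subrK mul1r.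
Qed.

End moment_equations.

Section lukacs.
Context {R : realType} {d} {T : measurableType d} (P : probability T R).
Variables X Y : T -> R.
Hypotheses (mX : measurable_fun setT X) (mY : measurable_fun setT Y).
Hypotheses (X0 : forall w, 0 < X w) (Y0 : forall w, 0 < Y w).
Let S w := X w + Y w.
Let B w := X w / S w.
Hypotheses (XY : indep P X Y) (SB : indep P S B).

Let mS : measurable_fun setT S. Proof. exact: measurable_funD. Qed.
Let S0 w : 0 < S w. Proof. by rewrite addr_gt0. Qed.
Let mB : measurable_fun setT B. Proof. exact: measurable_fun_divr. Qed.
Let B0 w : 0 < B w. Proof. by rewrite divr_gt0. Qed.
Let B1 w : B w < 1. Proof. by rewrite ltr_pdivrMr// mul1r ltrDl. Qed.

Let m (k : nat) : R := \int[P]_w B w ^+ k.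

Lemma ratio_moment_integrable k : P.-integrable setT (EFin \o (fun w => B w ^+ k)).
Proof.
apply: (@le_integrable _ _ R P setT _ _ (cst 1%:E)) => //.
- by apply/measurable_EFinP; exact: measurable_funX.
- move=> w _ /=; rewrite lee_fin normr1 ger0_norm ?exprn_ge0 ?(ltW (B0 w))//.
  by rewrite exprn_ile1 ?(ltW (B0 w)) ?(ltW (B1 w)).
- exact: finite_measure_integrable_cst.
Qed.

Lemma emom_prod k (s : R) : 0 < s -> emom P X k s * emom P Y 0 s = m k * emom P S k s.
Proof.
move=> s0.
(* Absolute values make the test functions nonnegative on the whole line, as [indep_Rintegral] asks;
   on positive variables they change nothing. *)
have me n : measurable_fun setT (fun x : R => `|x| ^+ n * expR (- (s * x))).
  apply: measurable_funM; first by apply: measurable_funX; exact: normr_measurable.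
  apply: measurableT_comp; first exact: measurable_expR.
  by apply: measurableT_comp => //; exact: measurable_funM.
have e0 n (x : R) : 0 <= `|x| ^+ n * expR (- (s * x)).
  by rewrite mulr_ge0 ?expR_ge0// exprn_ge0.
have nE (V : T -> R) n : (forall w, 0 < V w) ->
    (fun w => `|V w| ^+ n * expR (- (s * V w))) = (fun w => V w ^+ n * expR (- (s * V w))).
  by move=> V0; apply/funext => w; rewrite gtr0_norm.
have eX := indep_Rintegral mX mY XY (me k) (me 0%N) (e0 k) (e0 0%N).
have mp : measurable_fun setT (fun x : R => `|x| ^+ k).
  by apply: measurable_funX; exact: normr_measurable.
have p0 (x : R) : 0 <= `|x| ^+ k by rewrite exprn_ge0.
have eS := indep_Rintegral mS mB SB (me k) mp (e0 k) p0.
have pB : (fun w => `|B w| ^+ k) = (fun w => B w ^+ k).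
  by apply/funext => w; rewrite gtr0_norm.
rewrite (nE X k X0) (nE Y 0%N Y0) in eX; rewrite (nE S k S0) pB in eS.
rewrite /emom -eX; [|exact: emom_integrable..].
rewrite mulrC /m -eS; [|exact: emom_integrable|exact: ratio_moment_integrable].
apply: eq_Rintegral => w _.
rewrite (gtr0_norm (X0 w)) (gtr0_norm (Y0 w)) (gtr0_norm (S0 w)) (gtr0_norm (B0 w)).
rewrite expr0 mul1r -mulrA -expRD mulrAC -exprMn [S w * _]mulrC divfK ?gt_eqF//.
by rewrite /S mulrDr opprD.
Qed.

Let intB k : P.-integrable setT (EFin \o (fun w => B w ^+ k)) := ratio_moment_integrable k.

Lemma ratio_moment0 : m 0 = 1.
Proof.
rewrite /m (_ : (fun w => B w ^+ 0) = cst 1)//.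
by rewrite Rintegral_cst// mul1r -[RHS]/(fine 1%E) -(probability_setT P).
Qed.

Lemma ratio_moment_gt0 k : 0 < m k.
Proof. by apply: Rintegral_gt0 => // w; rewrite exprn_gt0. Qed.

Lemma ratio_moment1_lt1 : m 1 < 1.
Proof.
rewrite -subr_gt0 -ratio_moment0 /m -RintegralB//; [|exact: intB..].
apply: Rintegral_gt0 => [|w]; last by rewrite expr0 expr1 subr_gt0.
exact: (integrableB measurableT (intB 0%N) (intB 1%N)).
Qed.

Lemma lukacs :
  (is_dirac_law P X /\ is_dirac_law P S) \/
  exists l1 l2 c : R, [/\ 0 < l1, 0 < l2, 0 < c,
    forall A, measurable A -> P (S @^-1` A) = gamma_prob (l1 + l2) c A &
    forall A, measurable A -> P (X @^-1` A) = gamma_prob l1 c A].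
Proof.
have law_unique (V : T -> R) (mV : measurable_fun setT V) (q : probability R R) :
    (forall w, 0 < V w) -> q `]-oo, 0%R]%classic = 0%E ->
    (forall s : R, 0 < s -> (emom P V 0 s)%:E = laplace q s) ->
    forall A, measurable A -> P (V @^-1` A) = q A.
  move=> V0 q0 lap; apply: (@laplace_unique _ (distribution P (mfun_of mV))) => //.
    have V_le0 : V @^-1` `]-oo, 0]%classic = set0.
      by rewrite predeqE => w; split=> //=; rewrite in_itv/= leNgt V0.
    by rewrite -[RHS](measure0 P) -V_le0.
  by move=> s s0; rewrite emom0_laplace// lap.
have dirac0 (a : R) : 0 < a -> (\d_a : probability R R) `]-oo, 0%R]%classic = 0%E.
  by move=> a0; rewrite [LHS]diracE memNset//= in_itv/= leNgt a0.
have [[a [b [a0 b0 xE zE]]]|[l1 [l2 [c [l10 l20 c0 zE xE]]]]] := moment_solutions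
  (is_derive_emom P mX X0) (is_derive_emom P mS S0) (emom_gt0 P mX X0)
  (emom_gt0 P mS S0) emom_prod ratio_moment0 ratio_moment1_lt1 ratio_moment_gt0
  (emom0_le1 P mX X0) (emom0_le1 P mS S0) (emom0_cvg P mX X0) (emom0_cvg P mS S0).
  left; split; [exists a|exists b].
  - apply: (law_unique _ mX (\d_a : probability R R)) => //; first exact: dirac0.
    by move=> s s0; rewrite laplace_dirac// xE.
  - apply: (law_unique _ mS (\d_b : probability R R)) => //; first exact: dirac0.
    by move=> s s0; rewrite laplace_dirac// zE.
right; exists l1, l2, c; split=> //.
- apply: (law_unique _ mS (gammaP (addr_gt0 l10 l20) c0)) => //; first exact: gamma_prob_le0.
  by move=> s s0; rewrite laplace_gammaP// zE.
- apply: (law_unique _ mX (gammaP l10 c0)) => //; first exact: gamma_prob_le0.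
  by move=> s s0; rewrite laplace_gammaP// xE.
Qed.

End lukacs.

(** * Characterization of the invariant laws *)

Section indep_lemmas.
Context {R : realType} {d} {T : measurableType d} (P : probability T R).

Lemma indep_pair (X Y U : T -> R) (h : R * R -> R) :
  measurable_fun setT X -> measurable_fun setT Y -> measurable_fun setT U ->
  measurable_fun setT h ->
  (forall A B C, measurable A -> measurable B -> measurable C ->
     P (X @^-1` A `&` (Y @^-1` B `&` U @^-1` C)) =
     (P (X @^-1` A) * P (Y @^-1` B `&` U @^-1` C))%E) ->
  indep P X (fun w => h (Y w, U w)).
Proof.
move=> mX mY mU mh ind A B mA mB.
have mYU : measurable_fun setT (fun w => (Y w, U w)) by exact: measurable_fun_pair.
have mXYU : measurable_fun setT (fun w => (X w, (Y w, U w))).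
  exact: measurable_fun_pair.
pose m1 := restr_law P measurableT mXYU.
pose m2 := prodP (distribution P (mfun_of mX)) (distribution P (mfun_of mYU)).
have E D : measurable D -> m1 D = m2 D.
  apply: rectangle3_measure_unique.
    rewrite /m1 restr_lawE setIT; apply: (@le_lt_trans _ _ 1%E); last exact: ltry.
    exact/probability_le1/measurable_preimage.
  move=> A' B' C' mA' mB' mC'; rewrite /m1 restr_lawE setIT.
  apply: etrans (esym (prodPE _ _ mA' (measurableX mB' mC'))).
  exact: ind.
have mhB : measurable (h @^-1` B) by exact: measurable_preimage.
have := E _ (measurableX mA mhB); rewrite /m1 restr_lawE setIT => H.
exact: etrans H (prodPE _ _ mA mhB).
Qed.

Lemma indep_ae_eq (X Y X' Y' : T -> R) :
  measurable_fun setT X -> measurable_fun setT Y ->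
  measurable_fun setT X' -> measurable_fun setT Y' ->
  {ae P, forall w, X w = X' w /\ Y w = Y' w} -> indep P X Y -> indep P X' Y'.
Proof.
move=> mX mY mX' mY' XY ind A B mA mB.
have mp := measurable_preimage.
have eX : P (X' @^-1` A) = P (X @^-1` A).
  by apply: pr_ae_eq; [exact: mp..|]; apply: filterS XY => w [/= -> _].
have eY : P (Y' @^-1` B) = P (Y @^-1` B).
  by apply: pr_ae_eq; [exact: mp..|]; apply: filterS XY => w [_ /= ->].
rewrite eX eY -ind//; apply: pr_ae_eq; [by apply: measurableI; exact: mp..|].
by apply: filterS XY => w [/= -> ->].
Qed.

Lemma pair_iid_law1 (m12 m1 : probability R R) (X Y : int -> T -> R) n A :
  pair_iid P m12 m1 X Y -> measurable A -> P (X n @^-1` A) = m12 A.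
Proof.
move=> iid mA.
have := iid [:: n] [::] (fun=> A) (fun=> A) isT isT (fun=> mA) (fun=> mA).
rewrite big_seq1 big_nil mulr1 -prE// => <-; congr (P _).
apply/seteqP; split=> w /=; last by move=> [+ _]; apply; rewrite inE.
by move=> XA; split=> // k; rewrite inE => /eqP ->.
Qed.

Lemma pair_iid_law2 (m12 m1 : probability R R) (X Y : int -> T -> R) n A :
  pair_iid P m12 m1 X Y -> measurable A -> P (Y n @^-1` A) = m1 A.
Proof.
move=> iid mA.
have := iid [::] [:: n] (fun=> A) (fun=> A) isT isT (fun=> mA) (fun=> mA).
rewrite big_seq1 big_nil mul1r -prE// => <-; congr (P _).
apply/seteqP; split=> w /=; last by move=> [_ +]; apply; rewrite inE.
by move=> XA; split=> // k; rewrite inE => /eqP ->.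
Qed.

Lemma pair_iid_law12 (m12 m1 : probability R R) (X Y : int -> T -> R) n k A B :
  pair_iid P m12 m1 X Y -> measurable A -> measurable B ->
  P (X n @^-1` A `&` Y k @^-1` B) = (m12 A * m1 B)%E.
Proof.
move=> iid mA mB.
have := iid [:: n] [:: k] (fun=> A) (fun=> B) isT isT (fun=> mA) (fun=> mB).
rewrite !big_seq1 EFinM -!prE// => <-; congr (P _).
apply/seteqP; split=> w /=; last by move=> [XA YB]; split; [apply: XA|apply: YB]; rewrite inE.
by move=> [XA YB]; split=> // j; rewrite inE => /eqP ->.
Qed.

End indep_lemmas.

Section characterization.
Context {R : realType} {d} {T : measurableType d} (P : probability T R).
Variables (m12 m1 : probability R R).

(** Solvability alone bounds the partial sums by 1/U, so the perpetuity is finite and small ratios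
    recur. This is how the analysis of an unknown invariant law gets started. *)
Lemma affine_past_ratio_io (X Y : int -> T -> R) :
  (forall k, measurable_fun setT (X k)) -> (forall k, measurable_fun setT (Y k)) ->
  (forall k w, 0 < X k w) -> (forall k w, 0 < Y k w) -> pair_iid P m12 m1 X Y ->
  {ae P, forall w, exists I J U : nat -> int -> R,
     [/\ half_sol I J U, I 0%N = X^~ w & J 0%N = Y^~ w]} ->
  {ae P, forall w n (N : nat), exists2 k, (N <= k)%N &
     ratio (pastI (X^~ w) n) (pastJ (Y^~ w) n) k <= 1}.
Proof.
move=> mX mY X0 Y0 iid sol; apply: (past_ratio_io mX mY X0 Y0 iid) => n.
apply: filterS sol => w [I [J [U [h IE JE]]]].
have V0 m : 0 < (U 0%N m)^-1 by rewrite invr_gt0; have [[]] := h 0%N m.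
apply: (@le_lt_trans _ _ ((U 0%N n)^-1)%:E); last exact: ltry.
apply: pval_le => //; [by move=> k; exact: X0|by move=> k; exact: Y0|].
have I0 m : 0 < I 0%N m by have [[]] := h 0%N m.
have J0 m : 0 < J 0%N m by have [[]] := h 0%N m.
by rewrite -IE -JE; exact: (toda_affine_psum_le n I0 J0 V0 (half_affine h 0%N)).
Qed.

Lemma half_sol_ae_Vperp (X Y : int -> T -> R) :
  (forall k, measurable_fun setT (X k)) -> (forall k, measurable_fun setT (Y k)) ->
  (forall k w, 0 < X k w) -> (forall k w, 0 < Y k w) -> pair_iid P m12 m1 X Y ->
  {ae P, forall w, exists I J U : nat -> int -> R,
     [/\ half_sol I J U, I 0%N = X^~ w & J 0%N = Y^~ w]} ->
  {ae P, forall w (I J U : nat -> int -> R), half_sol I J U -> I 0%N = X^~ w ->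
     J 0%N = Y^~ w -> forall n, U 0%N n = (Vperp X Y n w)^-1}.
Proof.
move=> mX mY X0 Y0 iid sol.
apply: filterS (affine_past_ratio_io mX mY X0 Y0 iid sol) => w io I J U h IE JE n.
by rewrite /Vperp -IE -JE -(half_sol_Vperp h) ?invrK// => N; rewrite IE JE; exact: io.
Qed.

Lemma Vperp_next (X Y : int -> T -> R) n A B C :
  (forall k, measurable_fun setT (X k)) -> (forall k, measurable_fun setT (Y k)) ->
  (forall k w, 0 < X k w) -> (forall k w, 0 < Y k w) -> pair_iid P m12 m1 X Y ->
  measurable A -> measurable B -> measurable C ->
  P (X (n + 1) @^-1` A `&` (Y n @^-1` B `&` Vperp X Y n @^-1` C)) =
  (m12 A * (m1 B * P (Vperp X Y n @^-1` C)))%E.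
Proof.
move=> mX mY X0 Y0 iid mA mB mC.
have fK : cancel (fun k : nat => n + 1 + k%:Z) (fun m => `|(m - n - 1)%R|%N).
  by move=> k; lia.
have gK : cancel (fun k : nat => n + k%:Z) (fun m => `|(m - n)%R|%N) by move=> k; lia.
have nf (k : nat) : n < n + 1 + k%:Z by lia.
have ng (k : nat) : n <= n + k%:Z by lia.
have := perp_future mX mY X0 Y0 iid 1 fK gK nf ng (fun=> mA) (fun=> mB) mC.
cbv zeta; rewrite (_ : nat_event _ _ _ _ _ _ _ = X (n + 1) @^-1` A `&` Y n @^-1` B); last first.
  apply/seteqP; split=> w /=; first by move=> /(_ 0%N isT); rewrite !addr0.
  by move=> [XA YB] k; rewrite ltnS leqn0 => /eqP ->; rewrite !addr0.
rewrite (pair_iid_law12 _ _ iid mA mB) => E.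
by rewrite muleA [RHS]muleC -E setIA setIC.
Qed.

Variables X Y X1 Y1 : int -> T -> R.
Hypotheses (mX : forall k, measurable_fun setT (X k))
  (mY : forall k, measurable_fun setT (Y k))
  (mX1 : forall k, measurable_fun setT (X1 k))
  (mY1 : forall k, measurable_fun setT (Y1 k))
  (X0 : forall k w, 0 < X k w) (Y0 : forall k w, 0 < Y k w)
  (X10 : forall k w, 0 < X1 k w) (Y10 : forall k w, 0 < Y1 k w)
  (iid : pair_iid P m12 m1 X Y) (iid1 : pair_iid P m12 m1 X1 Y1)
  (step : {ae P, forall w, toda_step (X^~ w) (Y^~ w) (X1^~ w) (Y1^~ w)}).

Let X' n := X1 (- n).
Let Y' n := Y1 (- n - 1).
Let u w := (Vperp X Y 0 w)^-1.
(** This is U^0_1 recovered from the right: at mirrored site -1 the perpetuity reads I^1_k and J^1_k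
    with k >= 1 only, hence its independence of (I^1_0, J^1_0). *)
Let u' w := (Vperp X' Y' (- 1) w)^-1.

Let iid' : pair_iid P m12 m1 X' Y'.
Proof.
have gK : cancel (fun n : int => - n - 1) (fun n => - n - 1) by exact: shift_mirrorK.
exact: pair_iid_reindex (@opprK int) gK iid1.
Qed.

(* The solution read backwards from time 1 is a solution for the mirrored data,
   so its U-component is determined by the mirrored past as well. *)
Lemma step_carriers : {ae P, forall w,
  X1 0 w = Y 0 w + u w /\ Y 0 w / (Y 0 w + u w) = Y1 0 w / (Y1 0 w + u' w)}.
Proof.
have sol : {ae P, forall w, exists I J U : nat -> int -> R,
     [/\ half_sol I J U, I 0%N = X^~ w & J 0%N = Y^~ w]}.
  apply: filterS step => w [I [J [U [h IJ _ _]]]].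
  eexists; eexists; eexists; split; first exact: toda_sol_half h.
  - by apply/funext => n; have [] := IJ n.
  - by apply/funext => n; have [] := IJ n.
(* Time is shifted by one, so that the mirrored solution starts from the row at time 1. *)
pose It (I : int -> int -> R) n t := I n (t + 1).
have shift I J U : toda_sol I J U -> toda_sol (It I) (It J) (It U).
  by move=> h n t; exact: h.
have sol' : {ae P, forall w, exists I J U : nat -> int -> R,
     [/\ half_sol I J U, I 0%N = X'^~ w & J 0%N = Y'^~ w]}.
  apply: filterS step => w [I [J [U [h _ _ IJ]]]].
  eexists; eexists; eexists; split; first exact: toda_sol_half (toda_sol_mirror (shift _ _ _ h)).
  - by apply/funext => n; rewrite /It oppr0 add0r; have [] := IJ (- n).
  - by apply/funext => n; rewrite /It oppr0 add0r; have [] := IJ (- n - 1).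
apply: filterS3 step (half_sol_ae_Vperp mX mY X0 Y0 iid sol)
  (half_sol_ae_Vperp (fun=> mX1 _) (fun=> mY1 _) (fun=> X10 _) (fun=> Y10 _) iid' sol').
move=> w [I [J [U [h IJ0 _ IJ1]]]] /(_ _ _ _ (toda_sol_half h)) H.
move=> /(_ _ _ _ (toda_sol_half (toda_sol_mirror (shift _ _ _ h)))) H'.
have {H} : U 0 0 = u w.
  apply: H; first by apply/funext => n; have [] := IJ0 n.
  by apply/funext => n; have [] := IJ0 n.
have {H'} : U 1 0 = u' w.
  apply: etrans (H' _ _ (- 1)); first by [].
    by apply/funext => n; rewrite /It oppr0 add0r; have [] := IJ1 (- n).
  by apply/funext => n; rewrite /It oppr0 add0r; have [] := IJ1 (- n - 1).
move=> <- <-; have [[I00 J00 U00] [I1 J1 U1]] := h 0 0.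
have [_ JE] := IJ0 0; have [XE1 YE1] := IJ1 0.
rewrite add0r in I1 J1 U1; rewrite -JE -XE1 -YE1 I1; split=> //.
rewrite U1 J1 I1.
have [[I10 _ _] _] := h 1 0.
have z : J 0 0 + U 0 0 != 0 by rewrite gt_eqF// addr_gt0.
rewrite -mulrDl -mulrDr.
by field; rewrite z gt_eqF.
Qed.

Let mu : measurable_fun setT u.
Proof. by apply: measurable_fun_invr; exact: measurable_Vperp. Qed.

Let mu' : measurable_fun setT u'.
Proof. by apply: measurable_fun_invr; apply: measurable_Vperp => *; (exact: mX1 || exact: mY1 || exact: X10 || exact: Y10). Qed.

Let u0 w : 0 < u w. Proof. by rewrite invr_gt0 Vperp_gt0. Qed.

Let mVC C : measurable C -> measurable ((@GRing.inv R) @^-1` C).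
Proof. by move=> mC; apply: measurable_preimage => //; exact: measurable_invr. Qed.

Lemma indep_carrier : indep P (Y 0) u.
Proof.
move=> A C mA mC.
have := Vperp_next 0 mX mY X0 Y0 iid measurableT mA (mVC mC).
rewrite preimage_setT setTI probability_setT mul1e => ->.
by rewrite (pair_iid_law2 0 iid mA).
Qed.

Lemma indep_sum_ratio : indep P (fun w => Y 0 w + u w) (fun w => Y 0 w / (Y 0 w + u w)).
Proof.
pose h (z : R * R) := z.1 / (z.1 + z.2).
have mh : measurable_fun setT h.
  by apply: measurable_fun_divr => //; exact: measurable_funD.
have ind : indep P (X1 0) (fun w => h (Y1 0 w, u' w)).
  apply: indep_pair => // A B C mA mB mC.
  have mX' k : measurable_fun setT (X' k) by exact: mX1.
  have mY' k : measurable_fun setT (Y' k) by exact: mY1.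
  have X'0 k w : 0 < X' k w by exact: X10.
  have Y'0 k w : 0 < Y' k w by exact: Y10.
  have := Vperp_next (- 1) mX' mY' X'0 Y'0 iid' mA mB (mVC mC).
  have := Vperp_next (- 1) mX' mY' X'0 Y'0 iid' measurableT mB (mVC mC).
  rewrite preimage_setT setTI probability_setT mul1e => <-.
  by rewrite -(pair_iid_law1 0 iid1 mA).
apply: indep_ae_eq ind => //.
- by apply: measurableT_comp mh _; exact: measurable_fun_pair.
- exact: measurable_funD.
- by apply: measurable_fun_divr => //; exact: measurable_funD.
- by apply: filterS step_carriers => w [-> ->].
Qed.

(** Lukacs' theorem for J^0_0 and U^0_0 gives the laws of J^0_0 and of the sum. The sum is I^1_0,
    which has the law of I^0_0 by invariance. *)
Lemma toda_gamma_laws :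
  (is_dirac_law P (X 0) /\ is_dirac_law P (Y 0)) \/
  exists l1 l2 c : R, [/\ 0 < l1, 0 < l2, 0 < c,
    forall A, measurable A -> m12 A = gamma_prob (l1 + l2) c A &
    forall A, measurable A -> m1 A = gamma_prob l1 c A].
Proof.
have Slaw A : measurable A -> P ((fun w => Y 0 w + u w) @^-1` A) = m12 A.
  move=> mA; rewrite -(pair_iid_law1 0 iid1 mA); apply: pr_ae_eq.
  - by apply: measurable_preimage => //; exact: measurable_funD.
  - exact: measurable_preimage.
  - by apply: filterS step_carriers => w [/= -> _].
have [[[a aE] [b bE]]|[l1 [l2 [c [l10 l20 c0 SE YE]]]]] :=
  lukacs (mY 0) mu (Y0 0) u0 indep_carrier indep_sum_ratio.
- left; split; last by exists a.
  by exists b => A mA; rewrite -bE// Slaw// (pair_iid_law1 0 iid mA).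
- right; exists l1, l2, c; split; [exact: l10|exact: l20|exact: c0| |] => A mA.
    by rewrite -(SE _ mA) (Slaw _ mA).
  by rewrite -(YE _ mA) (pair_iid_law2 0 iid mA).
Qed.

End characterization.

Section invariant_laws.
Context {R : realType} {d} {T : measurableType d} (P : probability T R).

Lemma toda_invariant_gamma (I0 J0 : int -> {RV P >-> R}) :
  pairs_independent P (fun n => I0 n) (fun n => J0 n) ->
  pairs_identically_distributed P (fun n => I0 n) (fun n => J0 n) ->
  (forall n (A B : set R), measurable A -> measurable B ->
     P (I0 n @^-1` A `&` J0 n @^-1` B) =
     (P (I0 n @^-1` A) * P (J0 n @^-1` B))%E) ->
  ~ (is_dirac_law P (I0 0) /\ is_dirac_law P (J0 0)) ->
  toda_invariant I0 J0 ->
  exists lam1 lam2 c : R, [/\ 0 < lam1, 0 < lam2, 0 < c,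
    (forall A, measurable A -> P (I0 0 @^-1` A) = gamma_prob (lam1 + lam2) c A)
  & (forall A, measurable A -> P (J0 0 @^-1` A) = gamma_prob lam1 c A)].
Proof.
move=> ind idd prod ndirac [X1 [Y1 [step same]]].
pose m12 : probability R R := distribution P (I0 0).
pose m1 : probability R R := distribution P (J0 0).
have law n (A B : set R) : measurable A -> measurable B ->
    P (I0 n @^-1` A `&` J0 n @^-1` B) = (m12 A * m1 B)%E.
  by move=> mA mB; rewrite idd// prod.
have rect1 (X Y : int -> T -> R) n A B :
    rect_event X Y [:: n] A B = X n @^-1` A n `&` Y n @^-1` B n.
  apply/seteqP; split=> w /=; first by apply; rewrite inE.
  by move=> AB k; rewrite inE => /eqP ->.
have law1 n (A B : set R) : measurable A -> measurable B ->
    P (X1 n @^-1` A `&` Y1 n @^-1` B) = (m12 A * m1 B)%E.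
  move=> mA mB; have := same [:: n] (fun=> A) (fun=> B) (fun=> conj mA mB).
  by rewrite !rect1 => ->; exact: law.
have ind1 : pairs_independent P (fun n => X1 n) (fun n => Y1 n).
  move=> s A B us mAB; rewrite same// ind//; apply: eq_bigr => n _.
  by have [mA mB] := mAB n; rewrite law// law1.
have iid := pairs_independent_iid ind law.
have iid1 := pairs_independent_iid ind1 law1.
pose pI n := pos_version (I0 n); pose pJ n := pos_version (J0 n).
pose pX n := pos_version (X1 n); pose pY n := pos_version (Y1 n).
have mpv n (f : int -> {RV P >-> R}) : measurable_fun setT (pos_version (f n)).
  exact: measurable_pos_version.
(* Positivity of the data is read off the solution that [step] provides. *)
have pos : {ae P, forall w n, [/\ 0 < I0 n w, 0 < J0 n w, 0 < X1 n w & 0 < Y1 n w]}.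
  apply: filterS step => w [I [J [U [h IJ0 _ IJ1]]]] n.
  have [<- <-] := IJ0 n; have [<- <-] := IJ1 n.
  by have [[? ? _] _] := h n 0; have [[? ? _] _] := h n 1.
have iidp : pair_iid P m12 m1 pI pJ.
  apply: pair_iid_ae_eq iid => //; try by move=> n; exact: mpv.
  apply: filterS pos => w H; split=> n; have [? ? _ _] := H n;
    by rewrite /pI /pJ pos_versionE.
have iidp1 : pair_iid P m12 m1 pX pY.
  apply: pair_iid_ae_eq iid1 => //; try by move=> n; exact: mpv.
  apply: filterS pos => w H; split=> n; have [_ _ ? ?] := H n;
    by rewrite /pX /pY pos_versionE.
have stepp : {ae P, forall w, toda_step (pI^~ w) (pJ^~ w) (pX^~ w) (pY^~ w)}.
  apply: filterS2 pos step => w H; congr toda_step; apply/funext => n;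
    by have [? ? ? ?] := H n; rewrite /pI /pJ /pX /pY pos_versionE.
have pv0 n w (f : int -> {RV P >-> R}) : 0 < pos_version (f n) w by exact: pos_version_gt0.
have [[[a aE] [b bE]]|//] := @toda_gamma_laws _ _ _ P m12 m1 pI pJ pX pY
  (fun=> mpv _ _) (fun=> mpv _ _) (fun=> mpv _ _) (fun=> mpv _ _)
  (fun _ _ => pv0 _ _ _) (fun _ _ => pv0 _ _ _) (fun _ _ => pv0 _ _ _)
  (fun _ _ => pv0 _ _ _) iidp iidp1 stepp.
exfalso; apply: ndirac; split; [exists a|exists b] => A mA.
- by rewrite -aE// (pair_iid_law1 0 iidp mA).
- by rewrite -bE// (pair_iid_law2 0 iidp mA).
Qed.

End invariant_laws.

Unset Implicit Arguments.

Theorem theorem4p8 (R : realType) (d : measure_display) (T : measurableType d)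
    (P : probability T R) :
  (forall (lam1 lam2 c : R) (I0 J0 : int -> {RV P >-> R}),
     0 < lam1 -> 0 < lam2 -> 0 < c ->
     pairs_independent P (fun n => I0 n) (fun n => J0 n) ->
     (forall n (A B : set R), measurable A -> measurable B ->
        P (I0 n @^-1` A `&` J0 n @^-1` B) =
        (gamma_prob (lam1 + lam2) c A * gamma_prob lam1 c B)%E) ->
     toda_invariant I0 J0) /\
  (forall I0 J0 : int -> {RV P >-> R},
     pairs_independent P (fun n => I0 n) (fun n => J0 n) ->
     pairs_identically_distributed P (fun n => I0 n) (fun n => J0 n) ->
     (forall n (A B : set R), measurable A -> measurable B ->
        P (I0 n @^-1` A `&` J0 n @^-1` B) =
        (P (I0 n @^-1` A) * P (J0 n @^-1` B))%E) ->
     ~ (is_dirac_law P (I0 0) /\ is_dirac_law P (J0 0)) ->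
     toda_invariant I0 J0 ->
     exists lam1 lam2 c : R, [/\ 0 < lam1, 0 < lam2, 0 < c,
       (forall A, measurable A -> P (I0 0 @^-1` A) = gamma_prob (lam1 + lam2) c A)
     & (forall A, measurable A -> P (J0 0 @^-1` A) = gamma_prob lam1 c A)]).
Proof.
split; [exact: gamma_toda_invariant|exact: toda_invariant_gamma].
Qed.
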